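(* For $r$ large enough there exist $\gamma_0>0$ and a constant $c>0$ such that, for $0\le\gamma<\gamma_0$: if $g\in C^r(\mathbb T^2,\mathbb R)$ and $\mathcal O_{1,\gamma}(g)=0$, then $g$ is a $C^{\frac12-c\gamma}$ coboundary for $\phi_{\gamma,t}$, i.e. there exists $h\in C^{\frac12-c\gamma}(\mathbb T^2,\mathbb R)$ such that $h\circ\phi_{\gamma,t}(x)-h(x)=\int_0^tg\circ\phi_{\gamma,s}(x)\,ds$ for all $t\in\mathbb R$, $x\in\mathbb T^2$.
   Context: Fix $\varphi\in C^\infty(\mathbb T,\mathbb R)$ with $\int_{\mathbb T}\varphi=0$. For small $\gamma\ge0$ the map $F_\gamma(x,y)=(2x+y-\gamma\varphi(x),\,x+y-\gamma\varphi(x))$ of $\mathbb T^2=\mathbb R^2/\mathbb Z^2$ is Anosov; $V_\gamma$ is the unit vector field, with positive first component, spanning the stable distribution of $F_\gamma$ (it is $C^{1+\alpha}$ for some $\alpha\in(0,1)$), and $\phi_{\gamma,t}$ is the flow generated by $V_\gamma$. The flow is uniquely ergodic, and $\mathcal O_{1,\gamma}$ denotes the leading obstruction, which is a nonzero multiple of the unique $\phi_{\gamma,t}$-invariant probability measure. *)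

(* Defs.v *)
From HB Require Import structures.
From mathcomp Require Import all_boot all_order all_algebra.
From mathcomp Require Import all_classical all_reals all_analysis.
Import Order.TTheory GRing.Theory Num.Theory.
Import numFieldNormedType.Exports.

Set Implicit Arguments.
Unset Strict Implicit.
Unset Printing Implicit Defensive.

Local Open Scope classical_set_scope.
Local Open Scope ring_scope.

(* The torus T^2 = R^2/Z^2 is handled through its universal cover: functions
   and line fields on T^2 are Z^2-periodic objects on R * R, Borel sets of T^2
   are Z^2-periodic Borel sets, and self-maps of T^2 are given by lifts.
   The norm `|_| on R * R is the max norm; this only
   affects constants, except in [unit_stable_field], where the Euclidean norm
   is written out. *)

Definition lattice (R : realType) (k l : int) : R * R := (k%:~R, l%:~R).

Definition periodic2 (R : realType) (T : Type) (f : R * R -> T) : Prop :=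
  forall (k l : int) (x : R * R), f (x + lattice R k l) = f x.

Definition equivariant2 (R : realType) (f : R * R -> R * R) : Prop :=
  forall (k l : int) (x : R * R),
    f (x + lattice R k l) = f x + lattice R k l.

(* phi in C^oo(R/Z, R), as a 1-periodic function on R. *)
Definition smooth_circle (R : realType) (phi : R -> R) : Prop :=
  (forall x, phi (x + 1) = phi x) /\
  (forall (n : nat) (x : R), derivable (derive1n n phi) x 1).

(* For a = 0 this is boundedness of the oscillation, which is automatic for
   continuous periodic functions. *)
Definition holder (R : realType) (a : R) (f : R * R -> R) : Prop :=
  continuous f /\
  exists M : R, forall x y : R * R, `|f x - f y| <= M * `|x - y| `^ a.

(* All partial derivatives up to order k exist and are continuous, those of
   order k being moreover a-Hoelder. *)
Fixpoint Ck_holder (R : realType) (a : R) (k : nat) (f : R * R -> R) : Prop :=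
  if k is k'.+1 then
    [/\ continuous f,
        forall x, derivable f x (1, 0) /\ derivable f x (0, 1),
        Ck_holder a k' ('D_((1, 0) : R * R) f) &
        Ck_holder a k' ('D_((0, 1) : R * R) f)]
  else holder a f.

(* C^s(T^2, R) for real s >= 0, i.e. C^{k,a} with k the integral part and a
   the fractional part of s; in particular C^k has its usual meaning for
   integral k. The class is empty for s < 0. *)
Definition C_torus (R : realType) (s : R) (f : R * R -> R) : Prop :=
  [/\ 0 <= s, periodic2 f &
      Ck_holder (s - (Num.truncn s)%:R) (Num.truncn s) f].

(* Lift to R^2 of the map F_gamma of T^2. *)
Definition Fmap (R : realType) (phi : R -> R) (gamma : R) (p : R * R) : R * R :=
  (2 * p.1 + p.2 - gamma * phi p.1, p.1 + p.2 - gamma * phi p.1).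

(* Expansion along Eu is phrased with forward iterates: by invariance of Eu it
   is the same as contraction along Eu by the iterates of F^-1. *)
Definition anosov_splitting (R : realType) (F : R * R -> R * R)
    (Es Eu : R * R -> {vspace (R * R)}) : Prop :=
  [/\ periodic2 Es /\ periodic2 Eu,
      forall x, (Es x :&: Eu x)%VS = 0%VS /\ (Es x + Eu x)%VS = fullv,
      forall x, (linfun ('d F x) @: Es x)%VS = Es (F x) /\
                (linfun ('d F x) @: Eu x)%VS = Eu (F x) &
      exists C lambda : R,
        [/\ 0 < C, 0 < lambda < 1,
            forall (n : nat) x v, v \in Es x ->
              `|'d (iter n F) x v| <= C * lambda ^+ n * `|v| &
            forall (n : nat) x v, v \in Eu x ->
              `|v| <= C * lambda ^+ n * `|'d (iter n F) x v|]].

Definition unit_stable_field (R : realType) (F V : R * R -> R * R) : Prop :=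
  exists Es Eu : R * R -> {vspace (R * R)},
    anosov_splitting F Es Eu /\
    forall x, [/\ (V x).1 ^+ 2 + (V x).2 ^+ 2 = 1, 0 < (V x).1 &
                  Es x = <[V x]>%VS].

(* Lift to R^2 of the flow on T^2 generated by V. *)
Definition flow_generated_by (R : realType) (V : R * R -> R * R)
    (Phi : R -> R * R -> R * R) : Prop :=
  [/\ forall x, Phi 0 x = x,
      forall s t x, Phi (s + t) x = Phi s (Phi t x),
      continuous (fun p : R * (R * R) => Phi p.1 p.2),
      forall t, equivariant2 (Phi t) &
      forall t x, is_derive t (1 : R) (fun s => Phi s x) (V (Phi t x))].

(* A Borel probability measure on T^2 is represented by any probability mu on
   R^2 projecting to it; the projection is determined by the values of mu on
   Z^2-periodic Borel sets, and it is invariant under the flow induced by Phi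
   on T^2 iff the following holds. *)
Definition invariant_torus_probability (R : realType)
    (Phi : R -> R * R -> R * R) (mu : probability (R * R)%type R) : Prop :=
  forall (t : R) (A : set (R * R)), measurable A -> periodic2 A ->
    mu (Phi t @^-1` A) = mu A.

(* O is a nonzero multiple of an invariant probability measure of the flow.
   Since the flow is uniquely ergodic this measure is the unique one, and it
   is not necessary to mention its uniqueness. *)
Definition leading_obstruction (R : realType) (Phi : R -> R * R -> R * R)
    (O : (R * R -> R) -> R) : Prop :=
  exists (kappa : R) (mu : probability (R * R)%type R),
    [/\ kappa != 0, invariant_torus_probability Phi mu &
        forall g : R * R -> R, continuous g -> periodic2 g ->
          O g = kappa * \int[mu]_(x in [set: R * R]) g x].

Definition oriented_integral (R : realType) (f : R -> R) (t : R) : R :=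
  if 0 <= t then \int[lebesgue_measure]_(s in `[0, t]) f s
  else - \int[lebesgue_measure]_(s in `[t, 0]) f s.

Definition coboundary (R : realType) (s : R) (Phi : R -> R * R -> R * R)
    (g : R * R -> R) : Prop :=
  exists h : R * R -> R, C_torus s h /\
    forall (t : R) (x : R * R),
      h (Phi t x) - h x = oriented_integral (fun s => g (Phi s x)) t.

(* Main.v *)
(* In eigen-coordinates of the linear map, reparametrise the stable flow by the second coordinate:
   Psi. The map F sends leaves to leaves, and corrected along the leaves it conjugates Psi_(lam t)
   to Psi_t. Hence, for the average J G = (1/L) int_0^L G o Psi_r dr with L = lam^N, the integral of
   G along a leaf differs from that of the renormalised R G = L (J (J G)) o F^(-N) by a bounded
   function of the end points.
   Since (1/L, L) is a lattice vector, moving by L along a leaf is, up to a small error, moving by 1/L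
   across the leaves on the torus; so averaging flattens G, and interpolation between the increments
   over such small steps and the 4/5-Hoelder regularity of G across the leaves shows that R G is
   either of one sign or smaller than G by a factor q with q sqrt(2 L) <= 1/2.
   If some iterate R^n G has one sign, leaf integrals grow linearly, which is impossible when the mean
   of g vanishes. Otherwise the corrections sum up to a transfer function, which is 1/2-Hoelder because
   F^N expands by at most 2 L across the leaves.
   No differentiability of the stable field is needed: the fixed-point equation of its slope gives
   Lipschitz and four-point bounds of size O(gamma), and these pass to Psi by Gronwall estimates. *)
Require Import Defs.
From HB Require Import structures.
From mathcomp Require Import all_boot all_order all_algebra.
From mathcomp Require Import all_classical all_reals all_analysis.
From mathcomp Require Import ring lra.
Import Order.TTheory GRing.Theory Num.Theory.
Import numFieldNormedType.Exports.

Set Implicit Arguments.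
Unset Strict Implicit.
Unset Printing Implicit Defensive.

Local Open Scope classical_set_scope.
Local Open Scope ring_scope.

(** * Mean value and Gronwall estimates, oriented integrals *)

Section Calculus.
Context {R : realType}.
Implicit Types (f g df : R -> R) (a b x C : R).

(** The exponent 4/5 is constrained from two sides. Let four-point bounds carry an exponent alpha.
    The lattice vector (1/m, m) turns a transverse step 1/m into a leaf translation by -m, under
    which an average changes by about m/L^2. Dividing by the step, the transverse Lipschitz constant
    drops by the factor (m/L)^2 + m^(-alpha). The best choice m = L^(2/(2+alpha)) gives L^(-2
    alpha/(2+alpha)). This must beat L^(-1/2), the price of interpolating sup and Lipschitz bounds
    of the transfer function, hence alpha > 2/3. On the other hand the equation of the stable slope
    multiplies four-point bounds by about lam^(1+alpha)/lam^2, a contraction only for alpha < 1.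
    With alpha = 4/5 all scales are integral powers of one large number th: L = th^7, m = th^5,
    factor th^(-4). Two averages are taken because the first flattens G only across leaves;
    averaging the flattened function then makes it nearly constant over leaf pieces of length 2L,
    and such pieces, thickened slightly, cover the torus. Deviations from the linear case need only
    stay below th^(-9)/2, a bound fixed before gamma is restricted. *)

Definition der f x (d : R) := is_derive x (1 : R) f d.

Lemma der_continuous f x d : der f x d -> {for x, continuous f}.
Proof.
by move=> [fx _]; apply: differentiable_continuous; apply/derivable1_diffP.
Qed.

Lemma der_eq f x d d' : der f x d -> d = d' -> der f x d'.
Proof. by move=> H <-. Qed.

Lemma der_ext f g x d : f =1 g -> der f x d -> der g x d.
Proof. by move=> /funext ->. Qed.

Lemma der_cst (c : R) x : der (fun=> c) x 0.
Proof. exact: is_derive_cst. Qed.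

Lemma der_id x : der (fun t => t) x 1.
Proof. exact: is_derive_id. Qed.

Lemma derD f g x d e : der f x d -> der g x e -> der (fun t => f t + g t) x (d + e).
Proof. by move=> *; apply: is_deriveD. Qed.

Lemma derN f x d : der f x d -> der (fun t => - f t) x (- d).
Proof. by move=> *; apply: is_deriveN. Qed.

Lemma derB f g x d e : der f x d -> der g x e -> der (fun t => f t - g t) x (d - e).
Proof. by move=> *; apply: is_deriveB. Qed.

Lemma derM f g x d e :
  der f x d -> der g x e -> der (fun t => f t * g t) x (d * g x + f x * e).
Proof.
move=> Hf Hg; apply: der_eq; first exact: (is_deriveM Hf Hg).
by rewrite /GRing.scale /= addrC [g x * d]mulrC.
Qed.

Lemma derZ (c : R) f x d : der f x d -> der (fun t => c * f t) x (c * d).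
Proof. by move=> Hf; apply: der_eq (derM (der_cst c x) Hf) _; rewrite mul0r add0r. Qed.

Lemma der_comp f g x d e : der g x e -> der f (g x) d -> der (fun t => f (g t)) x (d * e).
Proof. by move=> Hg Hf; apply: der_eq; first exact: (is_derive1_comp Hf Hg). Qed.

Lemma der_shift f s x d : der f (x + s) d -> der (fun t => f (t + s)) x d.
Proof.
move=> H; apply: der_eq (mulr1 d); apply: (@der_comp f (fun t => t + s)) => //.
by apply: der_eq (derD (der_id x) (der_cst s x)) _; rewrite addr0.
Qed.

Definition btw a b x := ((a <= x <= b) || (b <= x <= a))%R.

Lemma mvt_abs f df a b C : (forall x, btw a b x -> der f x (df x)) ->
  (forall x, btw a b x -> `|df x| <= C) -> `|f b - f a| <= C * `|b - a|.
Proof.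
wlog ab : a b / a <= b => [H fd dC|].
  have [/H|/ltW /H H'] := leP a b; first exact.
  by rewrite distrC [`|b - a|]distrC; apply: H' => x xab; [apply: fd|apply: dC];
    rewrite /btw orbC.
move=> fd dC.
have sub x : x \in `[a, b] -> btw a b x.
  by rewrite in_itv /= /btw => ->.
have [x xab||c cab ->] := @MVT_segment R f df a b ab.
- by apply: fd; apply: sub; apply: subset_itv_oo_cc xab.
- apply: continuous_in_subspaceT => x; rewrite inE => /sub /fd; exact: der_continuous.
- by rewrite normrM ler_wpM2r // dC // sub.
Qed.

Lemma der0_cst f a b : (forall x, der f x 0) -> f a = f b.
Proof.
move=> f0; apply/eqP; rewrite -subr_eq0 -normr_le0.
by rewrite (le_trans (@mvt_abs f (fun=> 0) b a 0 _ _)) ?mul0r // => *; rewrite normr0.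
Qed.

Lemma der_unique f g df a b : (forall x, der f x (df x)) ->
  (forall x, der g x (df x)) -> f b - f a = g b - g a.
Proof.
move=> fd gd.
have E : f a - g a = f b - g b.
  apply: (@der0_cst (fun t => f t - g t)) => x.
  by apply: der_eq (derB (fd x) (gd x)) _; rewrite subrr.
lra.
Qed.

(** At a maximum point [c] of |f| the mean value inequality gives |f c| <= |f 0| + (C |f c| + D) T,
    and C T <= 1/2 absorbs the term in |f c|. Short times thus avoid exponentials, at the price of a
    factor 2. *)
Lemma sup_gronwall f df (T C D : R) : (forall t, der f t (df t)) -> 0 <= T ->
  C * T <= 1 / 2 -> (forall t, 0 <= t <= T -> `|df t| <= C * `|f t| + D) -> 0 <= C ->
  0 <= D -> forall t, 0 <= t <= T -> `|f t| <= 2 * (`|f 0| + D * T).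
Proof.
move=> fd T0 CT dfle C0 D0 t tT.
have cf : {within `[0, T], continuous (fun t => `|f t|)}.
  apply: continuous_subspaceT => x; apply: (@continuous_comp _ _ _ f (fun y : R => `|y|)).
    exact: der_continuous (fd x).
  exact: norm_continuous.
have [c] := EVT_max T0 cf; rewrite in_itv /= => cT cmax.
have {cmax} cmax s : 0 <= s <= T -> `|f s| <= `|f c|.
  by move=> sT; apply: cmax; rewrite in_itv.
suff : `|f c| <= 2 * (`|f 0| + D * T) by apply: le_trans; exact: cmax.
have H : `|f c - f 0| <= (C * `|f c| + D) * `|c - 0|.
  apply: mvt_abs => [x _|x]; first exact: fd.
  case/orP => /andP[x1 x2]; (have xT : 0 <= x <= T by apply/andP; split; lra);
    apply: le_trans (dfle x xT) _; by rewrite lerD2r ler_wpM2l // cmax.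
have H2 : (C * `|f c| + D) * `|c - 0| <= (C * `|f c| + D) * T.
  rewrite ler_wpM2l ?addr_ge0 ?mulr_ge0 // subr0 ger0_norm; lra.
have H3 : C * T * `|f c| <= 1 / 2 * `|f c| by rewrite ler_wpM2r.
have := lerB_dist (f c) (f 0).
have E : (C * `|f c| + D) * T = C * T * `|f c| + D * T by ring.
by move: H3 H2 H; rewrite E; lra.
Qed.

Lemma sup_gronwall_sym f df (T C D : R) : (forall t, der f t (df t)) -> 0 <= T ->
  C * T <= 1 / 2 -> (forall t, `|t| <= T -> `|df t| <= C * `|f t| + D) -> 0 <= C ->
  0 <= D -> forall t, `|t| <= T -> `|f t| <= 2 * (`|f 0| + D * T).
Proof.
move=> fd T0 CT dfle C0 D0 t tT.
have [t0|t0] := leP 0 t.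
  apply: (@sup_gronwall f df T C D) => //; last by rewrite t0 (le_trans (ler_norm t)).
  by move=> s /andP[s0 sT]; apply: dfle; rewrite ger0_norm.
have gd s : der (fun s => f (- s)) s (- df (- s)).
  apply: der_eq (der_comp (derN (der_id s)) (fd _)) _; lra.
have := @sup_gronwall (fun s => f (- s)) _ T C D gd T0 CT _ C0 D0 (- t).
rewrite opprK oppr0; apply; last first.
  by have := ler0_norm (ltW t0); move=> <-; rewrite normr_ge0.
by move=> s /andP[s0 sT]; rewrite normrN; apply: dfle; rewrite normrN ger0_norm.
Qed.

(** The half-line is covered by steps of length 1 / (2 C); on each of them the preceding estimate,
    with D = 0 and initial value 0, forces f = 0. *)
Lemma gronwall0_pos f df C : (forall t, der f t (df t)) ->
  (forall t, `|df t| <= C * `|f t|) -> 0 < C -> f 0 = 0 -> forall t, 0 <= t -> f t = 0.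
Proof.
move=> fd dfle C0 f0.
pose T := (2 * C)^-1.
have T0 : 0 < T by rewrite invr_gt0 mulr_gt0.
have CT : C * T <= 1 / 2.
  by rewrite /T invfM mulrCA divff ?mulr1 ?gt_eqF // div1r.
have step n : forall t, 0 <= t <= T *+ n -> f t = 0.
  elim: n => [|n IH] t; first by rewrite mulr0n -eq_le => /eqP <-.
  rewrite mulrS => /andP[t0 tn].
  have [tT|tT] := leP t (T *+ n); first by apply: IH; rewrite t0.
  have gd s : der (fun s => f (s + T *+ n)) s (df (s + T *+ n)) by apply: der_shift.
  have := @sup_gronwall _ _ T C 0 gd (ltW T0) CT _ (ltW C0) (lexx 0) (t - T *+ n).
  have -> : f (0 + T *+ n) = 0.
    by rewrite add0r; apply: IH; rewrite lexx mulrn_wge0 // ltW.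
  rewrite subrK normr0 mul0r addr0 mulr0 normr_le0 => H; apply/eqP; apply: H.
    by move=> s _; rewrite addr0.
  apply/andP; split; lra.
move=> t t0.
apply: (step (Num.truncn (t / T)).+1); rewrite t0 /= -[_ *+ _]mulr_natr -ler_pdivrMl //.
by rewrite mulrC ltW // truncnS_gt // divr_ge0 // ltW.
Qed.

Lemma gronwall0 f df C : (forall t, der f t (df t)) ->
  (forall t, `|df t| <= C * `|f t|) -> 0 < C -> f 0 = 0 -> forall t, f t = 0.
Proof.
move=> fd dfle C0 f0 t.
have [t0|t0] := leP 0 t; first exact: gronwall0_pos fd dfle C0 f0 t t0.
have gd s : der (fun s => f (- s)) s (- df (- s)).
  apply: der_eq (der_comp (derN (der_id s)) (fd _)) _; lra.
have := @gronwall0_pos (fun s => f (- s)) _ C gd _ C0 _ (- t).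
rewrite opprK oppr0; apply => //; last lra.
by move=> s; rewrite normrN.
Qed.

Lemma continuous_scale f (c d : R) : continuous f -> continuous (fun r => c * f (d * r)).
Proof.
move=> cf r; apply: (@continuous_comp _ _ _ (fun r : R => f (d * r)) (fun y : R => c * y)).
  by apply: (@continuous_comp _ _ _ (fun r : R => d * r) f); [exact: mulrl_continuous|exact: cf].
exact: mulrl_continuous.
Qed.

Notation mu := (@lebesgue_measure R).
Notation ig := (@oriented_integral R).

Lemma continuous_integrable_itv f a b : continuous f -> mu.-integrable `[a, b] (EFin \o f).
Proof.
move=> cf; apply: continuous_compact_integrable; first exact: segment_compact.
by move=> x; apply: continuous_subspaceT.
Qed.

(** A base point to the left of both 0 and t removes the distinction by the sign of t, so that one
    application of the fundamental theorem yields [der_ig]. *)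
Lemma ig_Rintegral f a t : continuous f -> a <= 0 -> a <= t ->
  ig f t = \int[mu]_(s in `[a, t]) f s - \int[mu]_(s in `[a, 0]) f s.
Proof.
move=> cf a0 at0; rewrite /oriented_integral; case: ifPn => t0.
  rewrite Rintegral_itvB ?bnd_simp //; last exact: continuous_integrable_itv.
  rewrite Rintegral_itv_obnd_cbnd //.
  by apply: integrableS (continuous_integrable_itv 0 t cf) => //;
    apply: subset_itvr; rewrite bnd_simp.
rewrite -[RHS]opprB; congr (- _); move: t0; rewrite -ltNge => /ltW t0.
rewrite Rintegral_itvB ?bnd_simp //; last exact: continuous_integrable_itv.
rewrite Rintegral_itv_obnd_cbnd //.
by apply: integrableS (continuous_integrable_itv t 0 cf) => //;
  apply: subset_itvr; rewrite bnd_simp.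
Qed.

Lemma ig0 f : ig f 0 = 0.
Proof. by rewrite /oriented_integral lexx set_itv1 Rintegral_set1. Qed.

Lemma der_ig f t : continuous f -> der (ig f) t (f t).
Proof.
move=> cf; pose a := Num.min 0 t - 1.
have a0 : a < 0 by rewrite /a; case: (leP 0 t); lra.
have at0 : a < t by rewrite /a; case: (leP 0 t); lra.
have t1 : t < t + 1 by lra.
have [/= Hd Hv] := @continuous_FTC1_closed R f a t (t + 1) t1
  (continuous_integrable_itv a (t + 1) cf) at0 (cf t).
pose F x := \int[mu]_(s in `[a, x]) f s.
have FD : der F t (f t) by split; [exact: Hd|rewrite -derive1E; exact: Hv].
have FD' : der (fun x => F x - F 0) t (f t).
  by apply: der_eq (derB FD (der_cst _ _)) _; rewrite subr0.
have near_eq : \forall x \near t, F x - F 0 = ig f x.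
  near=> x; rewrite (@ig_Rintegral f a x) // ?ltW //.
  near: x; exact: lt_nbhsr.
by apply: near_eq_is_derive near_eq FD'; rewrite oner_eq0.
Unshelve. all: by end_near. Qed.

(* Locked, because [lra] and [ring] otherwise unfold Lebesgue integrals when comparing atoms. *)
Definition itg : (R -> R) -> R -> R := locked (@oriented_integral R).

Lemma itgE : itg = @oriented_integral R.
Proof. by rewrite /itg -lock. Qed.

Lemma itg0 f : itg f 0 = 0.
Proof. by rewrite itgE ig0. Qed.

Lemma der_itg f t : continuous f -> der (itg f) t (f t).
Proof. by rewrite itgE; exact: der_ig. Qed.

Lemma itg_primitive f g t : continuous f -> (forall x, der g x (f x)) ->
  itg f t = g t - g 0.
Proof.
move=> cf gd; have := @der_unique (itg f) g f 0 t (fun x => der_itg x cf) gd.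
by rewrite itg0 subr0.
Qed.

Lemma itg_le f t C : continuous f -> (forall r, btw 0 t r -> `|f r| <= C) ->
  `|itg f t| <= C * `|t|.
Proof.
move=> cf fC; rewrite -[itg f t]subr0 -(itg0 f) -{2}[t]subr0.
by apply: (@mvt_abs _ f) => // r _; apply: der_itg.
Qed.

End Calculus.

(** * The modulus |d|^(4/5) and four-point bounds *)

Section Modulus.
Context {R : realType}.
Implicit Types (x y d K l : R) (u : R -> R).

Definition wmod d : R := `|d| `^ (4 / 5).

Lemma wmod_ge0 d : 0 <= wmod d. Proof. exact: powR_ge0. Qed.

Lemma wmod_mono x y : `|x| <= `|y| -> wmod x <= wmod y.
Proof. by move=> xy; apply: ge0_ler_powR; rewrite ?nnegrE //; lra. Qed.

Lemma wmodM x y : wmod (x * y) = wmod x * wmod y.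
Proof. by rewrite /wmod normrM powRM. Qed.

Lemma wmod_norm x : wmod `|x| = wmod x.
Proof. by rewrite /wmod normr_id. Qed.

Lemma wmod_ge x : `|x| <= 1 -> `|x| <= wmod x.
Proof.
have [->|x0] := eqVneq x 0; first by rewrite normr0 wmod_ge0.
move=> x1; rewrite -{1}[`|x|]powRr1 // /wmod ger_powR ?x1 ?normr_gt0 ?x0 //; lra.
Qed.

Lemma wmod_ge1 x : 1 <= `|x| -> 1 <= wmod x.
Proof.
move=> x1; apply: (@le_trans _ _ (1 `^ (4 / 5))); first by rewrite powR1.
by apply: ge0_ler_powR; rewrite ?nnegrE //; lra.
Qed.

Lemma wmod_le l x : `|x| <= l -> 1 <= l -> wmod x <= l.
Proof.
move=> xl l1; have l0 : 0 <= l by lra.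
apply: (@le_trans _ _ (wmod l)); first by apply: wmod_mono; rewrite [`|l|]ger0_norm.
rewrite -{2}[l]powRr1 // /wmod ger0_norm // ler_powR //; lra.
Qed.

(** For |d| <= 1 the linear bound lies below the power bound, and for |d| > 1 the sup bound
    suffices. A bounded Lipschitz function thereby acquires the modulus [wmod]. *)
Lemma wmod_interp K x d : `|x| <= K -> `|x| <= K * `|d| -> `|x| <= K * wmod d.
Proof.
move=> xK xd; have K0 : 0 <= K by apply: le_trans xK.
have [d1|d1] := leP `|d| 1.
  by apply: le_trans xd _; rewrite ler_wpM2l // wmod_ge.
apply: le_trans xK _; rewrite ler_peMr // wmod_ge1 //; exact: ltW.
Qed.

Lemma wmod_expV (th : R) : 0 < th -> wmod (th ^- 5) = th ^- 4.
Proof.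
move=> th0; rewrite /wmod ger0_norm ?invr_ge0 ?exprn_ge0 ?ltW //.
rewrite -!powR_mulrn ?ltW // -!powRN -powRrM.
by congr (_ `^ _); lra.
Qed.

(* The four-point condition stands for a 4/5-Hoelder derivative of u, without assuming u differentiable. *)
Definition reg1 K u := [/\ forall a, `|u a| <= K,
  forall a d, `|u (a + d) - u a| <= K * `|d| &
  forall a d d', `|u (a + d + d') - u (a + d) - u (a + d') + u a| <= K * `|d| * wmod d'].

Lemma reg1_ge0 K u : reg1 K u -> 0 <= K.
Proof. by move=> [/(_ 0) H _ _]; apply: le_trans H. Qed.

Lemma reg1_le K K' u : K <= K' -> reg1 K u -> reg1 K' u.
Proof.
move=> KK [H1 H2 H3]; split=> [a|a d|a d d'].
- exact: le_trans KK.
- by apply: le_trans (H2 _ _) _; rewrite ler_wpM2r.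
- by apply: le_trans (H3 _ _ _) _; rewrite !ler_wpM2r ?wmod_ge0.
Qed.

(** The four points need not form a parallelogram: [x10 + x01 - x00] completes one, and the
    Lipschitz bound pays for its distance to [x11]. [K1] and [K2] are kept apart because averaging
    makes the Lipschitz constant much smaller than the four-point constant. *)
Lemma reg1_four K1 K2 u x11 x10 x01 x00 :
  (forall a d, `|u (a + d) - u a| <= K1 * `|d|) ->
  (forall a d d', `|u (a + d + d') - u (a + d) - u (a + d') + u a| <= K2 * `|d| * wmod d') ->
  `|u x11 - u x10 - u x01 + u x00| <=
  K2 * `|x10 - x00| * wmod (x01 - x00) + K1 * `|x11 - x10 - x01 + x00|.
Proof.
move=> H1 H2.
have := H2 x00 (x10 - x00) (x01 - x00).
have := H1 (x00 + (x10 - x00) + (x01 - x00)) (x11 - x10 - x01 + x00).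
have -> : x00 + (x10 - x00) + (x01 - x00) + (x11 - x10 - x01 + x00) = x11 by ring.
have -> : x00 + (x10 - x00) = x10 by ring.
have -> : x00 + (x01 - x00) = x01 by ring.
set y := u (x10 + _) => h1 h2.
have -> : u x11 - u x10 - u x01 + u x00 = (y - u x10 - u x01 + u x00) + (u x11 - y) by ring.
by apply: le_trans (ler_normD _ _) _; lra.
Qed.

(* The increment u(d) - u(0) is compared with m increments of size d/k, m = floor(ak/d),
   whose sum is u(a) - u(0) up to an error that disappears as k grows. *)
Lemma lip_of_coarse_increment K u (a U A : R) : 0 < a -> 0 <= K ->
  (forall s d, `|u (s + d) - u s| <= A * `|d|) ->
  (forall s d d', `|u (s + d + d') - u (s + d) - u (s + d') + u s| <= K * `|d| * wmod d') ->
  (forall s, `|u (s + a) - u s| <= U) ->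
  forall s d, `|u (s + d) - u s| <= (U / a + K * wmod a) * `|d|.
Proof.
move=> a0 K0 uA uK uU.
have A0 : 0 <= A by move: (uA 0 1); rewrite normr1 mulr1; apply/le_trans/normr_ge0.
have U0 : 0 <= U by apply: le_trans (uU 0).
suff pos s d : 0 < d -> `|u (s + d) - u s| <= (U / a + K * wmod a) * d.
  move=> s d; have [d0|d0|<-] := ltgtP 0 d.
  - by rewrite (gtr0_norm d0) pos.
  - have := pos (s + d) (- d); rewrite addrK distrC (ltr0_norm d0); apply; lra.
  - by rewrite addr0 subrr !normr0 mulr0.
have mult t e m : 0 < e -> e *+ m <= a ->
    m%:R * `|u (t + e) - u t| <= `|u (t + e *+ m) - u t| + m%:R * (K * e * wmod a).
  move=> e0 ea; pose D := u (t + e) - u t.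
  suff H : `|u (t + e *+ m) - u t - m%:R * D| <= m%:R * (K * e * wmod a).
    have -> : m%:R * `|D| = `|m%:R * D| by rewrite normrM ger0_norm.
    have := ler_normB (u (t + e *+ m) - u t) (u (t + e *+ m) - u t - m%:R * D).
    have -> : u (t + e *+ m) - u t - (u (t + e *+ m) - u t - m%:R * D) = m%:R * D by ring.
    by move=> /le_trans; apply; rewrite lerD2l.
  elim: m ea => [|m IH] ea.
    by rewrite mulr0n addr0 subrr !mul0r subr0 normr0.
  have ea' : e *+ m <= a by apply: le_trans ea; rewrite ler_wpMn2l // ltW.
  have := IH ea'; have := uK t e (e *+ m).
  have -> : t + e + e *+ m = t + e *+ m.+1 by rewrite -addrA -mulrS.
  have wle : wmod (e *+ m) <= wmod a.
    by apply: wmod_mono; rewrite !ger0_norm ?mulrn_wge0 // ltW.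
  have : K * `|e| * wmod (e *+ m) <= K * e * wmod a.
    by rewrite (gtr0_norm e0) ler_wpM2l // mulr_ge0 // ltW.
  move=> h1 h2 h3.
  have -> : u (t + e *+ m.+1) - u t - m.+1%:R * D =
    (u (t + e *+ m.+1) - u (t + e) - u (t + e *+ m) + u t) + (u (t + e *+ m) - u t - m%:R * D).
    by rewrite -[m.+1]addn1 natrD /D; ring.
  apply: le_trans (ler_normD _ _) _; rewrite -[m.+1%:R]natr1 mulrDl mul1r; lra.
move=> d0; apply/ler_addgt0Pr => eps eps0.
pose k := (Num.truncn (2 * A * d ^+ 2 / (a * eps) + d / a)).+1.
have q0 : 0 <= 2 * A * d ^+ 2 / (a * eps).
  by rewrite divr_ge0 ?mulr_ge0 ?sqr_ge0 // ltW.
have q1 : 0 <= d / a by rewrite divr_ge0 // ltW.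
have k0 : 0 < k%:R :> R by rewrite ltr0n.
have kgt : 2 * A * d ^+ 2 / (a * eps) + d / a < k%:R.
  by rewrite truncnS_gt // addr_ge0.
pose e := d / k%:R; have e0 : 0 < e by rewrite divr_gt0.
pose m := Num.truncn (a / e).
have ma : m%:R * e <= a.
  by rewrite -ler_pdivlMr // truncn_le // divr_ge0 // ltW.
have am : a < m%:R * e + e.
  rewrite -[X in _ + X]mul1r -mulrDl -ltr_pdivrMr //.
  by have := truncnS_gt (a / e); rewrite -/m -natr1; apply.
have aek : 0 < a - e.
  have : d / a < k%:R by lra.
  rewrite ltr_pdivrMr // => H.
  by rewrite subr_gt0 /e ltr_pdivrMr // mulrC.
have incr s' : (a - e) * `|u (s' + e) - u s'| <= e * (U + A * e + a * (K * wmod a)).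
  have := mult s' e m e0; rewrite -[e *+ m]mulr_natl => /(_ ma) H.
  have h1 : `|u (s' + m%:R * e) - u s'| <= U + A * e.
    have := uA (s' + m%:R * e) (a - m%:R * e).
    have -> : s' + m%:R * e + (a - m%:R * e) = s' + a by ring.
    rewrite [`|a - _|]ger0_norm ?subr_ge0 // => hA.
    have := uU s' => hU.
    have -> : u (s' + m%:R * e) - u s' = (u (s' + a) - u s') - (u (s' + a) - u (s' + m%:R * e)).
      by ring.
    apply: le_trans (ler_normB _ _) _; apply: lerD => //.
    apply: le_trans hA _; rewrite ler_wpM2l //; lra.
  have h2 : (a - e) * `|u (s' + e) - u s'| <= e * (m%:R * `|u (s' + e) - u s'|).
    rewrite mulrA ler_wpM2r // mulrC; lra.
  apply: le_trans h2 _; rewrite (ler_wpM2l (ltW e0)) //.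
  apply: le_trans H _; apply: lerD => //.
  have -> : m%:R * (K * e * wmod a) = m%:R * e * (K * wmod a) by ring.
  by rewrite ler_wpM2r // mulr_ge0 ?wmod_ge0.
have tot : (a - e) * `|u (s + d) - u s| <= d * (U + A * e + a * (K * wmod a)).
  suff gen j : (a - e) * `|u (s + e *+ j) - u s| <=
      (e *+ j) * (U + A * e + a * (K * wmod a)).
    by move: (gen k); rewrite -[e *+ k]mulr_natr {1 3}/e divfK // gt_eqF.
  elim: j => [|j IH].
    by rewrite mulr0n addr0 subrr normr0 mulr0 mul0r.
  rewrite mulrSr addrA.
  have -> : u (s + e *+ j + e) - u s =
    (u (s + e *+ j + e) - u (s + e *+ j)) + (u (s + e *+ j) - u s) by ring.
  apply: (@le_trans _ _ ((a - e) * `|u (s + e *+ j + e) - u (s + e *+ j)| +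
                         (a - e) * `|u (s + e *+ j) - u s|)).
    by rewrite -mulrDr (ler_wpM2l (ltW aek)) // ler_normD.
  have := incr (s + e *+ j); rewrite mulrDl; lra.
have crude : `|u (s + d) - u s| <= A * d by have := uA s d; rewrite (gtr0_norm d0).
have small : 2 * A * e * d <= a * eps.
  have : 2 * A * d ^+ 2 / (a * eps) <= k%:R by lra.
  rewrite ler_pdivrMr ?mulr_gt0 // => H.
  rewrite -(ler_pM2l k0).
  have -> : k%:R * (2 * A * e * d) = 2 * A * d ^+ 2 by rewrite /e; field; lra.
  exact: H.
rewrite -(ler_pM2l a0).
have E1 : d * (U + A * e + a * (K * wmod a)) =
    a * ((U / a + K * wmod a) * d) + d * (A * e) by field; lra.
have h : e * `|u (s + d) - u s| <= e * (A * d) by rewrite ler_wpM2l // ltW.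
rewrite mulrDr; lra.
Qed.

End Modulus.

(** * Averages along leaves *)

Section Averaging.
Context {R : realType}.
Implicit Types (p : R * R) (G f : R * R -> R).

Variables (Psi : R -> R * R -> R * R) (lat : R * R -> Prop).
Variables (Lam mu eta e4 : R).

Definition nrm K G := forall b, reg1 K (fun a => G (a, b)).
Definition hlip K G := forall a b d, `|G (a + d, b) - G (a, b)| <= K * `|d|.
Definition hfour K G := forall a b d d',
  `|G (a + d + d', b) - G (a + d, b) - G (a + d', b) + G (a, b)| <= K * `|d| * wmod d'.
Definition leaf_continuous G := forall p, continuous (fun r => G (Psi r p)).
Definition lat_periodic G := forall v p, lat v -> G (p + v) = G p.
Definition leafint G p t := itg (fun r => G (Psi r p)) t.
Definition leafavg G p := Lam^-1 * leafint G p Lam.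
Definition leaf_growth G := exists c C : R, 0 < c /\
  ((forall p (t : R), 0 <= t -> c * t - C <= leafint G p t) \/
   (forall p (t : R), 0 <= t -> c * t - C <= - leafint G p t)).
Definition leaf_coboundary G := exists (h : R * R -> R) (C : R),
  [/\ lat_periodic h, forall p t, h (Psi t p) - h p = leafint G p t,
    forall p, `|h p| <= C &
    forall p p', `|h p - h p'| <= C * Num.sqrt (`|p'.1 - p.1| + `|p'.2 - p.2|)].
Definition drift t p := (Psi t p).1 - p.1.

Hypothesis PsiD : forall s t p, Psi (s + t) p = Psi s (Psi t p).
Hypothesis Psi2 : forall t p, (Psi t p).2 = p.2 + t.
Hypothesis PsiL : forall t v p, lat v -> Psi t (p + v) = Psi t p + v.
Hypothesis Lam_gt1 : 1 < Lam.
Hypothesis mu_gt0 : 0 < mu.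
Hypothesis mu_le : mu <= Lam.
Hypothesis eta_ge0 : 0 <= eta.
Hypothesis eta_Lam : eta * Lam <= 1 / 2.
Hypothesis eta_mu : eta * mu <= e4.
Hypothesis mu_Lam : (mu / Lam) ^+ 2 <= e4.
Hypothesis wmod_mu : wmod mu^-1 <= e4.
Hypothesis wmod_Lam : wmod Lam^-1 <= e4.
Hypothesis lat_Lam : lat (Lam^-1, Lam).
Hypothesis lat_mu : lat (mu^-1, mu).
Hypothesis drift_nrm : forall t, `|t| <= 2 * Lam -> nrm eta (drift t).

Lemma shift_pairE (a b d : R) : (a, b) + (d, 0) = (a + d, b).
Proof. by apply: injective_projections => //=; rewrite addr0. Qed.

Lemma PsiE t a b : Psi t (a, b) = (a + drift t (a, b), b + t).
Proof. by apply: injective_projections; rewrite /drift ?Psi2 //=; ring. Qed.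

Lemma PsiE' t p : Psi t p = p + (drift t p, t).
Proof. by case: p => a b; rewrite PsiE. Qed.

Lemma der_leafint G p t : leaf_continuous G -> der (leafint G p) t (G (Psi t p)).
Proof. by move=> cG; exact: (der_itg t (cG p)). Qed.

Lemma leafint0 G p : leafint G p 0 = 0.
Proof. exact: itg0. Qed.

Lemma leafint_shift G p t s : leaf_continuous G ->
  leafint G (Psi t p) s = leafint G p (s + t) - leafint G p t.
Proof.
move=> cG.
rewrite /leafint (@itg_primitive R _ (fun s => leafint G p (s + t))) //.
  by rewrite add0r.
by move=> x; rewrite -PsiD; apply: der_shift; apply: der_leafint.
Qed.

Lemma leafint_le G p t C : leaf_continuous G ->
  (forall r, btw 0 t r -> `|G (Psi r p)| <= C) -> `|leafint G p t| <= C * `|t|.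
Proof.
move=> cG GC; rewrite -[leafint G p t]subr0 -(leafint0 G p) -{2}[t]subr0.
by apply: (@mvt_abs _ _ (fun r => G (Psi r p))) => // r _; apply: der_leafint.
Qed.

Lemma leafint2_le G p q t C : leaf_continuous G ->
  (forall r, btw 0 t r -> `|G (Psi r p) - G (Psi r q)| <= C) ->
  `|leafint G p t - leafint G q t| <= C * `|t|.
Proof.
move=> cG GC; pose f t := leafint G p t - leafint G q t.
have -> : leafint G p t - leafint G q t = f t - f 0 by rewrite /f !leafint0; ring.
rewrite -{2}[t]subr0.
apply: (@mvt_abs _ _ (fun r => G (Psi r p) - G (Psi r q))) => // r _.
by apply: derB; apply: der_leafint.
Qed.

Lemma leafint4_le G p q p' q' t C : leaf_continuous G ->
  (forall r, btw 0 t r ->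
    `|G (Psi r p) - G (Psi r q) - G (Psi r p') + G (Psi r q')| <= C) ->
  `|leafint G p t - leafint G q t - leafint G p' t + leafint G q' t| <= C * `|t|.
Proof.
move=> cG GC.
pose f t := leafint G p t - leafint G q t - leafint G p' t + leafint G q' t.
rewrite -/(f t).
have -> : f t = f t - f 0 by rewrite /f !leafint0; ring.
rewrite -{2}[t]subr0.
apply: (@mvt_abs _ _ (fun r => G (Psi r p) - G (Psi r q) - G (Psi r p') + G (Psi r q'))) => // r _.
by apply: derD; [apply: derB; [apply: derB|]|]; apply: der_leafint.
Qed.

Let Lam_gt0 : 0 < Lam. Proof. exact: lt_trans Lam_gt1. Qed.
Let Lam_ge0 : 0 <= Lam. Proof. exact: ltW. Qed.
Let iLam_gt0 : 0 < Lam^-1. Proof. by rewrite invr_gt0. Qed.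

Lemma eta_le_iLam : eta <= Lam^-1 / 2.
Proof.
have -> : Lam^-1 / 2 = (1 / 2) / Lam by ring.
by rewrite ler_pdivlMr.
Qed.

Lemma eta_le1 : eta <= 1 / 2.
Proof. by apply: le_trans eta_Lam; rewrite ler_peMr // ltW. Qed.

Lemma btw_Lam r : btw 0 Lam r -> `|r| <= 2 * Lam.
Proof.
have L0 := Lam_gt0; case/orP => /andP[r0 r1]; last by lra.
by rewrite ger0_norm //; lra.
Qed.

Lemma drift_lip t a b d : `|t| <= 2 * Lam ->
  `|d + (drift t (a + d, b) - drift t (a, b))| <= (1 + eta) * `|d|.
Proof.
move=> tL; apply: le_trans (ler_normD _ _) _.
rewrite mulrDl mul1r lerD2l; case: (drift_nrm tL b) => _ H _; exact: H.
Qed.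

Lemma leafavg_lip (K : R) G : leaf_continuous G -> hlip K G -> 0 <= K ->
  hlip (K * (1 + eta)) (leafavg G).
Proof.
move=> cG GK K0 a b d.
rewrite /leafavg -mulrBr normrM (gtr0_norm iLam_gt0) ler_pdivrMl //.
have := @leafint2_le G (a + d, b) (a, b) Lam (K * (1 + eta) * `|d|) cG.
rewrite (gtr0_norm Lam_gt0) => H; rewrite [X in _ <= X]mulrC; apply: H => r /btw_Lam rL.
rewrite !PsiE; set y := (a + drift r (a, b)).
have -> : a + d + drift r (a + d, b) = y + (d + (drift r (a + d, b) - drift r (a, b))).
  by rewrite /y; ring.
by apply: le_trans (GK _ _ _) _; rewrite -mulrA ler_wpM2l // drift_lip.
Qed.

Lemma leafavg_sup (K : R) G : leaf_continuous G -> (forall p, `|G p| <= K) ->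
  forall p, `|leafavg G p| <= K.
Proof.
move=> cG GK p; rewrite /leafavg normrM (gtr0_norm iLam_gt0) ler_pdivrMl // mulrC.
by have := @leafint_le G p Lam K cG; rewrite (gtr0_norm Lam_gt0); apply.
Qed.

(** 5 = 2 * 2 + 1: leaf translations stretch [d] and [d'] by at most 2 each, and the four translated
    points miss a parallelogram by at most |d| times [wmod d']. *)
Lemma leafavg_four (K : R) G : leaf_continuous G -> nrm K G -> hfour (5 * K) (leafavg G).
Proof.
move=> cG GK a b d d'.
have K0 : 0 <= K by apply: reg1_ge0 (GK 0).
rewrite /leafavg.
have -> : forall x y z t : R, Lam^-1 * x - Lam^-1 * y - Lam^-1 * z + Lam^-1 * t =
  Lam^-1 * (x - y - z + t) by move=> *; ring.
rewrite normrM (gtr0_norm iLam_gt0) ler_pdivrMl //.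
have := @leafint4_le G (a + d + d', b) (a + d, b) (a + d', b) (a, b) Lam
  (5 * K * `|d| * wmod d') cG.
rewrite (gtr0_norm Lam_gt0) => H; rewrite [X in _ <= X]mulrC; apply: H => r /btw_Lam rL.
rewrite !PsiE; have [_ h1 h2] := GK (b + r).
apply: le_trans (reg1_four _ _ _ _ h1 h2) _.
have [_ _ D4] := drift_nrm rL b.
have E10 := @drift_lip r a b d rL; have E01 := @drift_lip r a b d' rL.
set x11 := a + d + d' + _; set x10 := a + d + _; set x01 := a + d' + _; set x00 := a + _.
have e10 : x10 - x00 = d + (drift r (a + d, b) - drift r (a, b)) by rewrite /x10 /x00; ring.
have e01 : x01 - x00 = d' + (drift r (a + d', b) - drift r (a, b)) by rewrite /x01 /x00; ring.
have e11 : x11 - x10 - x01 + x00 = drift r (a + d + d', b) - drift r (a + d, b)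
    - drift r (a + d', b) + drift r (a, b) by rewrite /x11 /x10 /x01 /x00; ring.
have h10 : `|x10 - x00| <= 2 * `|d|.
  by rewrite e10; apply: le_trans E10 _; rewrite ler_wpM2r //; have := eta_le1; lra.
have h01 : wmod (x01 - x00) <= 2 * wmod d'.
  rewrite e01; apply: (@le_trans _ _ (wmod (2 * d'))).
    apply: wmod_mono; apply: le_trans E01 _; rewrite normrM [`|2|]ger0_norm //.
    by rewrite ler_wpM2r //; have := eta_le1; lra.
  by rewrite wmodM ler_wpM2r ?wmod_ge0 // wmod_le ?ger0_norm; lra.
have h11 : `|x11 - x10 - x01 + x00| <= `|d| * wmod d'.
  rewrite e11; apply: le_trans (D4 _ _ _) _; rewrite -mulrA ler_piMl ?mulr_ge0 ?wmod_ge0 //.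
  by have := eta_le1; lra.
have : K * `|x10 - x00| * wmod (x01 - x00) <= K * (2 * `|d|) * (2 * wmod d').
  by rewrite ler_pM ?wmod_ge0 ?mulr_ge0 // ler_wpM2l.
have : K * `|x11 - x10 - x01 + x00| <= K * (`|d| * wmod d') by rewrite ler_wpM2l.
lra.
Qed.

Lemma leafavg_nrm (K : R) G : leaf_continuous G -> nrm K G -> nrm (5 * K) (leafavg G).
Proof.
move=> cG GK b; have K0 : 0 <= K by apply: reg1_ge0 (GK 0).
split=> [a|a d|a d d'].
- apply: le_trans (leafavg_sup cG (K := K) _ _) _; last lra.
  by case=> a' b'; case: (GK b').
- apply: le_trans (leafavg_lip cG (K := K) _ K0 _ _ _) _; last first.
    rewrite ler_wpM2r // mulrC ler_wpM2r //; have := eta_le1; lra.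
  by move=> a' b' d'; case: (GK b') => _ + _; apply.
- exact: leafavg_four.
Qed.

Lemma leafavg_continuous G : leaf_continuous G -> leaf_continuous (leafavg G).
Proof.
move=> cG p t; rewrite /leafavg.
apply: (@der_continuous _ _ _ (Lam^-1 * (G (Psi (t + Lam) p) - G (Psi t p)))).
apply: (@der_ext _ (fun r => Lam^-1 * (leafint G p (r + Lam) - leafint G p r))).
  by move=> r; rewrite leafint_shift // [Lam + r]addrC.
by apply: derZ; apply: derB; [apply: der_shift|]; apply: der_leafint.
Qed.

Lemma leafavg_periodic G : lat_periodic G -> lat_periodic (leafavg G).
Proof.
move=> pG v p lv; rewrite /leafavg /leafint; congr (_ * itg _ _).
by apply/funext => r; rewrite PsiL // pG.
Qed.

(* Translating by the lattice vector (1/Lam, Lam) turns a leaf translation by Lam into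
   a transverse one by about 1/Lam. *)
Lemma leafavg_along_leaf (A : R) G p r : leaf_continuous G -> lat_periodic G -> hlip A G -> 0 <= A ->
  `|leafavg G (Psi r p) - leafavg G p| <= `|r| / Lam * (A * (Lam^-1 + eta)).
Proof.
move=> cG pG GA A0; rewrite /leafavg leafint_shift // -mulrBr normrM (gtr0_norm iLam_gt0).
rewrite [`|r| / Lam]mulrC -mulrA ler_pM2l // mulrC.
pose g s := leafint G p (s + Lam) - leafint G p s.
have -> : leafint G p (Lam + r) - leafint G p r - leafint G p Lam = g r - g 0.
  by rewrite /g leafint0 add0r [r + Lam]addrC; ring.
rewrite -{2}[r]subr0.
apply: (@mvt_abs _ g (fun s => G (Psi (s + Lam) p) - G (Psi s p))) => s _.
  by apply: derB; [apply: der_shift|]; apply: der_leafint.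
rewrite [s + Lam]addrC PsiD; set x := Psi s p.
have -> : Psi Lam x = x + (drift Lam x - Lam^-1, 0) + (Lam^-1, Lam).
  by rewrite PsiE' -addrA; congr (_ + _); apply: injective_projections => /=; ring.
rewrite pG //; case: x => a b; rewrite shift_pairE; apply: le_trans (GA _ _ _) _.
rewrite ler_wpM2l //; apply: le_trans (ler_normB _ _) _.
rewrite [`|Lam^-1|]gtr0_norm // addrC lerD2l.
have : `|Lam| <= 2 * Lam.
  by rewrite (gtr0_norm Lam_gt0) ler_peMl // ler1n.
by move=> /drift_nrm /(_ b) [+ _ _]; apply.
Qed.

Lemma hlip_nrm (K : R) G : nrm K G -> hlip K G.
Proof. by move=> GK a b d; case: (GK b) => _ + _; apply. Qed.

(** Modulo the lattice vector (1/mu, mu), a transverse step 1/mu is a leaf translation by -mu up to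
    a drift of size eta, and along leaves the average varies slowly. [U] collects both errors, and
    [lip_of_coarse_increment] turns this single step size into a Lipschitz bound. The drift
    contributes 2, the leaf variation 2 and the four-point error 5 to the constant 9. *)
Lemma leafavg_lip_small (K : R) G : leaf_continuous G -> lat_periodic G -> nrm K G ->
  hlip (9 * e4 * K) (leafavg G).
Proof.
move=> cG pG GK a b d.
have K0 : 0 <= K by apply: reg1_ge0 (GK 0).
have GL := hlip_nrm GK.
have e1 := eta_le1; have eL := eta_le_iLam.
have JL : hlip (2 * K) (leafavg G).
  move=> x y z; apply: le_trans (leafavg_lip cG GL K0 _ _ _) _.
  by rewrite ler_wpM2r // mulrC ler_wpM2r //; lra.
pose U := 2 * K * eta + mu / Lam * (K * (Lam^-1 + eta)).
have incr s : `|leafavg G (s + mu^-1, b) - leafavg G (s, b)| <= U.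
  have muL : `|- mu| <= 2 * Lam.
    by have L0 := Lam_gt0; have ml := mu_le; rewrite normrN (gtr0_norm mu_gt0); lra.
  have -> : leafavg G (s + mu^-1, b) = leafavg G (s, b - mu).
    rewrite -(leafavg_periodic pG (s, b - mu) lat_mu); congr (leafavg G _).
    by apply: injective_projections => /=; ring.
  have H1 := @leafavg_along_leaf K G (s, b) (- mu) cG pG GL K0.
  move: H1; rewrite normrN (gtr0_norm mu_gt0) PsiE.
  have := JL s (b - mu) (drift (- mu) (s, b)).
  have D : `|drift (- mu) (s, b)| <= eta by case: (drift_nrm muL b).
  have D' : 2 * K * `|drift (- mu) (s, b)| <= 2 * K * eta.
    by rewrite ler_wpM2l // mulr_ge0.
  rewrite distrC => h1 h2.
  have -> : leafavg G (s, b - mu) - leafavg G (s, b) =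
    (leafavg G (s, b - mu) - leafavg G (s + drift (- mu) (s, b), b - mu)) +
    (leafavg G (s + drift (- mu) (s, b), b - mu) - leafavg G (s, b)) by ring.
  by apply: le_trans (ler_normD _ _) _; rewrite /U; lra.
have [_ _ J4] := leafavg_nrm cG GK b.
have imu : 0 < mu^-1 by rewrite invr_gt0.
have K5 : 0 <= 5 * K by lra.
have := lip_of_coarse_increment imu K5 (fun s d => JL s b d) J4 incr a d.
move=> /le_trans; apply; rewrite ler_wpM2r // invrK.
have h1 : 5 * K * wmod mu^-1 <= 5 * K * e4 by rewrite ler_wpM2l.
have h2 : K * (eta * mu) <= K * e4 by rewrite ler_wpM2l.
have h3 : K * ((mu / Lam) ^+ 2) <= K * e4 by rewrite ler_wpM2l.
have h4 : mu / Lam * (K * (Lam^-1 + eta)) * mu <= 2 * (K * (mu / Lam) ^+ 2).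
  have -> : mu / Lam * (K * (Lam^-1 + eta)) * mu = (Lam^-1 + eta) * (K * mu * (mu / Lam)).
    by ring.
  have -> : 2 * (K * (mu / Lam) ^+ 2) = 2 * Lam^-1 * (K * mu * (mu / Lam)).
    by rewrite expr2; field; rewrite gt_eqF.
  have m0 := ltW mu_gt0; rewrite ler_wpM2r ?mulr_ge0 ?divr_ge0 //; have i0 := iLam_gt0; lra.
rewrite /U mulrDl; lra.
Qed.

Lemma leafavg2_lip (K : R) G : leaf_continuous G -> lat_periodic G -> nrm K G ->
  hlip (18 * e4 * K) (leafavg (leafavg G)).
Proof.
move=> cG pG GK a b d; have K0 : 0 <= K by apply: reg1_ge0 (GK 0).
have e0 : 0 <= e4 by apply: le_trans mu_Lam; exact: sqr_ge0.
have K9 : 0 <= 9 * e4 * K by rewrite !mulr_ge0.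
apply: le_trans (leafavg_lip (leafavg_continuous cG) (leafavg_lip_small cG pG GK) K9 _ _ _) _.
rewrite ler_wpM2r //; have := eta_le1; nra.
Qed.

Hypothesis lat_reduction : forall x y, exists v, lat v /\
  (`|x + v.1| <= 4 / Lam /\ `|y + v.2| <= 2 * Lam).

(** Modulo the lattice, [p - q] lies in a box of half-sides 4/Lam across and 2 Lam along the leaves.
    The transverse part costs 18 * 5 by [leafavg2_lip]; the long leaf part costs 2 * 9 * 2, because
    the function averaged last already has small transverse Lipschitz constant. Together these make
    126. *)
Lemma leafavg2_osc (K : R) G p q : leaf_continuous G -> lat_periodic G -> nrm K G ->
  `|leafavg (leafavg G) p - leafavg (leafavg G) q| <= 126 * e4 * K / Lam.
Proof.
move=> cG pG GK; have K0 : 0 <= K by apply: reg1_ge0 (GK 0).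
have e0 : 0 <= e4 by apply: le_trans mu_Lam; exact: sqr_ge0.
have K9 : 0 <= 9 * e4 * K by rewrite !mulr_ge0.
have eL := eta_le_iLam.
case: p q => a b [a' b'].
have [[x y] [lv /= [hx hy]]] := lat_reduction (a - a') (b - b').
rewrite -(leafavg_periodic (leafavg_periodic pG) (a, b) lv) /=.
set JJ := leafavg (leafavg G); set t := b - b' + y in hy.
have H1 := @leafavg_along_leaf (9 * e4 * K) (leafavg G) (a', b') t
  (leafavg_continuous cG) (leafavg_periodic pG) (leafavg_lip_small cG pG GK) K9.
set D := drift t (a', b').
have D1 : `|D| <= eta by rewrite /D; case: (drift_nrm hy b').
have H2 := @leafavg2_lip K G cG pG GK (a' + D) (b' + t) (a - a' + x - D).
have E : (a, b) + (x, y) = (a' + D + (a - a' + x - D), b' + t).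
  by apply: injective_projections; rewrite /= /t; ring.
move: H1; rewrite PsiE -/D -/JJ => H1; rewrite -/JJ in H2; rewrite E.
apply: le_trans (ler_distD (JJ (a' + D, b' + t)) _ _) (le_trans (lerD H2 H1) _).
have i0 := iLam_gt0.
have hD : `|a - a' + x - D| <= 5 / Lam.
  by apply: le_trans (ler_normB _ _) (le_trans (lerD hx D1) _); clear H1 H2; lra.
have h3 : 18 * e4 * K * `|a - a' + x - D| <= 18 * e4 * K * (5 / Lam).
  by rewrite ler_wpM2l // !mulr_ge0.
have h4 : `|t| / Lam * (9 * e4 * K * (Lam^-1 + eta)) <= 2 * (9 * e4 * K * (2 / Lam)).
  apply: ler_pM.
  - by rewrite divr_ge0.
  - by apply: mulr_ge0 => //; apply: addr_ge0 => //; apply: ltW.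
  - by rewrite ler_pdivrMr.
  - by rewrite ler_wpM2l //; clear H1 H2 h3; lra.
apply: le_trans (lerD h3 h4) _; rewrite le_eqVlt; apply/orP; left; apply/eqP; ring.
Qed.

(** * The renormalised function *)

Variables Mi M : R * R -> R * R.
Hypothesis Mi2 : forall p, (Mi p).2 = Lam * p.2.
Hypothesis MiPsi : forall t p, Mi (Psi t p) = Psi (Lam * t) (Mi p).
Hypothesis MiL : forall v p, lat v -> exists2 v', lat v' & Mi (p + v) = Mi p + v'.
Hypothesis ML : forall v p, lat v -> exists2 v', lat v' & M (p + v) = M p + v'.
Hypothesis Mi_nrm : nrm eta (fun p => (Mi p).1 - p.1 / Lam).
Hypothesis MK : forall p, Mi (M p) = p.

(** By [MiPsi], [Mi] runs along leaves [Lam] times as fast. The factor [Lam] is the Jacobian of this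
    change of time, which keeps leaf integrals unchanged. *)
Definition renorm G p := Lam * leafavg (leafavg G) (Mi p).

Lemma renorm_continuous G : leaf_continuous G -> leaf_continuous (renorm G).
Proof.
move=> cG p.
have -> : (fun r => renorm G (Psi r p)) =
    (fun r => Lam * (fun s => leafavg (leafavg G) (Psi s (Mi p))) (Lam * r)).
  by apply/funext => r; rewrite /renorm MiPsi.
have cF := @leafavg_continuous _ (leafavg_continuous cG) (Mi p).
have := continuous_scale (c := Lam) (d := Lam) cF; exact.
Qed.

Lemma renorm_periodic G : lat_periodic G -> lat_periodic (renorm G).
Proof.
move=> pG v p lv; rewrite /renorm; have [v' lv' ->] := MiL p lv.
by rewrite (leafavg_periodic (leafavg_periodic pG)).
Qed.

Lemma Mi_lip a b d : `|(Mi (a + d, b)).1 - (Mi (a, b)).1| <= 2 / Lam * `|d|.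
Proof.
have [_ H _] := Mi_nrm b; have := H a d; rewrite /=; have eL := eta_le_iLam.
set x := (Mi (a + d, b)).1; set y := (Mi (a, b)).1 => h.
have -> : x - y = (x - (a + d) / Lam - (y - a / Lam)) + d / Lam by ring.
apply: le_trans (ler_normD _ _) _.
rewrite normrM [`|Lam^-1|]gtr0_norm //.
have : eta * `|d| <= Lam^-1 / 2 * `|d| by rewrite ler_wpM2r.
have : 0 <= Lam^-1 * `|d| by rewrite mulr_ge0 // ltW.
by move: h; lra.
Qed.

(** [Mi] differs from division by Lam by a map of Lipschitz constant eta <= 1 / (2 Lam), so it
    cannot shrink horizontal distances by more than 2 Lam. This yields injectivity and bounds the
    expansion of the inverse [M]. *)
Lemma Mi_lower a b d : `|d| <= 2 * Lam * `|(Mi (a + d, b)).1 - (Mi (a, b)).1|.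
Proof.
have [_ H _] := Mi_nrm b; have := H a d; rewrite /=; have eL := eta_le_iLam.
set x := (Mi (a + d, b)).1; set y := (Mi (a, b)).1 => h.
have E : d / Lam = (x - y) - (x - (a + d) / Lam - (y - a / Lam)) by ring.
have : `|d / Lam| <= `|x - y| + Lam^-1 / 2 * `|d|.
  rewrite {1}E; apply: le_trans (ler_normB _ _) _; rewrite lerD2l.
  by apply: le_trans h _; rewrite ler_wpM2r.
rewrite normrM [`|Lam^-1|]gtr0_norm // => h1.
have h2 : Lam^-1 * `|d| <= 2 * `|x - y| by lra.
have := ler_wpM2l Lam_ge0 h2; rewrite mulrA divff ?gt_eqF // mul1r; lra.
Qed.

Lemma Mi_inj p q : Mi p = Mi q -> p = q.
Proof.
case: p q => a b [a' b'] E.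
have Eb : b = b'.
  have := congr1 snd E; rewrite !Mi2 /= => /mulfI; apply.
  by rewrite gt_eqF.
rewrite Eb in E *; congr (_, _); apply/eqP; rewrite -subr_eq0 -normr_le0.
have := Mi_lower a' b' (a - a').
by rewrite [a' + _]addrC subrK E subrr normr0 mulr0.
Qed.

(** Averaging controls the oscillation but not the mean, so a constant [c] is split off; its size
    decides the later dichotomy. Against the factor Lam, the sup bound has the 1/Lam of
    [leafavg2_osc], and the other two have the contraction of [Mi]. The four-point constant 25 K is
    not improved by averaging; there the gain e4 comes from [wmod Lam^-1]. *)
Lemma renorm_nrm (K : R) G : leaf_continuous G -> lat_periodic G -> nrm K G ->
  exists c, nrm (126 * e4 * K) (fun p => renorm G p - c).
Proof.
move=> cG pG GK; have K0 : 0 <= K by apply: reg1_ge0 (GK 0).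
have e0 : 0 <= e4 by apply: le_trans mu_Lam; exact: sqr_ge0.
have eK0 : 0 <= e4 * K by rewrite mulr_ge0.
have L1 : Lam * Lam^-1 = 1 by rewrite divff // gt_eqF.
have lip := leafavg2_lip cG pG GK.
have MiE x b : Mi (x, b) = ((Mi (x, b)).1, Lam * b).
  by rewrite [LHS]surjective_pairing Mi2.
exists (renorm G (0, 0)) => b; split=> [a|a d|a d d'].
- rewrite /renorm -mulrBr normrM [`|Lam|]gtr0_norm //.
  have := leafavg2_osc (Mi (a, b)) (Mi (0, 0)) cG pG GK.
  by rewrite -(ler_pM2l Lam_gt0) [Lam * (_ / Lam)]mulrC divfK // gt_eqF.
- rewrite /renorm.
  have -> : forall x y z : R, x - y - (z - y) = x - z by move=> *; ring.
  rewrite -mulrBr normrM [`|Lam|]gtr0_norm //.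
  have h2 := Mi_lip a b d.
  have := lip (Mi (a, b)).1 (Lam * b) ((Mi (a + d, b)).1 - (Mi (a, b)).1).
  rewrite [_.1 + _]addrC subrK -!MiE => h1.
  apply: (@le_trans _ _ (Lam * (18 * e4 * K * (2 / Lam * `|d|)))).
    rewrite ler_pM2l //; apply: le_trans h1 _; rewrite ler_wpM2l // -mulrA mulr_ge0 //.
  have -> : Lam * (18 * e4 * K * (2 / Lam * `|d|)) = Lam * Lam^-1 * (36 * (e4 * K) * `|d|).
    by ring.
  rewrite L1 mul1r ler_wpM2r //; lra.
- rewrite /renorm.
  have -> : forall x y z t u : R, x - y - (z - y) - (t - y) + (u - y) = x - z - t + u.
    by move=> *; ring.
  have -> : forall x y z t : R, Lam * x - Lam * y - Lam * z + Lam * t = Lam * (x - y - z + t).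
    by move=> *; ring.
  rewrite normrM [`|Lam|]gtr0_norm //.
  rewrite (MiE (a + d + d') b) (MiE (a + d) b) (MiE (a + d') b) (MiE a b).
  set x11 := (Mi (a + d + d', b)).1; set x10 := (Mi (a + d, b)).1.
  set x01 := (Mi (a + d', b)).1; set x00 := (Mi (a, b)).1.
  have four := leafavg_nrm (leafavg_continuous cG) (leafavg_nrm cG GK) (Lam * b).
  case: four => _ _ four.
  apply: le_trans (_ : Lam * (5 * (5 * K) * `|x10 - x00| * wmod (x01 - x00) +
     18 * e4 * K * `|x11 - x10 - x01 + x00|) <= _).
    rewrite ler_pM2l //.
    exact: (@reg1_four _ (18 * e4 * K) _ (fun x => leafavg (leafavg G) (x, Lam * b)) _ _ _ _
      (fun x d => lip x _ d) four).
  have h10 : `|x10 - x00| <= 2 / Lam * `|d| by apply: Mi_lip.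
  have h01 : wmod (x01 - x00) <= 2 * e4 * wmod d'.
    apply: (@le_trans _ _ (wmod (2 / Lam * d'))).
      apply: wmod_mono; rewrite normrM [`|2 / Lam|]gtr0_norm ?divr_gt0 //; exact: Mi_lip.
    rewrite !wmodM ler_wpM2r ?wmod_ge0 // ler_pM ?wmod_ge0 //.
    by apply: wmod_le; rewrite ?ger0_norm // ler1n.
  have h11 : `|x11 - x10 - x01 + x00| <= eta * `|d| * wmod d'.
    have [_ _ H] := Mi_nrm b; have := H a d d'; rewrite /= -/x11 -/x10 -/x01 -/x00.
    by congr (`|_| <= _); ring.
  have dw0 : 0 <= `|d| * wmod d' by rewrite mulr_ge0 ?wmod_ge0.
  have m1 : 5 * (5 * K) * `|x10 - x00| * wmod (x01 - x00) <=
      5 * (5 * K) * (2 / Lam * `|d|) * (2 * e4 * wmod d').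
    by rewrite ler_pM ?wmod_ge0 ?mulr_ge0 // ler_wpM2l // !mulr_ge0.
  have m2 : 18 * e4 * K * `|x11 - x10 - x01 + x00| <= 18 * e4 * K * (eta * `|d| * wmod d').
    by rewrite ler_wpM2l // !mulr_ge0.
  apply: (@le_trans _ _ (Lam * (5 * (5 * K) * (2 / Lam * `|d|) * (2 * e4 * wmod d') +
      18 * e4 * K * (eta * `|d| * wmod d')))).
    by rewrite ler_pM2l //; apply: lerD.
  have -> : Lam * (5 * (5 * K) * (2 / Lam * `|d|) * (2 * e4 * wmod d') +
      18 * e4 * K * (eta * `|d| * wmod d')) =
      (100 * (Lam * Lam^-1) + 18 * (eta * Lam)) * (e4 * K) * (`|d| * wmod d') by ring.
  rewrite L1 -[X in _ <= X]mulrA [126 * e4 * K]mulrAC -[126 * K * e4]mulrA [K * e4]mulrC.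
  by rewrite ler_wpM2r // ler_wpM2r //; have := eta_Lam; lra.
Qed.

(** * Leaf integrals: corrections at the end points and renormalised remainder *)

Lemma MPsi t p : M (Psi t p) = Psi (t / Lam) (M p).
Proof. by apply: Mi_inj; rewrite MK MiPsi MK mulrC divfK // gt_eqF. Qed.

Lemma leafint_renorm G p t : leaf_continuous G ->
  leafint (leafavg (leafavg G)) p t = leafint (renorm G) (M p) (t / Lam).
Proof.
move=> cG; rewrite /leafint.
rewrite (@itg_primitive R _ (fun t => leafint (renorm G) (M p) (t / Lam))).
- by rewrite mul0r leafint0 subr0.
- exact: leafavg_continuous (leafavg_continuous cG) _.
move=> x; have D : der (fun t => t / Lam) x Lam^-1.
  by apply: der_eq (derM (der_id x) (der_cst _ x)) _; rewrite mulr0 addr0 mul1r.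
apply: der_eq (der_comp D (der_leafint _ _ (renorm_continuous cG))) _.
rewrite /renorm MiPsi MK mulrAC divff ?gt_eqF // mul1r.
by rewrite [Lam * _]mulrC divfK // gt_eqF.
Qed.

(** Minus the mean of the leaf integrals over times in [0, Lam]: the standard solution of the
    cohomological equation for G minus its average. *)
Definition leafprim G p := - (Lam^-1 * itg (leafint G p) Lam).

Lemma leafint_cont G p : leaf_continuous G -> continuous (leafint G p).
Proof. by move=> cG t; apply: der_continuous; exact: der_leafint. Qed.

Lemma leafprim_leaf G p t : leaf_continuous G ->
  leafprim G (Psi t p) - leafprim G p = leafint G p t - leafint (leafavg G) p t.
Proof.
(* With a primitive of the leaf integral, all terms become values of [Phi] at 0, t, Lam and t + Lam,
   and no double integral has to be interchanged. *)
move=> cG; pose Phi := itg (leafint G p).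
have PhiD x : der Phi x (leafint G p x) by apply: der_itg; exact: leafint_cont.
have Phi0 : Phi 0 = 0 by exact: itg0.
have -> : leafint (leafavg G) p t = Lam^-1 * (Phi (t + Lam) - Phi t - Phi Lam).
  rewrite /leafint (@itg_primitive R _ (fun t => Lam^-1 * (Phi (t + Lam) - Phi t))).
  - by rewrite add0r Phi0; ring.
  - exact: leafavg_continuous cG _.
  move=> x; rewrite /leafavg leafint_shift // [Lam + x]addrC.
  by apply: derZ; apply: derB => //; apply: der_shift.
have -> : leafprim G (Psi t p) = - (Lam^-1 * (Phi (Lam + t) - leafint G p t * Lam - Phi t)).
  rewrite /leafprim; congr (- (_ * _)).
  rewrite (@itg_primitive R _ (fun s => Phi (s + t) - leafint G p t * s)).
  - by rewrite add0r mulr0 subr0.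
  - exact: leafint_cont.
  move=> x; rewrite leafint_shift //; apply: derB; first exact: der_shift.
  by apply: der_eq (derZ _ (der_id x)) _; rewrite mulr1.
by rewrite /leafprim -/Phi [Lam + t]addrC; field; rewrite gt_eqF.
Qed.

Lemma leafprim_sup (K : R) G p : leaf_continuous G -> 0 <= K -> (forall p, `|G p| <= K) ->
  `|leafprim G p| <= K * Lam.
Proof.
move=> cG K0 GK; rewrite /leafprim normrN normrM [`|Lam^-1|]gtr0_norm // ler_pdivrMl //.
rewrite mulrC -[X in _ <= _ * X](gtr0_norm Lam_gt0).
apply: itg_le => [|r]; first exact: leafint_cont.
move=> rL; apply: le_trans (leafint_le cG (fun r _ => GK _)) _; rewrite ler_wpM2l //.
by case/orP: rL => /andP[r0 r1]; have L0 := Lam_gt0; rewrite ?ger0_norm //; lra.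
Qed.

Lemma leafprim_lip (K : R) G a b d : leaf_continuous G -> 0 <= K -> hlip K G ->
  `|leafprim G (a + d, b) - leafprim G (a, b)| <= 2 * K * Lam * `|d|.
Proof.
move=> cG K0 GK; rewrite /leafprim.
have -> : forall x y : R, - (Lam^-1 * x) - - (Lam^-1 * y) = Lam^-1 * (y - x) by move=> *; ring.
rewrite normrM [`|Lam^-1|]gtr0_norm // ler_pdivrMl // distrC.
pose f t := leafint G (a + d, b) t - leafint G (a, b) t.
have cf : continuous f.
  by move=> t; apply: der_continuous; apply: derB; apply: der_leafint.
have <- : itg f Lam = itg (leafint G (a + d, b)) Lam
    - itg (leafint G (a, b)) Lam.
  rewrite (@itg_primitive R _ (fun t => itg (leafint G (a + d, b)) t
    - itg (leafint G (a, b)) t)) //; first by rewrite !itg0; ring.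
  by move=> x; apply: derB; apply: der_itg; exact: leafint_cont.
rewrite [X in _ <= X]mulrC -[X in _ <= _ * X](gtr0_norm Lam_gt0).
apply: itg_le => // r rL; have rL' := btw_Lam rL.
apply: (@le_trans _ _ (2 * K * `|d| * `|r|)).
  apply: leafint2_le => // s sr.
  have sL : `|s| <= 2 * Lam.
    apply: btw_Lam; move: sr rL; have L0 := Lam_gt0.
    by case/orP => /andP[? ?] /orP[|] /andP[? ?]; apply/orP; left; apply/andP; split; lra.
  rewrite !PsiE; set y := (a + drift s (a, b)).
  have -> : a + d + drift s (a + d, b) = y + (d + (drift s (a + d, b) - drift s (a, b))).
    by rewrite /y; ring.
  apply: le_trans (GK _ _ _) _; rewrite [2 * K]mulrC -mulrA ler_wpM2l //.
  apply: le_trans (drift_lip _ _ _ sL) _; rewrite ler_wpM2r //; have := eta_le1; lra.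
have -> : 2 * K * Lam * `|d| = 2 * K * `|d| * Lam by ring.
rewrite ler_wpM2l ?mulr_ge0 //.
by case/orP: rL => /andP[r0 r1]; have L0 := Lam_gt0; rewrite ?ger0_norm //; lra.
Qed.

Definition corrector G p := leafprim G p + leafprim (leafavg G) p.

Lemma corrector_leaf G p t : leaf_continuous G ->
  leafint G p t =
  corrector G (Psi t p) - corrector G p + leafint (renorm G) (M p) (t / Lam).
Proof.
move=> cG; have := leafprim_leaf p t cG; have := leafprim_leaf p t (leafavg_continuous cG).
rewrite -leafint_renorm // /corrector; lra.
Qed.

Lemma corrector_sup (K : R) G p : leaf_continuous G -> nrm K G ->
  `|corrector G p| <= 2 * K * Lam.
Proof.
move=> cG GK; have K0 : 0 <= K by apply: reg1_ge0 (GK 0).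
have GK' q : `|G q| <= K by case: q => a b; case: (GK b).
have := leafprim_sup p cG K0 GK'.
have := leafprim_sup p (leafavg_continuous cG) K0 (leafavg_sup cG GK').
by move=> h1 h2; apply: le_trans (ler_normD _ _) _; lra.
Qed.

Lemma corrector_lip (K : R) G a b d : leaf_continuous G -> nrm K G ->
  `|corrector G (a + d, b) - corrector G (a, b)| <= 6 * K * Lam * `|d|.
Proof.
move=> cG GK; have K0 : 0 <= K by apply: reg1_ge0 (GK 0).
have K2 : 0 <= 2 * K by rewrite mulr_ge0.
have JL : hlip (2 * K) (leafavg G).
  move=> x y z; apply: le_trans (leafavg_lip cG (hlip_nrm GK) K0 _ _ _) _.
  by rewrite ler_wpM2r // mulrC ler_wpM2r //; have := eta_le1; lra.
have h1 := leafprim_lip a b d cG K0 (hlip_nrm GK).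
have h2 := leafprim_lip a b d (leafavg_continuous cG) K2 JL.
rewrite /corrector.
have -> : forall x y z t : R, x + y - (z + t) = (x - z) + (y - t) by move=> *; ring.
by apply: le_trans (ler_normD _ _) _; lra.
Qed.

Lemma corrector_along_leaf (K : R) G p t : leaf_continuous G -> nrm K G ->
  `|corrector G (Psi t p) - corrector G p| <= 2 * K * `|t|.
Proof.
move=> cG GK; have K0 : 0 <= K by apply: reg1_ge0 (GK 0).
have GK' q : `|G q| <= K by case: q => a b; case: (GK b).
have cJ := leafavg_continuous cG.
have := corrector_leaf p t cG; rewrite -leafint_renorm // => E.
have -> : corrector G (Psi t p) - corrector G p =
  leafint G p t - leafint (leafavg (leafavg G)) p t by rewrite E; ring.
have := leafint_le (p := p) (t := t) cG (fun r _ => GK' _).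
have := leafint_le (p := p) (t := t) (leafavg_continuous cJ)
  (fun r _ => leafavg_sup cJ (leafavg_sup cG GK') _).
by move=> h1 h2; apply: le_trans (ler_normB _ _) _; lra.
Qed.

Lemma corrector_periodic G : lat_periodic G -> lat_periodic (corrector G).
Proof.
have H f : lat_periodic f -> lat_periodic (leafprim f).
  move=> pf v p lv; rewrite /leafprim; congr (- (_ * itg _ _)).
  apply/funext => t; rewrite /leafint; congr (itg _ _).
  by apply/funext => r; rewrite PsiL // pf.
move=> pG v p lv; rewrite /corrector !H //; exact: leafavg_periodic.
Qed.

Definition renorm_iter n G := iter n renorm G.

Lemma renorm_iter_continuous n G : leaf_continuous G -> leaf_continuous (renorm_iter n G).
Proof. by move=> cG; elim: n => //= n; exact: renorm_continuous. Qed.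

Lemma renorm_iter_periodic n G : lat_periodic G -> lat_periodic (renorm_iter n G).
Proof. by move=> cG; elim: n => //= n; exact: renorm_periodic. Qed.

Lemma iter_MPsi n t p : iter n M (Psi t p) = Psi (t / Lam ^+ n) (iter n M p).
Proof.
elim: n => [|n IH] /=; first by rewrite expr0 divr1.
by rewrite IH MPsi exprSr invfM mulrA [t * _ * _]mulrAC.
Qed.

Lemma iter_M_lat n v p : lat v -> exists2 v', lat v' & iter n M (p + v) = iter n M p + v'.
Proof.
move=> lv; elim: n => [|n [v' lv' IH]] /=; first by exists v.
by rewrite IH; exact: ML.
Qed.

(** [Mi] multiplies second coordinates by Lam whatever the first one is, so its inverse maps
    horizontal lines to horizontal lines; [Mi_lower] bounds the stretching. *)
Lemma M_line a b d : exists2 d', M (a + d, b) = M (a, b) + (d', 0) & `|d'| <= 2 * Lam * `|d|.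
Proof.
set q := M (a, b); set q' := M (a + d, b).
have E2 : q'.2 = q.2.
  apply: (mulfI (lt0r_neq0 Lam_gt0)).
  by rewrite -!Mi2 !MK.
exists (q'.1 - q.1).
  by apply: injective_projections; rewrite /= ?E2 ?addr0 // addrC subrK.
have := Mi_lower q.1 q.2 (q'.1 - q.1).
rewrite [q.1 + _]addrC subrK -{1}E2 -!surjective_pairing !MK /=.
by rewrite [a + d]addrC addrK.
Qed.

Lemma iter_M_line n a b d : exists2 d',
  iter n M (a + d, b) = iter n M (a, b) + (d', 0) & `|d'| <= (2 * Lam) ^+ n * `|d|.
Proof.
elim: n => [|n [d' IH Hd]] /=.
  by exists d; [rewrite shift_pairE|rewrite expr0 mul1r].
rewrite IH; case: (iter n M (a, b)) => x y; rewrite shift_pairE.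
have [d'' -> H] := M_line x y d'; exists d'' => //.
by apply: le_trans H _; rewrite exprS -[X in _ <= X]mulrA ler_wpM2l // mulr_ge0.
Qed.

Lemma leafint_decomposition n G p t : leaf_continuous G ->
  leafint G p t = \sum_(k < n) (corrector (renorm_iter k G) (iter k M (Psi t p))
     - corrector (renorm_iter k G) (iter k M p))
  + leafint (renorm_iter n G) (iter n M p) (t / Lam ^+ n).
Proof.
move=> cG; elim: n => [|n IH]; first by rewrite big_ord0 add0r expr0 divr1.
rewrite IH big_ord_recr /= -addrA; congr (_ + _).
rewrite (corrector_leaf _ _ (@renorm_iter_continuous n _ cG)) iter_MPsi.
by rewrite exprSr invfM mulrA.
Qed.

(** * The dichotomy between one sign and decay *)

Variable q : R.
Hypothesis q_ge : 378 * e4 <= q.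
Hypothesis q_gt0 : 0 < q.
Hypothesis q_Lam : q * Num.sqrt (2 * Lam) <= 1 / 2.
Hypothesis drift_small : forall r p, `|r| <= 1 -> `|drift r p| <= `|r|.

Definition one_signed f := exists2 c, 0 < c &
  (forall p, c <= f p) \/ (forall p, f p <= - c).

(** By 378 = 3 * 126, the renormalised function stays within q K / 3 of the constant [c]. If |c| > 2
    q K / 3 it has one sign, with a margin q K / 3; otherwise its sup is at most q K. *)
Lemma renorm_step (K : R) G : 0 < K -> leaf_continuous G -> lat_periodic G -> nrm K G ->
  one_signed (renorm G) \/ nrm (q * K) (renorm G).
Proof.
move=> K0 cG pG GK; have [c Hc] := renorm_nrm cG pG GK.
have e0 : 0 <= e4 by apply: le_trans mu_Lam; exact: sqr_ge0.
have qK : 126 * e4 * K <= q * K / 3 by have := ler_wpM2r (ltW K0) q_ge; lra.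
have sup p : `|renorm G p - c| <= q * K / 3.
  by case: p => a b; case: (Hc b) => /(_ a) H _ _; apply: le_trans H qK.
have qK0 : 0 < q * K by rewrite mulr_gt0.
have [c2|c2] := leP `|c| (q * K * (2 / 3)).
  right=> b; have [h1 h2 h3] := Hc b; split=> [a|a d|a d d'].
  - have := sup (a, b) => h; rewrite -[renorm G (a, b)](subrK c).
    by apply: le_trans (ler_normD _ _) _; lra.
  - have := h2 a d; set x := renorm G _; set y := renorm G _.
    have -> : x - c - (y - c) = x - y by ring.
    by move=> /le_trans; apply; rewrite ler_wpM2r //; lra.
  - have := h3 a d d'; set x := renorm G _; set y := renorm G _; set z := renorm G _.
    set u := renorm G _.
    have -> : x - c - (y - c) - (z - c) + (u - c) = x - y - z + u by ring.
    move=> /le_trans; apply; rewrite ler_wpM2r ?wmod_ge0 // ler_wpM2r //; lra.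
left; exists (q * K / 3); first by rewrite divr_gt0.
have [c0|c0] := leP 0 c.
  left=> p; have := sup p; rewrite ler_norml => /andP[h1 h2].
  by move: c2; rewrite ger0_norm // => c2; lra.
right=> p; have := sup p; rewrite ler_norml => /andP[h1 h2].
by move: c2; rewrite ltr0_norm // => c2; lra.
Qed.

Lemma renorm_dichotomy (K : R) G : 0 < K -> leaf_continuous G -> lat_periodic G -> nrm K G ->
  (exists n, one_signed (renorm_iter n G)) \/ (forall n, nrm (q ^+ n * K) (renorm_iter n G)).
Proof.
move=> K0 cG pG GK; have [[n]|no] := pselect (exists n, one_signed (renorm_iter n G)).
  by left; exists n.
right; elim=> [|n IH]; first by rewrite expr0 mul1r.
have Kn : 0 < q ^+ n * K by rewrite mulr_gt0 // exprn_gt0.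
have [H|] := renorm_step Kn (@renorm_iter_continuous n _ cG) (@renorm_iter_periodic n _ pG) IH.
  by case: no; exists n.+1.
by rewrite exprS -mulrA.
Qed.

Lemma one_signed_growth n (K : R) G : leaf_continuous G -> lat_periodic G -> nrm K G ->
  one_signed (renorm_iter n G) -> leaf_growth G.
Proof.
move=> cG pG GK [c c0 Hc]; have L0 : 0 < Lam ^+ n by rewrite exprn_gt0.
have step m (K' : R) f : leaf_continuous f -> lat_periodic f -> nrm K' f ->
    exists K'' : R, nrm K'' (renorm_iter m f).
  elim: m K' f => [|m IH] K' f cf pf Kf; first by exists K'.
  have [K'' H] := IH _ _ cf pf Kf.
  have [c' Hc'] := renorm_nrm (@renorm_iter_continuous m _ cf) (@renorm_iter_periodic m _ pf) H.
  have K0 : 0 <= 126 * e4 * K'' by apply: reg1_ge0 (Hc' 0).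
  exists (126 * e4 * K'' + `|c'|) => b; have [h1 h2 h3] := Hc' b; split=> [a|a d|a d d'].
  - rewrite -[renorm_iter _ _ _](subrK c') /=; apply: le_trans (ler_normD _ _) _.
    by rewrite lerD2r.
  - have := h2 a d; rewrite /=; set x := renorm _ _; set y := renorm _ _.
    have -> : x - c' - (y - c') = x - y by ring.
    by move=> /le_trans; apply; rewrite ler_wpM2r // lerDl.
  - have := h3 a d d'; rewrite /=; set x := renorm _ _; set y := renorm _ _; set z := renorm _ _.
    set u := renorm _ _.
    have -> : x - c' - (y - c') - (z - c') + (u - c') = x - y - z + u by ring.
    by move=> /le_trans; apply; rewrite ler_wpM2r ?wmod_ge0 // ler_wpM2r // lerDl.
pose Kf k := projT1 (cid (step k K G cG pG GK)).
have Kfk k : nrm (Kf k) (renorm_iter k G) by rewrite /Kf; case: cid.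
pose C := \sum_(k < n) (4 * Kf k * Lam).
exists (c / Lam ^+ n), C; split; first by rewrite divr_gt0.
have sumC p t : `|\sum_(k < n) (corrector (renorm_iter k G) (iter k M (Psi t p))
     - corrector (renorm_iter k G) (iter k M p))| <= C.
  apply: le_trans (ler_norm_sum _ _ _) _; apply: ler_sum => k _.
  have h x := corrector_sup x (@renorm_iter_continuous k _ cG) (Kfk k).
  apply: le_trans (ler_normB _ _) _.
  have := lerD (h (iter k M (Psi t p))) (h (iter k M p)).
  by move=> /le_trans; apply; rewrite le_eqVlt; apply/orP; left; apply/eqP; ring.
have grow f p (t : R) : leaf_continuous f -> (forall p, c <= f p) -> 0 <= t ->
    c * t <= leafint f p t.
  move=> cf fc t0.
  have D x : der (fun s => leafint f p s - c * s) x (f (Psi x p) - c).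
    apply: derB; first exact: der_leafint.
    by apply: der_eq (derZ _ (der_id x)) _; rewrite mulr1.
  rewrite -subr_ge0.
  move: t0; rewrite le_eqVlt => /predU1P[<-|t0'].
    by rewrite leafint0 mulr0 subrr.
  have [|x _ E] := @MVT R _ _ 0 t t0' (fun x _ => D x).
    by apply: continuous_subspaceT => x; exact: der_continuous (D x).
  move: E; rewrite leafint0 mulr0 !subr0 => ->.
  by rewrite mulr_ge0 ?subr_ge0 // ltW.
have dec p t := leafint_decomposition n p t cG.
case: Hc => Hc; [left|right] => p t t0.
- have tL : 0 <= t / Lam ^+ n by rewrite divr_ge0 // ltW.
  have h' := grow _ (iter n M p) _ (@renorm_iter_continuous n _ cG) Hc tL.
  rewrite (dec p t); have := sumC p t; rewrite ler_norml => /andP[h _].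
  by rewrite mulrAC -mulrA; lra.
- have cN : leaf_continuous (fun p => - renorm_iter n G p).
    by move=> p' r; apply: cvgN; exact: (@renorm_iter_continuous n _ cG p').
  have := grow _ (iter n M p) (t / Lam ^+ n) cN.
  have -> : leafint (fun p => - renorm_iter n G p) (iter n M p) (t / Lam ^+ n) =
      - leafint (renorm_iter n G) (iter n M p) (t / Lam ^+ n).
    rewrite {1}/leafint.
    rewrite (@itg_primitive R _ (fun t => - leafint (renorm_iter n G) (iter n M p) t)).
    + by rewrite leafint0 oppr0 subr0.
    + exact: cN.
    + by move=> x; apply: derN; apply: der_leafint; exact: renorm_iter_continuous.
  have tL : 0 <= t / Lam ^+ n by rewrite divr_ge0 // ltW.
  move=> H; rewrite (dec p t); have := sumC p t; rewrite ler_norml => /andP[_ h].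
  have h' : c * (t / Lam ^+ n) <= - leafint (renorm_iter n G) (iter n M p) (t / Lam ^+ n).
    by apply: H => // x; have := Hc x; lra.
  by rewrite mulrAC -mulrA; lra.
Qed.

(** * The transfer function and its Hoelder exponent *)

Definition transfer G p := limn (series (fun k => - corrector (renorm_iter k G) (iter k M p))).

Let q_le : q <= 1 / 2.
Proof.
have s1 : 1 <= Num.sqrt (2 * Lam).
  by rewrite -[X in X <= _]sqrtr1; apply: ler_wsqrtr; have := Lam_gt1; lra.
by have := q_Lam; have := ler_wpM2l (ltW q_gt0) s1; rewrite mulr1; lra.
Qed.

Section Transfer.
Variables (K : R) (G : R * R -> R).
Hypothesis K_gt0 : 0 < K.
Hypothesis G_cont : leaf_continuous G.
Hypothesis G_per : lat_periodic G.
Hypothesis G_decay : forall n, nrm (q ^+ n * K) (renorm_iter n G).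

Let u k p := - corrector (renorm_iter k G) (iter k M p).
Let C := 2 * K * Lam.
Let C_ge0 : 0 <= C. Proof. by rewrite !mulr_ge0 // ltW. Qed.

Lemma geometric_partial_sum (r : R) n : 0 <= r <= 1 / 2 -> \sum_(k < n) r ^+ k <= 2.
Proof.
move=> /andP[r0 r1]; have H : (1 - r) * \sum_(k < n) r ^+ k = 1 - r ^+ n.
  by have := subrX1 r n; lra.
have rn : 0 <= r ^+ n by rewrite exprn_ge0.
have S0 : 0 <= \sum_(k < n) r ^+ k by apply: sumr_ge0 => k _; rewrite exprn_ge0.
by nra.
Qed.

Lemma term_le k p : `|u k p| <= C * q ^+ k.
Proof.
rewrite /u normrN.
have := corrector_sup (iter k M p) (@renorm_iter_continuous k _ G_cont) (G_decay k).
by congr (_ <= _); rewrite /C; ring.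
Qed.

Lemma cvg_transfer p : cvgn (series (u^~ p)).
Proof.
apply: normed_cvg; apply: (@series_le_cvg _ _ (geometric C q)).
- by move=> n; rewrite normr_ge0.
- by move=> n; rewrite /geometric /= mulr_ge0 // exprn_ge0 // ltW.
- by move=> n; exact: term_le.
- apply: is_cvg_geometric_series; rewrite gtr0_norm //.
  by apply: le_lt_trans q_le _; lra.
Qed.

Lemma lim_le (x : R^nat) (a D : R) : cvgn x -> (forall n, `|x n - a| <= D) -> `|limn x - a| <= D.
Proof.
move=> cx xD; rewrite ler_distl; apply/andP; split.
  by apply: limr_ge => //; apply: nearW => n; have := xD n; rewrite ler_distl => /andP[].
by apply: limr_le => //; apply: nearW => n; have := xD n; rewrite ler_distl => /andP[].
Qed.

Lemma transfer_diff_le p p' a D :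
  (forall n, `|series (u^~ p) n - series (u^~ p') n - a| <= D) ->
  `|transfer G p - transfer G p' - a| <= D.
Proof.
move=> H; have c1 := @cvg_transfer p; have c2 := @cvg_transfer p'.
rewrite /transfer -limB //; apply: lim_le => //; exact: is_cvgB.
Qed.

Lemma transfer_sup p : `|transfer G p| <= 2 * C.
Proof.
rewrite -[transfer G p]subr0; apply: lim_le; first exact: cvg_transfer.
move=> n; rewrite subr0 /series /= big_mkord; apply: le_trans (ler_norm_sum _ _ _) _.
apply: (@le_trans _ _ (\sum_(k < n) C * q ^+ k)).
  by apply: ler_sum => k _; exact: term_le.
rewrite -mulr_sumr mulrC ler_wpM2r //; apply: geometric_partial_sum.
by apply/andP; split; [exact: ltW|exact: q_le].
Qed.

Lemma transfer_periodic : lat_periodic (transfer G).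
Proof.
move=> v p lv; rewrite /transfer; congr (limn (series _)); apply/funext => k.
have [v' lv' ->] := iter_M_lat k p lv.
by rewrite (corrector_periodic (@renorm_iter_periodic k _ G_per)).
Qed.

(** After n steps the remainder is a leaf integral of the n-th renormalised function over the time t
    / Lam^n, which is bounded by K |t| q^n. *)
Lemma transfer_leaf p t : transfer G p - transfer G (Psi t p) = leafint G p t.
Proof.
have Gk k x : `|renorm_iter k G x| <= q ^+ k * K.
  by case: x => a b; case: (G_decay k b).
have S n : series (u^~ p) n - series (u^~ (Psi t p)) n - leafint G p t =
    - leafint (renorm_iter n G) (iter n M p) (t / Lam ^+ n).
  rewrite (leafint_decomposition n p t G_cont) /series /= !big_mkord -sumrB.
  rewrite opprD addrA -sumrB big1 ?add0r // => k _.
  by rewrite /u; ring.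
apply/eqP; rewrite -subr_eq0 -normr_le0.
apply/ler_addgt0Pr => e e0; rewrite add0r.
have c1 := @cvg_transfer p; have c2 := @cvg_transfer (Psi t p).
have cS : cvgn (fun n => series (u^~ p) n - series (u^~ (Psi t p)) n) by exact: is_cvgB.
have q0 : (fun n => K * `|t| * q ^+ n) @ \oo --> (0 : R).
  rewrite -[X in _ --> X](mulr0 (K * `|t|)); apply: cvgMr.
  by apply: cvg_expr; rewrite gtr0_norm //; apply: le_lt_trans q_le _; lra.
have bound n : `|series (u^~ p) n - series (u^~ (Psi t p)) n - leafint G p t| <= K * `|t| * q ^+ n.
  rewrite S normrN.
  have := leafint_le (p := iter n M p) (t := t / Lam ^+ n)
    (@renorm_iter_continuous n _ G_cont) (fun r _ => Gk n _).
  move=> /le_trans; apply; rewrite normrM [`|(Lam ^+ n)^-1|]gtr0_norm ?invr_gt0 ?exprn_gt0 //.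
  have -> : K * `|t| * q ^+ n = q ^+ n * K * `|t| by ring.
  apply: ler_wpM2l; first by rewrite mulr_ge0 ?exprn_ge0 // ltW.
  by rewrite ler_piMr // invf_le1 ?exprn_gt0 // exprn_ege1 // ltW.
have nr : (fun n => series (u^~ p) n - series (u^~ (Psi t p)) n) @ \oo --> leafint G p t.
  apply/cvgrPdist_le => eps eps0.
  move/cvgrPdist_le: q0 => /(_ _ eps0); apply: filterS => n; rewrite sub0r normrN.
  by apply: le_trans; rewrite distrC; apply: le_trans (bound n) (ler_norm _).
by rewrite /transfer -limB // (cvg_lim _ nr) // subrr normr0 ltW.
Qed.

(** Interpolation by min(1, X) <= sqrt X; this is where the exponent 1/2 enters. *)
Lemma min_sqrt (y X A : R) : 0 <= X -> `|y| <= A -> `|y| <= A * X -> `|y| <= A * Num.sqrt X.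
Proof.
move=> X0 yA yX; have A0 : 0 <= A by apply: le_trans yA.
have [X1|X1] := leP X 1.
  apply: le_trans yX _; rewrite ler_wpM2l // -{1}(sqr_sqrtr X0) expr2 ler_piMr ?sqrtr_ge0 //.
  by rewrite -sqrtr1 ler_sqrt.
by apply: le_trans yA _; rewrite ler_peMr // -sqrtr1 ler_wsqrtr // ltW.
Qed.

(** The k-th term is bounded by a multiple of q^k, and its increments by a multiple of q^k (2 Lam)^k
    times the distance. Interpolation gives the rate (q sqrt(2 Lam))^k <= 2^(-k), which makes the
    sum 1/2-Hoelder. *)
Lemma term_holder k p p' : `|p'.2 - p.2| <= 1 ->
  `|u k p - u k p'| <= 6 * K * Lam * (1 / 2) ^+ k *
     Num.sqrt (`|p'.1 - p.1| + 2 * `|p'.2 - p.2|).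
Proof.
case: p p' => a b [a' b'] /= r1; set r := b' - b in r1 *.
(* The second point is reached by a leaf translation by [r], which the iterates of [M] contract,
   followed by a horizontal move by [d], which they stretch by at most (2 Lam)^k. The drift, at most
   |r|, accounts for the factor 2 in front of |r|. *)
set d := a' - a - drift r (a, b).
have K6 : 0 <= 6 * K * Lam * q ^+ k by rewrite !mulr_ge0 ?exprn_ge0 // ltW.
have Kq : 0 <= q ^+ k * K by rewrite mulr_ge0 ?exprn_ge0 // ltW.
have d_le : `|d| + `|r| <= `|a' - a| + 2 * `|r|.
  have := ler_normB (a' - a) (drift r (a, b)); have := drift_small (a, b) r1.
  by rewrite -/d; lra.
have L2 : 1 <= 2 * Lam by have := Lam_gt1; lra.
have L20 : 0 <= 2 * Lam by lra.
have K6' : 0 <= 6 * (q ^+ k * K) * Lam by rewrite mulr_ge0 // mulr_ge0.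
have L2k : 1 <= (2 * Lam) ^+ k by rewrite exprn_ege1.
pose X := (2 * Lam) ^+ k * (`|a' - a| + 2 * `|r|).
have X0 : 0 <= X by rewrite mulr_ge0 ?addr_ge0 ?exprn_ge0 ?mulr_ge0.
have -> : (a', b') = (a + drift r (a, b) + d, b + r).
  by rewrite /d /r; congr (_, _); ring.
have lip : `|u k (a, b) - u k (a + drift r (a, b) + d, b + r)| <= 6 * K * Lam * q ^+ k * X.
  have [d' E dk] := iter_M_line k (a + drift r (a, b)) (b + r) d.
  rewrite /u E -PsiE iter_MPsi; set x := iter k M (a, b).
  have cG := @renorm_iter_continuous k _ G_cont.
  have h1 := corrector_along_leaf x (r / Lam ^+ k) cG (G_decay k).
  have := corrector_lip (Psi (r / Lam ^+ k) x).1 (Psi (r / Lam ^+ k) x).2 d' cG (G_decay k).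
  rewrite -shift_pairE -surjective_pairing => h2.
  set y2 := corrector _ (_ + _) in h2 *; set y1 := corrector _ (Psi _ _) in h1 h2 *.
  have -> : - corrector (renorm_iter k G) x - - y2 =
    (y2 - y1) + (y1 - corrector (renorm_iter k G) x) by ring.
  apply: le_trans (ler_normD _ _) _; apply: le_trans (lerD h2 h1) _.
  have h3 : `|r / Lam ^+ k| <= `|r|.
    rewrite normrM [`|(Lam ^+ k)^-1|]gtr0_norm ?invr_gt0 ?exprn_gt0 //.
    by rewrite ler_piMr // invf_le1 ?exprn_gt0 // exprn_ege1 // ltW.
  apply: (@le_trans _ _ (6 * (q ^+ k * K) * Lam * ((2 * Lam) ^+ k * `|d|) +
      6 * (q ^+ k * K) * Lam * ((2 * Lam) ^+ k * `|r|))).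
    apply: lerD; first by rewrite ler_wpM2l.
    apply: (@le_trans _ _ (2 * (q ^+ k * K) * `|r|)); first by rewrite ler_wpM2l // mulr_ge0.
    have : `|r| <= (2 * Lam) ^+ k * `|r| by rewrite ler_peMl.
    have : 1 <= Lam by apply: ltW.
    set z := (2 * Lam) ^+ k * `|r|; set w := q ^+ k * K in Kq *; move=> l1 l2.
    have z0 : 0 <= z by apply: le_trans l2.
    apply: (@le_trans _ _ (2 * w * z)); first by rewrite ler_wpM2l // mulr_ge0.
    have : 0 <= w * z by rewrite mulr_ge0.
    have -> : 6 * w * Lam * z = 6 * (w * z) * Lam by ring.
    move=> wz0; apply: (@le_trans _ _ (6 * (w * z))); first lra.
    by rewrite ler_peMr // mulr_ge0.
  rewrite -mulrDr -mulrDr.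
  have -> : 6 * (q ^+ k * K) * Lam = 6 * K * Lam * q ^+ k by ring.
  by rewrite ler_wpM2l // ler_wpM2l // exprn_ge0 // ltW // (lt_le_trans ltr01).
have sup : `|u k (a, b) - u k (a + drift r (a, b) + d, b + r)| <= 6 * K * Lam * q ^+ k.
  apply: le_trans (ler_normB _ _) _; apply: le_trans (lerD (term_le _ _) (term_le _ _)) _.
  rewrite /C; have : 0 <= K * Lam * q ^+ k by rewrite !mulr_ge0 ?exprn_ge0 // ltW.
  lra.
apply: le_trans (min_sqrt X0 sup lip) _.
rewrite /X sqrtrM ?exprn_ge0 ?mulr_ge0 // mulrA ler_wpM2r ?sqrtr_ge0 //.
rewrite -mulrA; apply: ler_wpM2l; first by rewrite !mulr_ge0 // ltW.
have -> : Num.sqrt ((2 * Lam) ^+ k) = Num.sqrt (2 * Lam) ^+ k.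
  elim: k {L2k X X0 lip sup K6 K6' Kq} => [|k IH]; first by rewrite !expr0 sqrtr1.
  by rewrite !exprS sqrtrM ?mulr_ge0 // IH.
rewrite -exprMn lerXn2r // ?nnegrE ?mulr_ge0 ?sqrtr_ge0 ?ltW //; lra.
Qed.

Lemma transfer_holder p p' : `|transfer G p - transfer G p'| <=
  24 * K * Lam * Num.sqrt (`|p'.1 - p.1| + `|p'.2 - p.2|).
Proof.
have KL : 0 <= K * Lam by rewrite mulr_ge0 // ltW.
set D := `|p'.1 - p.1| + `|p'.2 - p.2|.
have [r1|r1] := leP `|p'.2 - p.2| 1; last first.
  have s1 : 1 <= Num.sqrt D.
    rewrite -[X in X <= _]sqrtr1; apply: ler_wsqrtr.
    by rewrite /D; have := normr_ge0 (p'.1 - p.1); lra.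
  apply: le_trans (ler_normB _ _) _.
  apply: le_trans (lerD (transfer_sup _) (transfer_sup _)) _.
  rewrite /C; apply: (@le_trans _ _ (24 * K * Lam)); first lra.
  by rewrite ler_peMr //; lra.
rewrite -[_ - _]subr0; apply: transfer_diff_le => n; rewrite subr0.
rewrite /series /= !big_mkord -sumrB; apply: le_trans (ler_norm_sum _ _ _) _.
apply: (@le_trans _ _ (\sum_(k < n) 6 * K * Lam * (1 / 2) ^+ k *
    Num.sqrt (`|p'.1 - p.1| + 2 * `|p'.2 - p.2|))).
  by apply: ler_sum => k _; exact: term_holder.
rewrite -mulr_suml -mulr_sumr.
have half : 0 <= (1 / 2 : R) <= 1 / 2 by lra.
have g2 := geometric_partial_sum n half.
have sD : Num.sqrt (`|p'.1 - p.1| + 2 * `|p'.2 - p.2|) <= 2 * Num.sqrt D.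
  have -> : 2 * Num.sqrt D = Num.sqrt (4 * D).
    rewrite sqrtrM // (_ : (4 : R) = 2 ^+ 2); last by rewrite expr2; ring.
    by rewrite sqrtr_sqr ger0_norm.
  by apply: ler_wsqrtr; rewrite /D; have := normr_ge0 (p'.1 - p.1); have := normr_ge0 (p'.2 - p.2); lra.
apply: (@le_trans _ _ (6 * K * Lam * 2 * (2 * Num.sqrt D))).
  apply: ler_pM => //; rewrite ?sqrtr_ge0 //.
    apply: mulr_ge0; first by rewrite !mulr_ge0 // ltW.
    by apply: sumr_ge0 => k _; rewrite exprn_ge0.
  by rewrite ler_wpM2l //; lra.
by rewrite le_eqVlt; apply/orP; left; apply/eqP; ring.
Qed.

End Transfer.

Theorem leaf_cohomology (K : R) G : leaf_continuous G -> lat_periodic G -> nrm K G ->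
  leaf_growth G \/ leaf_coboundary G.
Proof.
move=> cG pG GK'; have K0 : 0 <= K by apply: reg1_ge0 (GK' 0).
have GK : nrm (K + 1) G by move=> b; apply: reg1_le (GK' b); lra.
have {}K0 : 0 < K + 1 by lra.
have [[n Gn]|dec] := renorm_dichotomy K0 cG pG GK.
  by left; exact: one_signed_growth pG GK Gn.
right; exists (fun p => - transfer G p), (24 * (K + 1) * Lam); split.
- by move=> v p lv; rewrite (transfer_periodic pG p lv).
- by move=> p t; rewrite -(transfer_leaf K0 cG dec) opprK addrC.
- move=> p; rewrite normrN; apply: le_trans (transfer_sup K0 cG dec p) _.
  by have : 0 <= (K + 1) * Lam by [rewrite mulr_ge0 // ltW]; lra.
- move=> p p'; have -> : - transfer G p - - transfer G p' = - (transfer G p - transfer G p').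
    by rewrite opprB opprK addrC.
  rewrite normrN; have T := transfer_holder K0 cG dec p p'; exact: T.
Qed.

End Averaging.

(** * The lattice Z^2 in eigen-coordinates of the hyperbolic matrix *)

Section Lattice.
Context {R : realType}.
Implicit Types (x y : R) (v p : R * R).

Definition gold : R := (1 + Num.sqrt 5) / 2.
Definition lam : R := gold + 1.

Lemma sqrt5_bounds : 2236 / 1000 <= Num.sqrt (5 : R) <= 2237 / 1000.
Proof.
have s0 : 0 <= Num.sqrt 5 :> R := sqrtr_ge0 _.
have s5 : Num.sqrt 5 ^+ 2 = 5 :> R by rewrite sqr_sqrtr.
by apply/andP; split; rewrite leNgt; apply/negP => h; nra.
Qed.

Lemma gold_sqr : gold ^+ 2 = gold + 1.
Proof.
have s5 : Num.sqrt 5 ^+ 2 = 5 :> R by rewrite sqr_sqrtr.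
by rewrite /gold; move: s5; nra.
Qed.

Lemma gold_bounds : 1618 / 1000 <= gold <= 1619 / 1000.
Proof. by have := sqrt5_bounds; rewrite /gold => /andP[h1 h2]; apply/andP; split; lra. Qed.

Lemma gold_gt0 : 0 < gold.
Proof. by have := gold_bounds => /andP[h1 h2]; lra. Qed.

Lemma lam_bounds : 2618 / 1000 <= lam <= 2619 / 1000.
Proof. by have := gold_bounds; rewrite /lam => /andP[h1 h2]; apply/andP; split; lra. Qed.

Lemma lam_gt0 : 0 < lam.
Proof. by have := lam_bounds => /andP[h1 h2]; lra. Qed.

Lemma lam_ge2 : 2 <= lam.
Proof. by have := lam_bounds => /andP[h1 h2]; lra. Qed.

Lemma lam_pow_unbounded (x : R) : exists k, x <= lam ^+ k.
Proof.
exists (Num.truncn `|x|).+1; apply: le_trans (ler_norm x) _.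
apply: (@le_trans _ _ ((Num.truncn `|x|).+1%:R)); first by rewrite ltW // truncnS_gt.
apply: (@le_trans _ _ (2 ^+ (Num.truncn `|x|).+1)).
  by rewrite -natrX ler_nat ltnW // ltn_expl.
by rewrite lerXn2r ?nnegrE ?lam_ge2 // ltW // lam_gt0.
Qed.

Lemma gold_inv : gold^-1 = gold - 1.
Proof.
have g0 := gold_gt0; apply: (mulfI (lt0r_neq0 g0)).
by rewrite divff ?lt0r_neq0 //; have := gold_sqr; lra.
Qed.

Lemma lam_inv : lam^-1 = 2 - gold.
Proof.
have l0 := lam_gt0; apply: (mulfI (lt0r_neq0 l0)).
by rewrite divff ?lt0r_neq0 // /lam; have := gold_sqr; lra.
Qed.

(* Coordinates in which the hyperbolic matrix (2 1; 1 1) is (a, b) |-> (lam a, b / lam). *)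
Definition eigen p : R * R := (p.2 + gold * p.1, p.2 - p.1 / gold).

Definition lat v := exists k l : int, v = eigen (k%:~R, l%:~R).

Let gold_rel (x : R) : x * (gold + 1 - gold ^+ 2) = 0.
Proof. by rewrite gold_sqr subrr mulr0. Qed.

Lemma lat_one : lat (1, 1).
Proof. by exists 0, 1; rewrite /eigen /= !mul0r mulr0 subr0 addr0. Qed.

Lemma lat_contract v : lat v -> lat (v.1 / lam, lam * v.2).
Proof.
(* The inverse of (2 1; 1 1) is (1 -1; -1 2). *)
move=> [k [l ->]]; exists (k - l), (2 * l - k); rewrite /eigen /= lam_inv gold_inv /lam.
rewrite !intrD !mulrNz intrM; have := gold_rel k%:~R.
by move=> E; congr (_, _); apply/eqP; rewrite -subr_eq0 -E; apply/eqP; ring.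
Qed.

Lemma lat_expand v : lat v -> lat (lam * v.1, v.2 / lam).
Proof.
move=> [k [l ->]]; exists (2 * k + l), (k + l); rewrite /eigen /= lam_inv gold_inv /lam.
rewrite !intrD intrM; have := gold_rel (- k%:~R).
by move=> E; congr (_, _); apply/eqP; rewrite -subr_eq0 -E; apply/eqP; ring.
Qed.

Lemma lat_contractn n v : lat v -> lat (v.1 / lam ^+ n, lam ^+ n * v.2).
Proof.
move=> lv; elim: n => [|n IH].
  by rewrite expr0 divr1 mul1r -surjective_pairing.
by have := lat_contract IH; rewrite /= exprSr invfM !mulrA [lam * _]mulrC.
Qed.

Lemma lat_expandn n v : lat v -> lat (lam ^+ n * v.1, v.2 / lam ^+ n).
Proof.
move=> lv; elim: n => [|n IH].
  by rewrite expr0 divr1 mul1r -surjective_pairing.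
by have := lat_expand IH; rewrite /= exprSr invfM !mulrA [lam * _]mulrC.
Qed.

(** (1, 1) represents the integer vector (0, 1); its images under powers of the inverse matrix are
    lattice vectors almost parallel to the leaves. *)
Lemma lat_pow n : lat ((lam ^+ n)^-1, lam ^+ n).
Proof. by have := lat_contractn n lat_one; rewrite /= mul1r mulr1. Qed.

Let unit_box_bound (u z : R) : 0 <= u -> u <= 1 -> 0 <= z -> z <= 1 ->
  `|u + gold * z| <= 4 /\ `|u - z * (gold - 1)| <= 2.
Proof.
move=> u0 u1 z0 z1; have /andP[g1 g2] := gold_bounds.
have gz0 : 0 <= gold * z by rewrite mulr_ge0 // ltW // gold_gt0.
have gz1 : gold * z <= gold by rewrite ler_piMr // ltW // gold_gt0.
split; rewrite ler_norml; apply/andP; split; lra.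
Qed.

Lemma lat_reduction0 x y : exists v, lat v /\ (`|x + v.1| <= 4 /\ `|y + v.2| <= 2).
Proof.
pose k := (x - y) / Num.sqrt 5; pose l := x - gold * k.
have [s1 s2] := andP sqrt5_bounds; have [g1 g2] := andP gold_bounds.
have s0 : Num.sqrt 5 != 0 :> R by rewrite gt_eqF //; lra.
have kE : k * Num.sqrt 5 = x - y by rewrite /k divfK.
have xE : x = l + gold * k by rewrite /l; ring.
have yE : y = l - k / gold.
  have : k * (gold + gold^-1) = x - y.
    by rewrite -kE gold_inv /gold; congr (_ * _); field.
  by rewrite mulrDr; lra.
have fl (z : R) : exists2 n : int, 0 <= z + n%:~R & z + n%:~R <= 1.
  exists (- Num.floor z).
    by rewrite rmorphN subr_ge0 floor_le.
  by rewrite rmorphN lerBlDl ltW // -[1]/(1%:~R) -intrD floorD1_gt.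
have [m m0 m1] := fl k; have [n n0 n1] := fl l.
exists (eigen (m%:~R, n%:~R)); split; first by exists m, n.
rewrite {1}xE {1}yE /eigen /=.
have -> : l + gold * k + (n%:~R + gold * m%:~R) = (l + n%:~R) + gold * (k + m%:~R) by ring.
have -> : l - k / gold + (n%:~R - m%:~R / gold) = (l + n%:~R) - (k + m%:~R) / gold by ring.
rewrite gold_inv.
set u := l + n%:~R in n0 n1 *; set z := k + m%:~R in m0 m1 *.
exact: unit_box_bound.
Qed.

(** The hyperbolic matrix preserves the lattice, so a fixed bounded box meeting every coset can be
    squeezed by lam^n across the leaves and stretched by lam^n along them. *)
Lemma lat_reductionn n x y : exists v, lat v /\
  (`|x + v.1| <= 4 / lam ^+ n /\ `|y + v.2| <= 2 * lam ^+ n).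
Proof.
have L0 : 0 < lam ^+ n by rewrite exprn_gt0 // lam_gt0.
have [v [lv [h1 h2]]] := lat_reduction0 (x * lam ^+ n) (y / lam ^+ n).
exists (v.1 / lam ^+ n, lam ^+ n * v.2); split; first exact: lat_contractn.
have L1 : lam ^+ n != 0 by rewrite gt_eqF.
split => /=.
  have -> : x + v.1 / lam ^+ n = (x * lam ^+ n + v.1) / lam ^+ n by field.
  by rewrite normrM [`|(lam ^+ n)^-1|]gtr0_norm ?invr_gt0 // ler_pM2r ?invr_gt0.
have -> : y + lam ^+ n * v.2 = (y / lam ^+ n + v.2) * lam ^+ n by field.
by rewrite normrM [`|lam ^+ n|]gtr0_norm // ler_pM2r.
Qed.

End Lattice.

(** * Iteration of the return map and choice of the scales *)

Section RenormalizableFlow.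
Context {R : realType}.
Notation lam := (@lam R).
Implicit Types (p v : R * R).

Lemma nrm_le (K K' : R) (G : R * R -> R) : K <= K' -> nrm K G -> nrm K' G.
Proof. by move=> KK GK b; apply: reg1_le (GK b). Qed.

(* [Psi] is the stable flow in eigen-coordinates, with the second coordinate as time; [Fi] is the
   inverse Anosov map, corrected along leaves so as to multiply that coordinate exactly by lam. *)
Record renormalizable_flow (Psi : R -> R * R -> R * R) (Fi : R * R -> R * R) (T eta : R) : Prop :=
  RenormalizableFlow {
  rfD : forall s t p, Psi (s + t) p = Psi s (Psi t p);
  rf2 : forall t p, (Psi t p).2 = p.2 + t;
  rfL : forall t v p, lat v -> Psi t (p + v) = Psi t p + v;
  rf_drift : forall t, `|t| <= T -> nrm eta (drift Psi t);
  rf_small : forall r p, `|r| <= 1 -> `|drift Psi r p| <= `|r|;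
  rfi2 : forall p, (Fi p).2 = lam * p.2;
  rfiPsi : forall t p, Fi (Psi t p) = Psi (lam * t) (Fi p);
  rfiL : forall v p, lat v -> Fi (p + v) = Fi p + (v.1 / lam, lam * v.2);
  rfi_nrm : nrm eta (fun p => (Fi p).1 - p.1 / lam) }.

Section Iterate.
Variables (Psi : R -> R * R -> R * R) (Fi : R * R -> R * R) (T eta : R).
Hypothesis rf : renormalizable_flow Psi Fi T eta.

Lemma iter_rfi2 n p : (iter n Fi p).2 = lam ^+ n * p.2.
Proof. by elim: n => [|n IH] /=; rewrite ?expr0 ?mul1r // (rfi2 rf) IH exprS mulrA. Qed.

Lemma iter_rfiPsi n t p : iter n Fi (Psi t p) = Psi (lam ^+ n * t) (iter n Fi p).
Proof. by elim: n => [|n IH] /=; rewrite ?expr0 ?mul1r // IH (rfiPsi rf) exprS mulrA. Qed.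

Lemma iter_rfiL n v p : lat v ->
  iter n Fi (p + v) = iter n Fi p + (v.1 / lam ^+ n, lam ^+ n * v.2).
Proof.
move=> lv; elim: n => [|n IH] /=.
  by rewrite expr0 divr1 mul1r -surjective_pairing.
by rewrite IH (rfiL rf) ?exprSr ?invfM /= ?mulrA //; [rewrite [lam * _]mulrC|exact: lat_contractn].
Qed.

(** The defect of n + 1 steps is the earlier defect divided by lam plus the defect of [Fi] at the
    n-th image. As long as the total stays below 1, the first coordinate of the n-th image stretches
    differences by at most 2 and has four-point defect at most 1, so each step adds at most (2 * 2 +
    1) eta. *)
Lemma iter_rfi_nrm n : 5 * n%:R * eta <= 1 ->
  nrm (5 * n%:R * eta) (fun p => (iter n Fi p).1 - p.1 / lam ^+ n).
Proof.
have e0 : 0 <= eta by apply: reg1_ge0 (rfi_nrm rf 0).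
elim: n => [|n IH] ne b.
  rewrite mulr0 mul0r; split=> [a|a d|a d d']; rewrite /= expr0 !divr1 ?mul0r ?subrr ?normr0 //.
  by rewrite add0r normr0.
have nS : 5 * n.+1%:R * eta = 5 * n%:R * eta + 5 * eta by rewrite -natr1; ring.
have ne' : 5 * n%:R * eta <= 1 by move: ne; rewrite nS; lra.
have [h1 h2 h3] := IH ne' b.
set c := 5 * n%:R * eta in nS ne' h1 h2 h3 *.
have c0 : 0 <= c by rewrite /c !mulr_ge0.
pose k a := (iter n Fi (a, b)).1.
have [g1 g2 g3] := rfi_nrm rf (lam ^+ n * b).
pose ka x := (Fi (x, lam ^+ n * b)).1 - x / lam.
have il : 0 <= lam^-1 <= 1 by rewrite lam_inv; have /andP[x1 x2] := @gold_bounds R; apply/andP; split; lra.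
have kE a : (iter n.+1 Fi (a, b)).1 - a / lam ^+ n.+1 =
    (k a - a / lam ^+ n) / lam + ka (k a).
  rewrite /= /ka /k [iter n Fi (a, b)]surjective_pairing iter_rfi2 /= exprSr invfM; ring.
have ln0 : 0 <= (lam ^+ n)^-1 <= 1.
  have l1 : 1 <= lam by have := @lam_ge2 R; lra.
  have l0 := @lam_gt0 R; apply/andP; split; first by rewrite invr_ge0 exprn_ge0 // ltW.
  by rewrite invf_le1 ?exprn_gt0 // exprn_ege1.
have klip a d : `|k (a + d) - k a| <= 2 * `|d|.
  have := h2 a d; rewrite /= -/(k _) -/(k a) => h.
  have -> : k (a + d) - k a = (k (a + d) - (a + d) / lam ^+ n - (k a - a / lam ^+ n))
    + d / lam ^+ n by ring.
  apply: le_trans (ler_normD _ _) _; rewrite normrM.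
  move/andP: ln0 => [l1 l2]; rewrite [`|(lam ^+ n)^-1|]ger0_norm //.
  have : `|d| / lam ^+ n <= `|d| by rewrite ler_piMr.
  have : c * `|d| <= `|d| by rewrite ler_piMl.
  lra.
have contr (x A : R) : `|x| <= A -> `|x / lam| <= A.
  move/andP: il => [l1 l2]; move=> xA; rewrite normrM [`|lam^-1|]ger0_norm //.
  by apply: le_trans xA; rewrite ler_piMr.
rewrite nS; split=> [a|a d|a d d'].
- rewrite kE; apply: le_trans (ler_normD _ _) _; apply: lerD; first exact: contr (h1 a).
  by apply: le_trans (g1 _) _; lra.
- rewrite !kE.
  have -> : (k (a + d) - (a + d) / lam ^+ n) / lam + ka (k (a + d)) -
    ((k a - a / lam ^+ n) / lam + ka (k a)) =
    (k (a + d) - (a + d) / lam ^+ n - (k a - a / lam ^+ n)) / lam + (ka (k (a + d)) - ka (k a)).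
    by ring.
  rewrite [X in _ <= X]mulrDl; apply: le_trans (ler_normD _ _) _; apply: lerD; first exact: contr (h2 a d).
  have := g2 (k a) (k (a + d) - k a).
  rewrite [k a + _]addrC subrK => /le_trans; apply.
  have := ler_wpM2l e0 (klip a d).
  have : 0 <= eta * `|d| by rewrite mulr_ge0.
  lra.
- rewrite !kE.
  set x11 := k (a + d + d'); set x10 := k (a + d); set x01 := k (a + d'); set x00 := k a.
  have := h3 a d d'; rewrite /= -/(k _) -/(k (a + d)) -/(k (a + d')) -/(k a).
  rewrite -/x11 -/x10 -/x01 -/x00 => h.
  have -> : (x11 - (a + d + d') / lam ^+ n) / lam + ka x11 -
     ((x10 - (a + d) / lam ^+ n) / lam + ka x10) -
     ((x01 - (a + d') / lam ^+ n) / lam + ka x01) + ((x00 - a / lam ^+ n) / lam + ka x00) =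
     (x11 - (a + d + d') / lam ^+ n - (x10 - (a + d) / lam ^+ n) -
      (x01 - (a + d') / lam ^+ n) + (x00 - a / lam ^+ n)) / lam +
     (ka x11 - ka x10 - ka x01 + ka x00) by ring.
  have dw0 : 0 <= `|d| * wmod d' by rewrite mulr_ge0 ?wmod_ge0.
  rewrite [X in _ <= X * _]mulrDl [X in _ <= X]mulrDl.
  apply: le_trans (ler_normD _ _) _; apply: lerD; first exact: contr h.
  apply: le_trans (reg1_four _ _ _ _ g2 g3) _.
  have f1 : `|x10 - x00| <= 2 * `|d| by exact: klip.
  have f2 : wmod (x01 - x00) <= 2 * wmod d'.
    apply: (@le_trans _ _ (wmod (2 * d'))).
      by apply: wmod_mono; rewrite normrM [`|2|]ger0_norm //; exact: klip.
    by rewrite wmodM ler_wpM2r ?wmod_ge0 // wmod_le // ?ger0_norm //; lra.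
  have f3 : `|x11 - x10 - x01 + x00| <= `|d| * wmod d'.
    have -> : x11 - x10 - x01 + x00 = x11 - (a + d + d') / lam ^+ n - (x10 - (a + d) / lam ^+ n) -
      (x01 - (a + d') / lam ^+ n) + (x00 - a / lam ^+ n) by ring.
    by apply: le_trans h _; rewrite -mulrA ler_piMl.
  have m1 : eta * `|x10 - x00| * wmod (x01 - x00) <= eta * (2 * `|d|) * (2 * wmod d').
    by rewrite ler_pM ?wmod_ge0 ?mulr_ge0 // ler_wpM2l.
  have m2 := ler_wpM2l e0 f3.
  lra.
Qed.

(** On each horizontal line [Fi] is a bounded continuous perturbation of division by lam, hence onto
    the image line by the intermediate value theorem. *)
Lemma iter_rfi_surj n p : eta <= 1 / 10 -> exists q, iter n Fi q = p.
Proof.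
move=> e1; elim: n p => [|n IH] p; first by exists p.
suff [q Hq] : exists q, Fi q = p by have [q' Hq'] := IH q; exists q'; rewrite /= Hq'.
have l0 := @lam_gt0 R; case: p => a b.
have [g1 g2 _] := rfi_nrm rf (b / lam).
have e0 : 0 <= eta by apply: reg1_ge0 (rfi_nrm rf 0).
pose f x := (Fi (x, b / lam)).1.
have cf : continuous f.
  have fl x y : `|f x - f y| <= `|x - y|.
    have := g2 y (x - y); rewrite /= [y + _]addrC subrK -/(f x) -/(f y) => h.
    have -> : f x - f y = (f x - x / lam - (f y - y / lam)) + (x - y) / lam by ring.
    apply: le_trans (ler_normD _ _) _; rewrite normrM [`|lam^-1|]gtr0_norm ?invr_gt0 //.
    have h1 : eta * `|x - y| <= 1 / 10 * `|x - y| by rewrite ler_wpM2r.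
    have h2 : `|x - y| / lam <= `|x - y| * (1 / 2).
      by rewrite ler_wpM2l // lam_inv; have /andP[x1 x2] := @gold_bounds R; lra.
    by have := normr_ge0 (x - y); lra.
  move=> x; apply/cvgrPdist_le => e e_gt0.
  near=> y; apply: le_trans (fl _ _) _.
  by near: y; apply: cvgr_dist_le.
pose A := lam * (`|a| + 1).
have A0 : 0 <= A by apply: mulr_ge0; [exact: ltW|exact: addr_ge0].
have [] := @IVT R f (- A) A a.
- lra.
- by apply: continuous_subspaceT.
- have := g1 A; have := g1 (- A); rewrite /= -/(f _) -/(f A).
  rewrite mulNr /A [lam * _]mulrC mulfK ?gt_eqF // !ler_norml => /andP[h1 h2] /andP[h3 h4].
  have a1 := ler_norm a; have a2 := ler_norm (- a); rewrite normrN in a2.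
  rewrite ge_min le_max; apply/andP; split; apply/orP; [left|right]; lra.
move=> x _ fx; exists (x, b / lam); rewrite [LHS]surjective_pairing (rfi2 rf) /=.
by rewrite -/(f x) fx mulrC divfK // gt_eqF.
Unshelve. all: by end_near. Qed.

End Iterate.

Theorem renormalizable_flow_cohomology : exists T eta : R, [/\ 0 < T, 0 < eta & forall Psi Fi,
  renormalizable_flow Psi Fi T eta -> forall (K : R) G,
  leaf_continuous Psi G -> lat_periodic lat G -> nrm K G ->
  leaf_growth Psi G \/ leaf_coboundary Psi lat G].
Proof.
(* 378 is the constant required in [renorm_step]. The bound th >= 8 c^2 is what the decay needs:
   with e4 = th^(-4) and Lam = th^7, (c e4)^2 * 2 Lam = 2 c^2 / th <= 1/4. *)
have [c c0 c_ge] : exists2 c : R, 0 < c & 378 <= c by exists 378; rewrite ?ltr0n ?lexx.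
have [k th_big] := lam_pow_unbounded (8 * c * c).
pose th := lam ^+ k; rewrite -/th in th_big.
have th0 : 0 < th by rewrite exprn_gt0 // lam_gt0.
have th1 : 1 <= th by rewrite exprn_ege1 // (le_trans _ (lam_ge2 (R := R))) // ler1n.
pose N := (7 * k)%N; pose Lam := lam ^+ N; pose mu := lam ^+ (5 * k)%N.
have LamE : Lam = th ^+ 7 by rewrite /Lam /th -exprM mulnC.
have muE : mu = th ^+ 5 by rewrite /mu /th -exprM mulnC.
(* With this eta, eta * mu = th^(-4) / 2 and eta * Lam = th^(-2) / 2. *)
pose e4 := th ^- 4; pose eta := th ^- 9 / 2.
have thn n : 0 < th ^+ n by rewrite exprn_gt0.
have thn1 n : 1 <= th ^+ n by rewrite exprn_ege1.
have eta0 : 0 < eta by rewrite divr_gt0 // invr_gt0.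
(* N iterations cost the factor 5 N of [iter_rfi_nrm]. *)
pose eta' := eta / (10 * N.+1%:R).
have N0 : 0 < N.+1%:R :> R by rewrite ltr0n.
have eta'0 : 0 < eta' by rewrite divr_gt0 // mulr_gt0.
have eta_le1 : eta <= 1 / 2.
  by rewrite /eta ler_pM2r ?invr_gt0 // invf_le1.
have eta'N : 5 * N%:R * eta' <= eta.
  have -> : 5 * N%:R * eta' = eta * (N%:R / N.+1%:R * (1 / 2)).
    by rewrite /eta'; field; rewrite gt_eqF.
  rewrite ler_piMr ?(ltW eta0) //.
  apply: (@le_trans _ _ (N%:R / N.+1%:R)); last by rewrite ler_pdivrMr // mul1r ler_nat.
  by rewrite ler_piMr ?divr_ge0 //; lra.
have eta'_le : eta' <= eta / 10.
  rewrite /eta' invfM mulrA; apply: ler_piMr; first by rewrite divr_ge0 // ltW.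
  by rewrite invf_le1 // ler1n.
exists (2 * Lam), eta'; split=> //.
  by rewrite mulr_gt0 // LamE.
move=> Psi Fi rf K G cG pG GK.
have surj p : exists q, iter N Fi q = p by apply: (iter_rfi_surj rf); lra.
(* A pointwise choice of preimages; compatibility with the lattice follows below from the
   injectivity of the iterate. *)
pose M p := projT1 (cid (surj p)).
have MK p : iter N Fi (M p) = p by rewrite /M; case: cid.
have iE n m : th ^- n * th ^+ (n + m) = th ^+ m.
  by rewrite exprD mulrA mulVf ?mul1r // gt_eqF.
have nrmM : nrm eta (fun p => (iter N Fi p).1 - p.1 / lam ^+ N).
  by apply: (nrm_le eta'N); apply: (iter_rfi_nrm rf); apply: (le_trans eta'N); lra.
have Lam0 : 0 < Lam by rewrite LamE.
have Lam1 : 1 < Lam.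
  by rewrite LamE; apply: (@lt_le_trans _ _ th); [apply: lt_le_trans th_big; nra|rewrite -{1}[th]expr1 ler_weXn2l].
have etaL : eta * Lam <= 1 / 2.
  have -> : eta * Lam = th ^- 2 / 2 by rewrite /eta LamE; field; rewrite gt_eqF.
  by rewrite ler_pM2r ?invr_gt0 // invf_le1.
have surjM : forall p, iter N Fi (M p) = p by [].
have mu0 : 0 < mu by rewrite muE.
have muLam : mu <= Lam by rewrite muE LamE ler_weXn2l.
have eta_mu : eta * mu <= e4.
  have -> : eta * mu = th ^- 4 / 2 by rewrite /eta muE; field; rewrite gt_eqF.
  by have : 0 < th ^- 4 by [rewrite invr_gt0]; rewrite /e4; lra.
have mu_Lam : (mu / Lam) ^+ 2 <= e4.
  by rewrite muE LamE /e4 le_eqVlt; apply/orP; left; apply/eqP; field; rewrite gt_eqF.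
have wmu : wmod mu^-1 <= e4 by rewrite muE wmod_expV.
have wLam : wmod Lam^-1 <= e4.
  apply: le_trans wmu; apply: wmod_mono; rewrite !gtr0_norm ?invr_gt0 //.
  by rewrite lef_pV2 ?posrE.
have latLam : lat (Lam^-1, Lam) by exact: lat_pow.
have latmu : lat (mu^-1, mu) by exact: lat_pow.
have dr t : `|t| <= 2 * Lam -> nrm eta (drift Psi t).
  by move=> tL; apply: nrm_le (rf_drift rf tL); lra.
have ML v p : lat v -> exists2 v', lat v' & M (p + v) = M p + v'.
  move=> lv; exists (lam ^+ N * v.1, v.2 / lam ^+ N); first exact: lat_expandn.
  apply: (@Mi_inj R Lam eta Lam1 etaL (iter N Fi) (iter_rfi2 rf N) nrmM).
  rewrite MK (iter_rfiL rf) ?MK /=; last exact: lat_expandn.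
  congr (_ + _); apply: injective_projections => /=; first by rewrite mulrC mulKf // gt_eqF.
  by rewrite mulrC divfK // gt_eqF.
have e40 : 0 < e4 by rewrite /e4 invr_gt0.
have q0 : 0 < c * e4 by rewrite mulr_gt0.
have q_ge : 378 * e4 <= c * e4 by rewrite ler_pM2r.
have qL : c * e4 * Num.sqrt (2 * Lam) <= 1 / 2.
  have s0 := sqrtr_ge0 (2 * Lam).
  have h0 : 0 <= c * e4 * Num.sqrt (2 * Lam) by rewrite mulr_ge0 // ltW.
  have h1 : (0 : R) <= 1 / 2 by lra.
  rewrite -(@ler_pXn2r _ 2) ?nnegrE //.
  rewrite exprMn sqr_sqrtr; last by rewrite mulr_ge0 // ltW.
  have -> : (c * e4) ^+ 2 * (2 * Lam) = 2 * c * c / th.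
    by rewrite /e4 LamE; field; rewrite gt_eqF.
  rewrite ler_pdivrMr //; lra.
have red x y : exists v, lat v /\ (`|x + v.1| <= 4 / Lam /\ `|y + v.2| <= 2 * Lam).
  exact: lat_reductionn.
have MiL v p : lat v -> exists2 v', lat v' & iter N Fi (p + v) = iter N Fi p + v'.
  move=> lv; exists (v.1 / lam ^+ N, lam ^+ N * v.2); first exact: lat_contractn.
  exact: (iter_rfiL rf).
exact (@leaf_cohomology R Psi lat Lam mu eta e4 (rfD rf) (rf2 rf) (rfL rf) Lam1 mu0
  muLam (ltW eta0) etaL eta_mu mu_Lam wmu wLam latLam latmu dr red (iter N Fi) M
  (iter_rfi2 rf N) (iter_rfiPsi rf N) MiL ML nrmM MK _ q_ge q0 qL (rf_small rf) K G cG pG GK).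
Qed.

End RenormalizableFlow.

(** * An algebra of functions with Lipschitz and four-point bounds *)

Section RegularFunctions.
Context {R : realType}.
Implicit Types (p v : R * R) (f g : R * R -> R) (K : R).

Definition norm1 v : R := `|v.1| + `|v.2|.

Definition reg2 K f := [/\ forall p, `|f p| <= K,
  forall p v, `|f (p + v) - f p| <= K * norm1 v &
  forall p v v', `|f (p + v + v') - f (p + v) - f (p + v') + f p|
    <= K * norm1 v * wmod (norm1 v')].

Lemma norm1_ge0 v : 0 <= norm1 v.
Proof. exact: addr_ge0. Qed.

Lemma reg2_ge0 K f : reg2 K f -> 0 <= K.
Proof. by move=> [/(_ 0) H _ _]; apply: le_trans H. Qed.

Lemma reg2_le K K' f : K <= K' -> reg2 K f -> reg2 K' f.
Proof.
move=> KK [H1 H2 H3]; split=> [p|p v|p v v'].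
- exact: le_trans KK.
- by apply: (le_trans (H2 _ _)); rewrite ler_wpM2r ?norm1_ge0.
- apply: (le_trans (H3 _ _ _)); rewrite ler_wpM2r ?wmod_ge0 // ler_wpM2r ?norm1_ge0 //.
Qed.

Lemma reg2_lip K f p q : reg2 K f -> `|f p - f q| <= K * norm1 (p - q).
Proof. by move=> [_ H _]; have := H q (p - q); rewrite [q + _]addrC subrK. Qed.

Lemma reg2_wmod K f p q : reg2 K f -> `|f p - f q| <= 2 * K * wmod (norm1 (p - q)).
Proof.
move=> Hf; have K0 := reg2_ge0 Hf; apply: wmod_interp.
  case: Hf => H _ _; apply: (le_trans (ler_normB _ _)).
  by have := H p; have := H q; lra.
rewrite (ger0_norm (norm1_ge0 _)); apply: (le_trans (reg2_lip p q Hf)).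
by rewrite ler_wpM2r ?norm1_ge0 //; lra.
Qed.

Lemma reg2_four K f p11 p10 p01 p00 : reg2 K f ->
  `|f p11 - f p10 - f p01 + f p00| <=
  K * norm1 (p10 - p00) * wmod (norm1 (p01 - p00)) + K * norm1 (p11 - p10 - p01 + p00).
Proof.
move=> [_ H1 H2].
have := H2 p00 (p10 - p00) (p01 - p00).
have := H1 (p00 + (p10 - p00) + (p01 - p00)) (p11 - p10 - p01 + p00).
have -> : p00 + (p10 - p00) = p10 by rewrite addrC subrK.
have -> : p00 + (p01 - p00) = p01 by rewrite addrC subrK.
have -> : p10 + (p01 - p00) + (p11 - p10 - p01 + p00) = p11.
  by apply: injective_projections => /=; ring.
set y := f (p10 + _) => h1 h2.
have -> : f p11 - f p10 - f p01 + f p00 = (y - f p10 - f p01 + f p00) + (f p11 - y) by ring.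
by apply: (le_trans (ler_normD _ _)); rewrite lerD.
Qed.

Lemma reg2_nrm K f : reg2 K f -> nrm K f.
Proof.
have E (a b d : R) : (a + d, b) = (a, b) + (d, 0).
  by apply: injective_projections => //=; rewrite addr0.
have N (d : R) : norm1 (d, 0) = `|d| by rewrite /norm1 /= normr0 addr0.
move=> [H1 H2 H3] b; split=> [a|a d|a d d'] //.
  by rewrite E; have := H2 (a, b) (d, 0); rewrite N.
by rewrite !E; have := H3 (a, b) (d, 0) (d', 0); rewrite !N wmod_norm.
Qed.

Lemma reg2_cst (c : R) : reg2 `|c| (fun=> c).
Proof.
split=> // [p v|p v v'].
  by rewrite subrr normr0 mulr_ge0 ?norm1_ge0.
by rewrite subrr sub0r addNr normr0 !mulr_ge0 ?norm1_ge0 ?wmod_ge0.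
Qed.

Lemma reg2_add K K' f g : reg2 K f -> reg2 K' g -> reg2 (K + K') (fun p => f p + g p).
Proof.
move=> [f1 f2 f3] [g1 g2 g3]; split=> [p|p v|p v v'].
- by apply: (le_trans (ler_normD _ _)); apply: lerD.
- have -> : f (p + v) + g (p + v) - (f p + g p) = (f (p + v) - f p) + (g (p + v) - g p) by ring.
  by rewrite mulrDl; apply: (le_trans (ler_normD _ _)); apply: lerD.
- set x := f (p + v + v'); set y := f (p + v); set z := f (p + v').
  set x' := g (p + v + v'); set y' := g (p + v); set z' := g (p + v').
  have -> : x + x' - (y + y') - (z + z') + (f p + g p) =
    (x - y - z + f p) + (x' - y' - z' + g p) by ring.
  rewrite [(K + K') * _]mulrDl [X in _ <= X]mulrDl; apply: (le_trans (ler_normD _ _)); apply: lerD.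
    exact: f3.
  exact: g3.
Qed.

Lemma reg2_opp K f : reg2 K f -> reg2 K (fun p => - f p).
Proof.
move=> [f1 f2 f3]; split=> [p|p v|p v v'].
- by rewrite normrN.
- by rewrite -opprD normrN.
- by rewrite -!opprD normrN.
Qed.

(** Discrete Leibniz rule for mixed second differences; in the two middle products one factor is
    estimated by the Lipschitz bound and the other by the modulus. *)
Lemma four_mul (x11 x10 x01 x00 y11 y10 y01 y00 : R) :
  x11 * y11 - x10 * y10 - x01 * y01 + x00 * y00 =
  x11 * (y11 - y10 - y01 + y00) + (x11 - x10) * (y10 - y00) + (x11 - x01) * (y01 - y00)
  + (x11 - x10 - x01 + x00) * y00.
Proof. by ring. Qed.

Lemma reg2_mul K K' f g : reg2 K f -> reg2 K' g -> reg2 (6 * K * K') (fun p => f p * g p).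
Proof.
move=> Hf Hg; have K0 := reg2_ge0 Hf; have K0' := reg2_ge0 Hg.
have KK : 0 <= K * K' by rewrite mulr_ge0.
have [f1 f2 f3] := Hf; have [g1 g2 g3] := Hg; split=> [p|p v|p v v'].
- rewrite normrM; apply: (@le_trans _ _ (K * K')); first by rewrite ler_pM.
  lra.
- have -> : f (p + v) * g (p + v) - f p * g p =
    f (p + v) * (g (p + v) - g p) + (f (p + v) - f p) * g p by ring.
  apply: (le_trans (ler_normD _ _)); rewrite !normrM.
  have h1 : `|f (p + v)| * `|g (p + v) - g p| <= K * (K' * norm1 v) by rewrite ler_pM.
  have h2 : `|f (p + v) - f p| * `|g p| <= K * norm1 v * K'.
    by rewrite ler_pM.
  have h3 : 0 <= K * K' * norm1 v by rewrite mulr_ge0 ?norm1_ge0.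
  apply: (le_trans (lerD h1 h2)).
  have -> : K * (K' * norm1 v) + K * norm1 v * K' = 2 * (K * K' * norm1 v) by ring.
  have -> : 6 * K * K' * norm1 v = 6 * (K * K' * norm1 v) by ring.
  lra.
- rewrite four_mul.
  set n := norm1 v; set w := wmod (norm1 v').
  have n0 : 0 <= n by exact: norm1_ge0.
  have w0 : 0 <= w by exact: wmod_ge0.
  have sub (q q' : R * R) : q + q' - q = q' by rewrite [q + q']addrC addrK.
  have fw q : `|f (q + v') - f q| <= 2 * K * w.
    by have := reg2_wmod (q + v') q Hf; rewrite sub.
  have gw q : `|g (q + v') - g q| <= 2 * K' * w.
    by have := reg2_wmod (q + v') q Hg; rewrite sub.
  have fv : `|f (p + v + v') - f (p + v')| <= K * n by rewrite -addrA [v + v']addrC addrA.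
  have t1 : `|f (p + v + v') * (g (p + v + v') - g (p + v) - g (p + v') + g p)| <= K * (K' * n * w).
    by rewrite normrM ler_pM.
  have t2 : `|(f (p + v + v') - f (p + v)) * (g (p + v) - g p)| <= 2 * K * w * (K' * n).
    by rewrite normrM ler_pM.
  have t3 : `|(f (p + v + v') - f (p + v')) * (g (p + v') - g p)| <= K * n * (2 * K' * w).
    by rewrite normrM ler_pM.
  have t4 : `|(f (p + v + v') - f (p + v) - f (p + v') + f p) * g p| <= K * n * w * K'.
    by rewrite normrM ler_pM.
  apply: (le_trans (ler_normD _ _)).
  apply: (@le_trans _ _ (K * (K' * n * w) + 2 * K * w * (K' * n) + K * n * (2 * K' * w) + K * n * w * K')).
    apply: lerD => //; apply: (le_trans (ler_normD _ _)); apply: lerD => //.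
    by apply: (le_trans (ler_normD _ _)); apply: lerD.
  by rewrite le_eqVlt; apply/orP; left; apply/eqP; ring.
Qed.

(** Discrete form of (1/x)'' = - x'' / x^2 + 2 x'^2 / x^3. *)
Lemma four_inv (m x11 x10 x01 x00 : R) : 0 < m -> m <= x11 -> m <= x10 -> m <= x01 -> m <= x00 ->
  `|x11^-1 - x10^-1 - x01^-1 + x00^-1| <= `|x11 - x10 - x01 + x00| / m ^+ 2 +
    `|x01 - x00| * (`|x10 - x00| + `|x11 - x01|) / m ^+ 3.
Proof.
move=> m0 h11 h10 h01 h00.
have [p11 [p10 [p01 p00]]] : 0 < x11 /\ 0 < x10 /\ 0 < x01 /\ 0 < x00.
  by do ?split; apply: lt_le_trans m0 _.
have inv_le y z : m <= y -> m <= z -> (y * z)^-1 <= m ^- 2.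
  move=> my mz; rewrite lef_pV2 ?posrE ?mulr_gt0 ?exprn_gt0 //.
  - by rewrite expr2; apply: ler_pM => //; apply: ltW.
  - exact: lt_le_trans my.
  - exact: lt_le_trans mz.
have inv_le3 y z t : m <= y -> m <= z -> m <= t -> (y * z * t)^-1 <= m ^- 3.
  move=> my mz mt; rewrite lef_pV2 ?posrE ?mulr_gt0 ?exprn_gt0 //;
    try by apply: (lt_le_trans m0).
  have m0' := ltW m0; rewrite exprSr expr2; apply: ler_pM => //; first exact: mulr_ge0.
  exact: ler_pM.
have -> : x11^-1 - x10^-1 - x01^-1 + x00^-1 =
  - ((x11 - x10 - x01 + x00) / (x10 * x11)) +
  (x01 - x00) * ((x11 - x01) / (x01 * x10 * x11) + (x10 - x00) / (x00 * x01 * x10)).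
  by field; rewrite !gt_eqF.
apply: (le_trans (ler_normD _ _)); apply: lerD.
  have i0 : 0 <= (x10 * x11)^-1 by rewrite invr_ge0 mulr_ge0 // ltW.
  by rewrite normrN normrM (ger0_norm i0) ler_wpM2l // inv_le.
rewrite normrM -[X in _ <= X]mulrA; apply: ler_wpM2l => //.
rewrite [X in _ <= X]mulrDl [X in _ <= X]addrC; apply: (le_trans (ler_normD _ _)); apply: lerD.
  rewrite normrM; apply: ler_wpM2l => //; rewrite ger0_norm; first exact: inv_le3.
  by rewrite invr_ge0 !mulr_ge0 // ltW.
rewrite normrM; apply: ler_wpM2l => //; rewrite ger0_norm; first exact: inv_le3.
by rewrite invr_ge0 !mulr_ge0 // ltW.
Qed.

Lemma lip_inv (m x y : R) : 0 < m -> m <= x -> m <= y -> `|x^-1 - y^-1| <= `|x - y| / m ^+ 2.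
Proof.
move=> m0 mx my; have x0 := lt_le_trans m0 mx; have y0 := lt_le_trans m0 my.
have -> : x^-1 - y^-1 = (y - x) / (x * y) by field; rewrite !gt_eqF.
rewrite normrM distrC; apply: ler_wpM2l => //.
rewrite ger0_norm; last by rewrite invr_ge0 mulr_ge0 // ltW.
have m0' := ltW m0.
by rewrite lef_pV2 ?posrE ?mulr_gt0 ?exprn_gt0 // expr2; apply: ler_pM.
Qed.

Lemma reg2_inv (m K : R) f : 0 < m -> (forall p, m <= f p) -> reg2 K f ->
  reg2 (m^-1 + K / m ^+ 2 + 4 * K ^+ 2 / m ^+ 3) (fun p => (f p)^-1).
Proof.
move=> m0 fm Hf; have K0 := reg2_ge0 Hf; have [f1 f2 f3] := Hf.
have fp p : 0 < f p by exact: lt_le_trans (fm p).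
have m2 : 0 <= (m ^+ 2)^-1 by rewrite invr_ge0 exprn_ge0 // ltW.
have m3 : 0 <= (m ^+ 3)^-1 by rewrite invr_ge0 exprn_ge0 // ltW.
have im : 0 <= m^-1 by rewrite invr_ge0 ltW.
have t1 : 0 <= K / m ^+ 2 by rewrite mulr_ge0.
have t2 : 0 <= 4 * K ^+ 2 / m ^+ 3 by rewrite !mulr_ge0 ?exprn_ge0.
split=> [p|p v|p v v'].
- have fi0 : 0 <= (f p)^-1 by rewrite invr_ge0 ltW.
  rewrite (ger0_norm fi0); have : (f p)^-1 <= m^-1 by rewrite lef_pV2 ?posrE.
  lra.
- apply: (le_trans (lip_inv m0 (fm _) (fm _))).
  have : K * norm1 v / m ^+ 2 <= (m^-1 + K / m ^+ 2 + 4 * K ^+ 2 / m ^+ 3) * norm1 v.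
    by rewrite mulrAC ler_wpM2r ?norm1_ge0 //; lra.
  by apply: le_trans; rewrite ler_wpM2r.
- set n := norm1 v; set w := wmod (norm1 v').
  have n0 : 0 <= n by exact: norm1_ge0.
  have w0 : 0 <= w by exact: wmod_ge0.
  apply: (le_trans (four_inv m0 (fm _) (fm _) (fm _) (fm _))).
  have sub (q q' : R * R) : q + q' - q = q' by rewrite [q + q']addrC addrK.
  have h1 : `|f (p + v') - f p| <= 2 * K * w.
    by have := reg2_wmod (p + v') p Hf; rewrite sub.
  have h2 : `|f (p + v) - f p| <= K * n by [].
  have h3 : `|f (p + v + v') - f (p + v')| <= K * n by rewrite -addrA [v + v']addrC addrA.
  have h4 := f3 p v v'; rewrite -/n -/w in h4.
  apply: (@le_trans _ _ (K * n * w / m ^+ 2 + 2 * K * w * (K * n + K * n) / m ^+ 3)).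
    apply: lerD; first by rewrite ler_wpM2r.
    rewrite ler_wpM2r //; apply: ler_pM => //; exact: lerD.
  have -> : K * n * w / m ^+ 2 + 2 * K * w * (K * n + K * n) / m ^+ 3 =
    (K / m ^+ 2 + 4 * K ^+ 2 / m ^+ 3) * n * w by ring.
  rewrite ler_wpM2r // ler_wpM2r //; lra.
Qed.

(** Up to a product of first differences, the mixed difference of the squares is the mixed
    difference of the values times [x11 + x10 >= 2 m], so it can be solved for the latter. *)
Lemma four_sqrt (m x11 x10 x01 x00 : R) : 0 < m -> m <= x11 -> m <= x10 -> m <= x01 -> m <= x00 ->
  2 * m * `|x11 - x10 - x01 + x00| <= `|x11 ^+ 2 - x10 ^+ 2 - x01 ^+ 2 + x00 ^+ 2| +
    `|x01 - x00| * (`|x11 - x01| + `|x10 - x00|).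
Proof.
move=> m0 h11 h10 h01 h00.
have E : (x11 - x10 - x01 + x00) * (x11 + x10) = (x11 ^+ 2 - x10 ^+ 2 - x01 ^+ 2 + x00 ^+ 2)
   - (x01 - x00) * ((x11 - x01) + (x10 - x00)) by ring.
apply: (@le_trans _ _ (`|(x11 - x10 - x01 + x00) * (x11 + x10)|)).
  rewrite normrM mulrC ler_wpM2l // ger0_norm; lra.
rewrite E; apply: (le_trans (ler_normB _ _)); rewrite lerD2l normrM ler_wpM2l //.
exact: ler_normD.
Qed.

Lemma reg2_sqrt K f : (forall p, 1 <= f p) -> reg2 K f ->
  reg2 (1 + K + 2 * K ^+ 2) (fun p => Num.sqrt (f p)).
Proof.
move=> f1 Hf; have K0 := reg2_ge0 Hf; have [g1 g2 g3] := Hf.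
have s1 p : 1 <= Num.sqrt (f p) by rewrite -[X in X <= _]sqrtr1 ler_wsqrtr.
have sq p : Num.sqrt (f p) ^+ 2 = f p by rewrite sqr_sqrtr // (le_trans ler01).
have K2 : 0 <= K ^+ 2 by exact: sqr_ge0.
have lip p q : `|Num.sqrt (f p) - Num.sqrt (f q)| <= `|f p - f q|.
  have -> : f p - f q = (Num.sqrt (f p) - Num.sqrt (f q)) * (Num.sqrt (f p) + Num.sqrt (f q)).
    by rewrite -subr_sqr !sq.
  by rewrite normrM ler_peMr // ger0_norm; have := s1 p; have := s1 q; lra.
split=> [p|p v|p v v'].
- rewrite ger0_norm ?sqrtr_ge0 //.
  have : Num.sqrt (f p) <= f p by rewrite -{2}(sq p) expr2 ler_peMr ?sqrtr_ge0.
  by have := g1 p; have := ler_norm (f p); lra.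
- apply: (le_trans (lip _ _)); apply: (le_trans (g2 _ _)).
  by rewrite ler_wpM2r ?norm1_ge0 //; lra.
- set n := norm1 v; set w := wmod (norm1 v').
  have n0 : 0 <= n by exact: norm1_ge0.
  have w0 : 0 <= w by exact: wmod_ge0.
  have nw : 0 <= n * w by rewrite mulr_ge0.
  have := four_sqrt ltr01 (s1 (p + v + v')) (s1 (p + v)) (s1 (p + v')) (s1 p).
  rewrite !sq.
  have sub (q q' : R * R) : q + q' - q = q' by rewrite [q + q']addrC addrK.
  have h1 : `|Num.sqrt (f (p + v')) - Num.sqrt (f p)| <= 2 * K * w.
    by apply: (le_trans (lip _ _)); have := reg2_wmod (p + v') p Hf; rewrite sub.
  have h2 : `|Num.sqrt (f (p + v)) - Num.sqrt (f p)| <= K * n.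
    exact: (le_trans (lip _ _)).
  have h3 : `|Num.sqrt (f (p + v + v')) - Num.sqrt (f (p + v'))| <= K * n.
    by apply: (le_trans (lip _ _)); rewrite -addrA [v + v']addrC addrA.
  have h4 := g3 p v v'; rewrite -/n -/w in h4.
  have h5 : `|Num.sqrt (f (p + v')) - Num.sqrt (f p)| *
      (`|Num.sqrt (f (p + v + v')) - Num.sqrt (f (p + v'))| +
       `|Num.sqrt (f (p + v)) - Num.sqrt (f p)|) <= 2 * K * w * (K * n + K * n).
    by apply: ler_pM => //; exact: lerD.
  move=> H; have {}H := le_trans H (lerD h4 h5).
  have E : K * n * w + 2 * K * w * (K * n + K * n) = (K + 4 * K ^+ 2) * (n * w) by ring.
  rewrite E mulr1 in H.
  rewrite -mulrA.
  have : (K + 4 * K ^+ 2) * (n * w) <= 2 * ((1 + K + 2 * K ^+ 2) * (n * w)).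
    by rewrite [X in _ <= X]mulrA; apply: ler_wpM2r => //; lra.
  lra.
Qed.

(** The bounds are inequalities between finitely many values, so they survive uniform limits. A C^1
    class with fixed constants would not be closed in this way. *)
Lemma reg2_closed K f : (forall e, 0 < e -> exists2 g, reg2 K g & forall p, `|f p - g p| <= e) ->
  reg2 K f.
Proof.
move=> H; split=> [p|p v|p v v']; apply/ler_addgt0Pr => e e0.
- have [g [g1 _ _] fg] := H _ e0; rewrite -[f p](subrK (g p)).
  by apply: (le_trans (ler_normD _ _)); rewrite addrC lerD.
- have e2 : 0 < e / 2 by rewrite divr_gt0.
  have [g [_ g2 _] fg] := H _ e2.
  have -> : f (p + v) - f p = (g (p + v) - g p) + ((f (p + v) - g (p + v)) - (f p - g p)) by ring.
  apply: (le_trans (ler_normD _ _)); apply: lerD => //.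
  by apply: (le_trans (ler_normB _ _)); rewrite [e]splitr lerD.
- have e4 : 0 < e / 4 by rewrite divr_gt0.
  have [g [_ _ g3] fg] := H _ e4.
  set x := p + v + v'; set y := p + v; set z := p + v'.
  have -> : f x - f y - f z + f p = (g x - g y - g z + g p) +
    ((f x - g x) - (f y - g y) - (f z - g z) + (f p - g p)) by ring.
  apply: (le_trans (ler_normD _ _)); apply: lerD; first exact: g3.
  have -> : e = e / 4 + e / 4 + e / 4 + e / 4 by field.
  apply: (le_trans (ler_normD _ _)); apply: lerD => //.
  apply: (le_trans (ler_normB _ _)); apply: lerD => //.
  by apply: (le_trans (ler_normB _ _)); apply: lerD.
Qed.

End RegularFunctions.

(** * Dependence of leaf translations on the starting point *)

Section ShortTime.
Context {R : realType}.
Variables (Psi : R -> R * R -> R * R) (sigma : R * R -> R) (kap : R).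
Hypothesis Psi0 : forall p, Psi 0 p = p.
Hypothesis Psi2 : forall t p, (Psi t p).2 = p.2 + t.
Hypothesis dPsi : forall p t, der (fun t => (Psi t p).1) t (sigma (Psi t p)).
Hypothesis Hsigma : reg2 kap sigma.

Lemma norm1_fst (p q : R * R) : p.2 = q.2 -> norm1 (p - q) = `|p.1 - q.1|.
Proof. by move=> E; rewrite /norm1 /= E subrr normr0 addr0. Qed.

Lemma wmod_le_scale (c x d : R) : 1 <= c -> `|x| <= c * `|d| -> wmod x <= c * wmod d.
Proof.
move=> c1 H; apply: (@le_trans _ _ (wmod (c * d))).
  by apply: wmod_mono; rewrite normrM [`|c|]ger0_norm // (le_trans ler01).
rewrite wmodM ler_wpM2r ?wmod_ge0 //; apply: wmod_le => //.
by rewrite ger0_norm // (le_trans ler01).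
Qed.

Lemma drift_abs t p : `|drift Psi t p| <= kap * `|t|.
Proof.
have [s1 _ _] := Hsigma.
rewrite /drift -{2}(Psi0 p) -{2}[t]subr0.
by apply: (@mvt_abs _ (fun t => (Psi t p).1) (fun t => sigma (Psi t p))).
Qed.

Variable T : R.
Hypotheses (T0 : 0 <= T) (kT : kap * T <= 1 / 2).

Lemma flow_lip t p q : `|t| <= T -> p.2 = q.2 ->
  `|(Psi t p).1 - (Psi t q).1| <= 2 * `|p.1 - q.1|.
Proof.
move=> tT E; have := @sup_gronwall_sym _ (fun t => (Psi t p).1 - (Psi t q).1)
  (fun t => sigma (Psi t p) - sigma (Psi t q)) T kap 0.
rewrite !Psi0 mul0r addr0; apply => //; last exact: reg2_ge0 Hsigma.
  by move=> r; apply: derB.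
move=> r _; rewrite addr0 -norm1_fst; first exact: reg2_lip.
by rewrite !Psi2 E.
Qed.

Lemma flow_drift_lip t p q : `|t| <= T -> p.2 = q.2 ->
  `|drift Psi t p - drift Psi t q| <= 2 * kap * T * `|p.1 - q.1|.
Proof.
move=> tT E; have k0 := reg2_ge0 Hsigma.
pose f t := (Psi t p).1 - (Psi t q).1.
have -> : drift Psi t p - drift Psi t q = f t - f 0 by rewrite /f /drift !Psi0; ring.
have := @mvt_abs _ f (fun t => sigma (Psi t p) - sigma (Psi t q)) 0 t (kap * (2 * `|p.1 - q.1|)).
rewrite subr0; have fd r : der f r (sigma (Psi r p) - sigma (Psi r q)) by apply: derB.
move=> /(_ (fun r _ => fd r)) H; apply: (le_trans (H _)).
  move=> r rt; have rT : `|r| <= T.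
    apply: le_trans tT; move: rt; rewrite /btw.
    have := ler_norm t; have := ler_norm (- t); rewrite normrN.
    case: (ger0P r) => _ ? ? /orP[]/andP[]; lra.
  apply: (le_trans (reg2_lip _ _ Hsigma)); rewrite norm1_fst ?Psi2 ?E //.
  by rewrite ler_wpM2l // flow_lip.
have -> : 2 * kap * T * `|p.1 - q.1| = kap * (2 * `|p.1 - q.1|) * T by ring.
by rewrite ler_wpM2l // !mulr_ge0.
Qed.

(** The mixed difference of four trajectories vanishes at time 0, where the points form a
    parallelogram, and obeys a linear differential inequality with forcing 4 kap |d| [wmod d'];
    [sup_gronwall_sym] doubles the constant. *)
Lemma drift_nrm t : `|t| <= T -> nrm (8 * kap * T) (drift Psi t).
Proof.
move=> tT b; have k0 := reg2_ge0 Hsigma; have kT0 : 0 <= kap * T by rewrite mulr_ge0.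
split=> [a|a d|a d d'].
- apply: (le_trans (drift_abs _ _)); apply: (@le_trans _ _ (kap * T)); last lra.
  by rewrite ler_wpM2l.
- have := @flow_drift_lip t (a + d, b) (a, b) tT erefl; rewrite /= [a + d]addrC addrK => H.
  by apply: (le_trans H); rewrite ler_wpM2r //; lra.
- set p11 := (a + d + d', b); set p10 := (a + d, b); set p01 := (a + d', b); set p00 := (a, b).
  pose E t := (Psi t p11).1 - (Psi t p10).1 - (Psi t p01).1 + (Psi t p00).1.
  pose dE t := sigma (Psi t p11) - sigma (Psi t p10) - sigma (Psi t p01) + sigma (Psi t p00).
  have -> : drift Psi t p11 - drift Psi t p10 - drift Psi t p01 + drift Psi t p00 = E t.
    by rewrite /drift /E /=; ring.
  have E0 : E 0 = 0 by rewrite /E !Psi0 /=; ring.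
  have dw : 0 <= `|d| * wmod d' by rewrite mulr_ge0 ?wmod_ge0.
  have := @sup_gronwall_sym _ E dE T kap (4 * kap * (`|d| * wmod d')).
  rewrite E0 normr0 add0r => H.
  have -> : 8 * kap * T * `|d| * wmod d' = 2 * (4 * kap * (`|d| * wmod d') * T) by ring.
  apply: (H _ T0 kT _ k0 _ t tT); [|move=> r rT|by rewrite mulr_ge0 // mulr_ge0].
    by move=> r; apply: derD => //; apply: derB => //; apply: derB.
  apply: (le_trans (reg2_four _ _ _ _ Hsigma)).
  rewrite addrC; apply: lerD.
    by rewrite /norm1 /= !Psi2 /= subrr sub0r addNr normr0 addr0 ler_wpM2l.
  rewrite !norm1_fst ?Psi2 // -mulrA.
  have -> : 4 * kap * (`|d| * wmod d') = kap * (2 * `|d| * (2 * wmod d')) by ring.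
  apply: ler_wpM2l => //; apply: ler_pM; rewrite ?wmod_ge0 //.
    by have := @flow_lip r p10 p00 rT erefl; rewrite /= [a + d]addrC addrK.
  apply: wmod_le_scale; first lra.
  by rewrite normr_id; have := @flow_lip r p01 p00 rT erefl; rewrite /= [a + d']addrC addrK.
Qed.

End ShortTime.

(** * The return map corrected along leaves *)

Section ReturnMap.
Context {R : realType}.
Variables (Psi : R -> R * R -> R * R) (sigma e : R * R -> R) (kap eps : R).
Hypothesis Psi0 : forall p, Psi 0 p = p.
Hypothesis Psi2 : forall t p, (Psi t p).2 = p.2 + t.
Hypothesis dPsi : forall p t, der (fun t => (Psi t p).1) t (sigma (Psi t p)).
Hypotheses (Hsigma : reg2 kap sigma) (He : reg2 eps e).
Hypotheses (kap1 : kap <= 1 / 100) (eps1 : eps <= 1 / 100).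

(** The path from the displaced point, at th = 0, back along its leaf to the height of [q], at th =
    1. The flow time depends on [q]; rescaling it to [0, 1] lets different paths be compared at the
    same parameter. *)
Let P q (th : R) := Psi (- (th * e q)) (q.1 + e q, q.2 + e q).

Let k0 : 0 <= kap. Proof. exact: reg2_ge0 Hsigma. Qed.
Let e0 : 0 <= eps. Proof. exact: reg2_ge0 He. Qed.
Let ek : 0 <= eps * kap. Proof. by rewrite mulr_ge0. Qed.

Let ek_small : eps * kap * 1 <= 1 / 2.
Proof.
have h : eps * kap <= 1 / 100 * (1 / 100) by rewrite ler_pM.
lra.
Qed.

Let P2 q th : (P q th).2 = q.2 + (1 - th) * e q.
Proof. by rewrite /P Psi2 /=; ring. Qed.

Let P0 q : (P q 0).1 = q.1 + e q.
Proof. by rewrite /P mul0r oppr0 Psi0. Qed.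

Let dP q th : der (fun th => (P q th).1) th (- (e q * sigma (P q th))).
Proof.
apply: der_eq; first apply: (@der_comp _ (fun t => (Psi t (q.1 + e q, q.2 + e q)).1) (fun th => - (th * e q)) th).
- apply: derN; apply: der_eq; first exact: (derM (der_id th) (der_cst (e q) th)).
  by [].
- exact: dPsi.
- by rewrite mul1r mulr0 addr0 /P; ring.
Qed.

Let P_norm (q q' : R * R) (th : R) : q.2 = q'.2 -> 0 <= th <= 1 ->
  norm1 (P q th - P q' th) <= `|(P q th).1 - (P q' th).1| + eps * `|q.1 - q'.1|.
Proof.
move=> E /andP[th0 th1]; rewrite /norm1 /= lerD2l !P2 E.
have -> : q'.2 + (1 - th) * e q - (q'.2 + (1 - th) * e q') = (1 - th) * (e q - e q') by ring.
rewrite normrM ger0_norm ?subr_ge0 // -norm1_fst //.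
apply: (@le_trans _ _ (1 * `|e q - e q'|)); last by rewrite mul1r reg2_lip.
by rewrite ler_wpM2r //; have := eps1; lra.
Qed.

Let dP_lip (q q' : R * R) (th : R) : q.2 = q'.2 -> 0 <= th <= 1 ->
  `|e q * sigma (P q th) - e q' * sigma (P q' th)| <=
  eps * kap * `|(P q th).1 - (P q' th).1| + 2 * (eps * kap) * `|q.1 - q'.1|.
Proof.
move=> E th01.
have -> : e q * sigma (P q th) - e q' * sigma (P q' th) =
  e q * (sigma (P q th) - sigma (P q' th)) + (e q - e q') * sigma (P q' th) by ring.
have [s1 _ _] := Hsigma; have [e1 _ _] := He.
apply: (le_trans (ler_normD _ _)); rewrite !normrM.
set y := (_ - _ in X in _ <= _ * `|X| + _); set d := q.1 - q'.1.
have h1 : `|e q| * `|sigma (P q th) - sigma (P q' th)| <= eps * (kap * (`|y| + eps * `|d|)).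
  apply: ler_pM => //; apply: (le_trans (reg2_lip _ _ Hsigma)); rewrite ler_wpM2l //.
  exact: P_norm.
have h2 : `|e q - e q'| * `|sigma (P q' th)| <= eps * `|d| * kap.
  by apply: ler_pM => //; rewrite /d -norm1_fst // reg2_lip.
have h3 : eps * kap * `|d| * eps <= eps * kap * `|d| * 1.
  by apply: ler_wpM2l; [rewrite mulr_ge0|have := eps1; lra].
apply: (le_trans (lerD h1 h2)).
lra.
Qed.

Let P_lip (q q' : R * R) (th : R) : q.2 = q'.2 -> 0 <= th <= 1 ->
  `|(P q th).1 - (P q' th).1| <= 3 * `|q.1 - q'.1|.
Proof.
move=> E th01; set d := `|q.1 - q'.1|; have d0 : 0 <= d by exact: normr_ge0.
have := @sup_gronwall _ (fun th => (P q th).1 - (P q' th).1)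
  (fun th => - (e q * sigma (P q th)) - - (e q' * sigma (P q' th))) 1 (eps * kap)
  (2 * (eps * kap) * d).
rewrite !P0 mulr1 => H; apply: (le_trans (H _ _ _ _ _ _ _ th01)) => //.
- by move=> r; apply: derB; exact: dP.
- by have := ek_small; rewrite mulr1.
- by move=> r r01; rewrite -opprD normrN; exact: dP_lip.
- by rewrite !mulr_ge0.
have h1 : `|q.1 + e q - (q'.1 + e q')| <= d + eps * d.
  have -> : q.1 + e q - (q'.1 + e q') = (q.1 - q'.1) + (e q - e q') by ring.
  by apply: (le_trans (ler_normD _ _)); rewrite lerD2l /d -norm1_fst // reg2_lip.
have h2 : eps * d <= 1 / 100 * d by rewrite ler_wpM2r.
have h3 : eps * kap * d <= 1 / 100 * d.
  rewrite ler_wpM2r //; have : eps * kap <= 1 / 100 * 1 by rewrite ler_pM //; have := kap1; lra.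
  lra.
lra.
Qed.

Let P_norm_lip (q q' : R * R) (th : R) : q.2 = q'.2 -> 0 <= th <= 1 ->
  norm1 (P q th - P q' th) <= 4 * `|q.1 - q'.1|.
Proof.
move=> E th01; apply: (le_trans (P_norm E th01)).
have := P_lip E th01; have : eps * `|q.1 - q'.1| <= 1 * `|q.1 - q'.1|.
  by rewrite ler_wpM2r //; have := eps1; lra.
lra.
Qed.

Definition return_drift q := (Psi (- e q) (q + (e q, e q))).1 - q.1.

Let return_driftE q : return_drift q = (P q 1).1 - q.1.
Proof. by rewrite /return_drift /P mul1r. Qed.

Let in1 : ((0 : R) <= 1 <= (1 : R))%R. Proof. by rewrite ler01 lexx. Qed.

Lemma return_drift_nrm : nrm (3 * eps) return_drift.
Proof.
have [s1 _ _] := Hsigma; have [e1 e2 e3] := He.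
move=> b; split=> [a|a d|a d d']; rewrite !return_driftE.
- set q := (a, b).
  have : `|(P q 1).1 - (P q 0).1| <= eps * kap * `|1 - 0|.
    apply: (@mvt_abs _ (fun th => (P q th).1) (fun th => - (e q * sigma (P q th)))) => r _; first exact: dP.
    by rewrite normrN normrM ler_pM.
  rewrite subr0 normr1 mulr1 P0 => h1.
  have -> : (P q 1).1 - q.1 = ((P q 1).1 - (q.1 + e q)) + e q by ring.
  apply: (le_trans (ler_normD _ _)); have := e1 q.
  have : eps * kap <= eps * 1 by rewrite ler_wpM2l //; have := kap1; lra.
  have := e0; lra.
- set q := (a + d, b); set q' := (a, b).
  have dE : q.1 - q'.1 = d by rewrite /=; ring.
  pose y th := (P q th).1 - (P q' th).1.
  have : `|y 1 - y 0| <= 5 * (eps * kap) * `|d| * `|1 - 0|.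
    apply: (@mvt_abs _ y (fun th => - (e q * sigma (P q th)) - - (e q' * sigma (P q' th)))).
      by move=> r _; apply: derB; exact: dP.
    move=> r; rewrite /btw => r01; have {}r01 : 0 <= r <= 1 by move: r01; lra.
    rewrite -opprD normrN; apply: (le_trans (@dP_lip q q' r erefl r01)); rewrite dE.
    have := @P_lip q q' r erefl r01; rewrite dE => h.
    have : eps * kap * `|(P q r).1 - (P q' r).1| <= eps * kap * (3 * `|d|) by rewrite ler_wpM2l.
    lra.
  rewrite subr0 normr1 mulr1 => h1.
  have -> : (P q 1).1 - q.1 - ((P q' 1).1 - q'.1) = (y 1 - y 0) + (e q - e q').
    by rewrite /y !P0; ring.
  apply: (le_trans (ler_normD _ _)).
  have h2 : `|e q - e q'| <= eps * `|d|.
    by have := reg2_lip q q' He; rewrite norm1_fst // dE.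
  have h3 : eps * `|d| * kap <= eps * `|d| * (1 / 100) by rewrite ler_wpM2l // mulr_ge0.
  have h4 : 0 <= eps * `|d| by rewrite mulr_ge0.
  lra.
- set q11 := (a + d + d', b); set q10 := (a + d, b); set q01 := (a + d', b); set q00 := (a, b).
  set w := wmod d'; have w0 : 0 <= w by exact: wmod_ge0.
  have dw : 0 <= `|d| * w by rewrite mulr_ge0.
  pose Z th := (P q11 th).1 - (P q10 th).1 - (P q01 th).1 + (P q00 th).1.
  pose g q th := e q * sigma (P q th).
  pose dZ th := - g q11 th - - g q10 th - - g q01 th + - g q00 th.
  have -> : (P q11 1).1 - q11.1 - ((P q10 1).1 - q10.1) - ((P q01 1).1 - q01.1)
     + ((P q00 1).1 - q00.1) = Z 1 by rewrite /Z /=; ring.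
  have e4 : `|e q11 - e q10 - e q01 + e q00| <= eps * (`|d| * w).
    by have [_ _ /(_ a d d')] := reg2_nrm He b; rewrite mulrA.
  have Z0 : Z 0 = e q11 - e q10 - e q01 + e q00 by rewrite /Z !P0 /=; ring.
  have d10 : q10.1 - q00.1 = d by rewrite /=; ring.
  have d01 : q01.1 - q00.1 = d' by rewrite /=; ring.
  have d11 : q11.1 - q01.1 = d by rewrite /=; ring.
  have d11' : q11.1 - q10.1 = d' by rewrite /=; ring.
  (* The forcing 34 is 17 + 8 + 8 + 1, one summand for each term of [four_mul], where 17 = 4 * 4 + 1
     comes from [reg2_four]. With kap <= 1/100 the result 2 (1 + 34 kap) eps stays below 3 eps. *)
  have := @sup_gronwall _ Z dZ 1 (eps * kap) (34 * (eps * kap) * (`|d| * w)).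
  rewrite Z0 mulr1 => H; apply: (le_trans (H _ _ _ _ _ _ 1 in1)) => //.
  + by move=> r; apply: derD; [apply: derB; [apply: derB|]|]; exact: dP.
  + by have := ek_small; rewrite mulr1.
  + move=> r r01.
    have -> : dZ r = - (g q11 r - g q10 r - g q01 r + g q00 r) by rewrite /dZ; ring.
    rewrite normrN /g four_mul.
    have n10 := @P_norm_lip q10 q00 r erefl r01; rewrite d10 in n10.
    have n01 := @P_norm_lip q01 q00 r erefl r01; rewrite d01 in n01.
    have w01 : wmod (norm1 (P q01 r - P q00 r)) <= 4 * w.
      by apply: wmod_le_scale; [lra|rewrite ger0_norm ?norm1_ge0].
    have s4 : `|sigma (P q11 r) - sigma (P q10 r) - sigma (P q01 r) + sigma (P q00 r)| <=
        17 * kap * (`|d| * w) + kap * `|Z r|.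
      apply: (le_trans (reg2_four _ _ _ _ Hsigma)).
      have h1 : kap * norm1 (P q10 r - P q00 r) * wmod (norm1 (P q01 r - P q00 r)) <=
          kap * (4 * `|d|) * (4 * w).
        apply: ler_pM; rewrite ?wmod_ge0 ?mulr_ge0 ?norm1_ge0 //.
        by rewrite ler_wpM2l.
      have h2 : norm1 (P q11 r - P q10 r - P q01 r + P q00 r) <= `|Z r| + `|d| * w.
        rewrite /norm1 /= lerD2l !P2 /=.
        have -> : b + (1 - r) * e q11 - (b + (1 - r) * e q10) - (b + (1 - r) * e q01) +
          (b + (1 - r) * e q00) = (1 - r) * (e q11 - e q10 - e q01 + e q00) by ring.
        rewrite normrM; apply: (@le_trans _ _ (1 * (eps * (`|d| * w)))).
          by apply: ler_pM => //; case/andP: r01 => r0 r1; rewrite ger0_norm; lra.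
        by rewrite mul1r ler_piMl //; have := eps1; lra.
      have h3 : kap * norm1 (P q11 r - P q10 r - P q01 r + P q00 r) <=
          kap * (`|Z r| + `|d| * w) by rewrite ler_wpM2l.
      lra.
    have t1 : `|e q11 * (sigma (P q11 r) - sigma (P q10 r) - sigma (P q01 r) + sigma (P q00 r))| <=
        eps * (17 * kap * (`|d| * w) + kap * `|Z r|) by rewrite normrM ler_pM.
    have t2 : `|(e q11 - e q10) * (sigma (P q10 r) - sigma (P q00 r))| <=
        2 * eps * w * (kap * (4 * `|d|)).
      rewrite normrM; apply: ler_pM => //.
        by have := reg2_wmod q11 q10 He; rewrite norm1_fst // d11' wmod_norm.
      by apply: (le_trans (reg2_lip _ _ Hsigma)); rewrite ler_wpM2l.
    have t3 : `|(e q11 - e q01) * (sigma (P q01 r) - sigma (P q00 r))| <=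
        eps * `|d| * (2 * kap * (4 * w)).
      rewrite normrM; apply: ler_pM => //.
        by have := reg2_lip q11 q01 He; rewrite norm1_fst // d11.
      by apply: (le_trans (reg2_wmod _ _ Hsigma)); rewrite ler_wpM2l // mulr_ge0.
    have t4 : `|(e q11 - e q10 - e q01 + e q00) * sigma (P q00 r)| <= eps * (`|d| * w) * kap.
      by rewrite normrM ler_pM.
    apply: (le_trans (ler_normD _ _)).
    apply: (@le_trans _ _ (eps * (17 * kap * (`|d| * w) + kap * `|Z r|) +
      2 * eps * w * (kap * (4 * `|d|)) + eps * `|d| * (2 * kap * (4 * w)) +
      eps * (`|d| * w) * kap)).
      apply: lerD => //; apply: (le_trans (ler_normD _ _)); apply: lerD => //.
      by apply: (le_trans (ler_normD _ _)); apply: lerD.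
    by rewrite le_eqVlt; apply/orP; left; apply/eqP; ring.
  + by rewrite !mulr_ge0.
  have h1 : eps * (`|d| * w) * kap <= eps * (`|d| * w) * (1 / 100).
    by rewrite ler_wpM2l // mulr_ge0.
  have h2 : 0 <= eps * (`|d| * w) by rewrite mulr_ge0.
  have -> : 3 * eps * `|d| * w = 3 * (eps * (`|d| * w)) by ring.
  lra.
Qed.

End ReturnMap.

(** * The inverse Anosov map in eigen-coordinates and its action on leaves *)

Section LeafMap.
Context {R : realType}.
Notation gold := (@gold R).
Notation lam := (@lam R).
Implicit Types (p q v : R * R).

(** The x-coordinate on the torus, recovered from eigen-coordinates; [2 * gold - 1] is sqrt 5. *)
Definition xcoord q : R := (q.1 - q.2) / (2 * gold - 1).
Definition hyp_inv p : R * R := (p.1 / lam, lam * p.2).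

Lemma sqrt5_gt2 : 2 < 2 * gold - 1.
Proof. by have /andP[g1 g2] := @gold_bounds R; lra. Qed.

Lemma xcoordD q v : xcoord (q + v) = xcoord q + xcoord v.
Proof. by rewrite /xcoord -mulrDl /=; congr (_ / _); ring. Qed.

Lemma xcoord_eigen p : xcoord (eigen p) = p.1.
Proof.
have s5 := sqrt5_gt2; have s0 : 2 * gold - 1 != 0 by rewrite gt_eqF //; lra.
rewrite /xcoord /eigen /= gold_inv; apply: (mulIf s0); rewrite divfK //; ring.
Qed.

Variables (phi : R -> R) (gamma : R).
Hypothesis phi_int : forall x (k : int), phi (x + k%:~R) = phi x.

Definition kick q := gamma * phi (xcoord q).
(** [Fmap] subtracts gamma phi(x) from y and then applies the matrix. A vertical kick points along
    (1, 1) in eigen-coordinates and leaves x unchanged, so the inverse may evaluate it after the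
    linear map has been undone. *)
Definition inv_map p := hyp_inv p + (kick (hyp_inv p), kick (hyp_inv p)).

Lemma hyp_invD p v : hyp_inv (p + v) = hyp_inv p + hyp_inv v.
Proof. by rewrite /hyp_inv; apply: injective_projections => /=; ring. Qed.

Lemma kick_lat q v : lat v -> kick (q + v) = kick q.
Proof. by move=> [k [l ->]]; rewrite /kick xcoordD xcoord_eigen /= phi_int. Qed.

Variables (Psi : R -> R * R -> R * R) (sigma : R * R -> R) (dphi : R -> R) (kap eps B : R).
Hypothesis Psi0 : forall p, Psi 0 p = p.
Hypothesis PsiD : forall s t p, Psi (s + t) p = Psi s (Psi t p).
Hypothesis PsiL : forall t v p, lat v -> Psi t (p + v) = Psi t p + v.
Hypothesis Psi2 : forall t p, (Psi t p).2 = p.2 + t.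
Hypothesis dPsi : forall p t, der (fun t => (Psi t p).1) t (sigma (Psi t p)).
Hypothesis Hsigma : reg2 kap sigma.
Hypothesis dphiE : forall x, der phi x (dphi x).
Hypothesis dphiB : forall x, `|gamma * dphi x| <= B.

(** The derivative of the kick along the leaf tangent (sigma p, 1). The tangent of [inv_map] sends
    this vector to (sigma p / lam + rate, lam + rate); the equation assumed next says that the image
    is again tangent to a leaf. *)
Definition kick_rate p :=
  gamma * dphi (xcoord (hyp_inv p)) * ((sigma p / lam - lam) / (2 * gold - 1)).

Hypothesis sigma_inv : forall p,
  sigma (inv_map p) * (lam + kick_rate p) = sigma p / lam + kick_rate p.

Let der_kick p t : der (fun t => kick (hyp_inv (Psi t p))) t (kick_rate (Psi t p)).
Proof.
rewrite /kick_rate -mulrA; apply: derZ; rewrite /hyp_inv /xcoord /=.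
apply: (@der_comp _ phi (fun t => ((Psi t p).1 / lam - lam * (Psi t p).2) / (2 * gold - 1)));
  last exact: dphiE.
apply: (@der_ext _ (fun t => (2 * gold - 1)^-1 * (lam^-1 * (Psi t p).1 - lam * (p.2 + t)))).
  by move=> s; rewrite Psi2; ring.
apply: der_eq; first apply: derZ; first apply: derB; first (apply: derZ; exact: dPsi).
  by apply: derZ; apply: derD; [exact: der_cst|exact: der_id].
by rewrite add0r mulr1; ring.
Qed.

Let rate_bound p : `|lam + kick_rate p| <= lam + B * ((kap + lam) / 1).
Proof.
have l0 := @lam_gt0 R; have s5 := sqrt5_gt2; have [s1 _ _] := Hsigma.
have l2 := @lam_ge2 R.
apply: (le_trans (ler_normD _ _)); apply: lerD; first by rewrite ger0_norm // ltW.
rewrite /kick_rate normrM; apply: ler_pM => //.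
rewrite normrM; apply: ler_pM => //.
  apply: (le_trans (ler_normB _ _)); rewrite (gtr0_norm l0) lerD2r normrM.
  rewrite -[kap]mulr1; apply: ler_pM => //.
  by rewrite gtr0_norm ?invr_gt0 // invf_le1 //; lra.
by rewrite invr1 gtr0_norm ?invr_gt0 ?invf_le1 //; lra.
Qed.

(* Both sides solve the leaf equation with the same second coordinate. *)
Lemma inv_map_leaf p t : inv_map (Psi t p) =
  Psi (lam * t + kick (hyp_inv (Psi t p)) - kick (hyp_inv p)) (inv_map p).
Proof.
pose tau t := lam * t + kick (hyp_inv (Psi t p)) - kick (hyp_inv p).
pose X t := (inv_map (Psi t p)).1 - (Psi (tau t) (inv_map p)).1.
pose r t := lam + kick_rate (Psi t p).
pose dX t := (sigma (inv_map (Psi t p)) - sigma (Psi (tau t) (inv_map p))) * r t.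
have E2 t0 : (inv_map (Psi t0 p)).2 = (Psi (tau t0) (inv_map p)).2.
  by rewrite Psi2 /inv_map /tau /= Psi2; ring.
have dtau s : der tau s (r s).
  rewrite /tau /r; apply: der_eq.
    apply: derB; last exact: der_cst.
    by apply: derD; [apply: derZ; exact: der_id|exact: der_kick].
  by rewrite subr0 mulr1.
have X0 : X 0 = 0 by rewrite /X /tau Psi0 mulr0 add0r subrr Psi0 subrr.
have k0 := reg2_ge0 Hsigma.
have B0 : 0 <= B by apply: le_trans (dphiB 0).
have l0 := @lam_gt0 R.
have : X t = 0; last first.
  rewrite /X => /eqP; rewrite subr_eq0 => /eqP E1.
  by apply: injective_projections; [exact: E1|exact: E2].
have M0 : 0 <= kap * (lam + B * ((kap + lam) / 1)).
  rewrite divr1; apply: mulr_ge0 => //; apply: addr_ge0; first exact: ltW.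
  by apply: mulr_ge0 => //; apply: addr_ge0 => //; exact: ltW.
apply: (@gronwall0 _ X dX (kap * (lam + B * ((kap + lam) / 1)) + 1)) => //; last lra.
- move=> s; apply: der_eq.
    apply: (@derB _ (fun s => (inv_map (Psi s p)).1) (fun s => (Psi (tau s) (inv_map p)).1)).
      apply: (@der_ext _ (fun s => lam^-1 * (Psi s p).1 + kick (hyp_inv (Psi s p)))).
        by move=> y; rewrite /inv_map /= mulrC.
      by apply: derD; [apply: derZ; exact: dPsi|exact: der_kick].
    apply: (@der_comp _ (fun s => (Psi s (inv_map p)).1) tau); first exact: dtau.
    exact: dPsi.
  rewrite /dX mulrBl; congr (_ - _).
  by rewrite /r sigma_inv [lam^-1 * _]mulrC.
- move=> s; rewrite /dX normrM.
  have h1 : `|sigma (inv_map (Psi s p)) - sigma (Psi (tau s) (inv_map p))| <= kap * `|X s|.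
    by rewrite /X -norm1_fst //; exact: reg2_lip.
  have h2 := rate_bound (Psi s p).
  have h3 : `|sigma (inv_map (Psi s p)) - sigma (Psi (tau s) (inv_map p))| * `|r s| <=
    kap * `|X s| * (lam + B * ((kap + lam) / 1)) by apply: ler_pM.
  apply: (le_trans h3); rewrite [X in _ <= X]mulrDl mul1r mulrAC lerDl; exact: normr_ge0.
Qed.

Definition leaf_renorm p := Psi (- kick (hyp_inv p)) (inv_map p).

Lemma leaf_renormalizable (T eta : R) : 0 <= T -> kap * T <= 1 / 2 ->
  8 * kap * T <= eta -> 3 * eps <= eta -> kap <= 1 / 100 -> eps <= 1 / 100 ->
  reg2 eps kick -> renormalizable_flow Psi leaf_renorm T eta.
Proof.
move=> T0 kT kTe epse kap1 eps1 He; have l0 := @lam_gt0 R; have ln := lt0r_neq0 l0.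
have k0 := reg2_ge0 Hsigma; have e0 := reg2_ge0 He; have l2 := @lam_ge2 R.
split => //.
- by move=> t tT; apply: nrm_le kTe _; exact: (drift_nrm Psi0 Psi2 dPsi Hsigma T0 kT).
- move=> r p _; apply: (le_trans (drift_abs Psi0 dPsi Hsigma r p)).
  by rewrite ler_piMl //; lra.
- by move=> p; rewrite /leaf_renorm Psi2 /inv_map /=; ring.
- move=> t p; rewrite /leaf_renorm inv_map_leaf -!PsiD; congr (Psi _ _); ring.
- move=> v p lv; rewrite /leaf_renorm /inv_map hyp_invD.
  have lv' : lat (hyp_inv v) by exact: lat_contract.
  rewrite (kick_lat _ lv') -[(v.1 / lam, lam * v.2)]/(hyp_inv v) -(PsiL _ _ lv').
  by congr (Psi _ _); rewrite addrAC.
- apply: nrm_le epse _ => b.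
  have [h1 h2 h3] := return_drift_nrm Psi0 Psi2 dPsi Hsigma He kap1 eps1 (lam * b).
  have E a : (leaf_renorm (a, b)).1 - (a, b).1 / lam =
      return_drift Psi kick (a / lam, lam * b) by [].
  have inv1 d : `|d / lam| <= `|d|.
    rewrite normrM ler_piMr // gtr0_norm ?invr_gt0 // invf_le1 //; lra.
  split=> [a|a d|a d d']; rewrite !E ?[(_ + _) / lam]mulrDl //.
    by apply: (le_trans (h2 _ _)); rewrite ler_wpM2l // mulr_ge0.
  apply: (le_trans (h3 _ _ _)).
  apply: ler_pM; rewrite ?wmod_ge0 ?mulr_ge0 //; first by rewrite ler_wpM2l // mulr_ge0.
  exact: wmod_mono.
Qed.

End LeafMap.

(** * Four-point bounds from two derivatives *)

Section Regularity.
Context {R : realType}.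
Notation gold := (@gold R).
Notation lam := (@lam R).
Implicit Types (p q v : R * R) (f u : R * R -> R) (K M c : R).

Lemma norm1N v : norm1 (- v) = norm1 v.
Proof. by rewrite /norm1 /= !normrN. Qed.

Lemma reg2_scale K c f : 0 <= c -> reg2 K f -> reg2 (c * K) (fun p => c * f p).
Proof.
move=> c0 [f1 f2 f3]; split=> [p|p v|p v v'].
- by rewrite normrM ger0_norm // ler_wpM2l.
- by rewrite -mulrBr normrM ger0_norm // -mulrA ler_wpM2l.
- by rewrite -!mulrBr -mulrDr normrM ger0_norm // -!mulrA ler_wpM2l // mulrA.
Qed.

Lemma reg2_comp_linear K c f (L : R * R -> R * R) : 1 <= c ->
  (forall p v, L (p + v) = L p + L v) -> (forall v, norm1 (L v) <= c * norm1 v) ->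
  reg2 K f -> reg2 (c ^+ 2 * K) (fun p => f (L p)).
Proof.
move=> c1 LD Lc Hf; have K0 := reg2_ge0 Hf; have [f1 f2 f3] := Hf.
have c0 : 0 <= c by lra.
have cc : c <= c ^+ 2 by rewrite expr2 ler_peMl.
split=> [p|p v|p v v'].
- by apply: (le_trans (f1 _)); rewrite ler_peMl //; lra.
- rewrite LD; apply: (le_trans (f2 _ _)); rewrite [_ * K]mulrC -mulrA ler_wpM2l //.
  by apply: (le_trans (Lc v)); rewrite ler_wpM2r ?norm1_ge0.
- rewrite !LD; apply: (le_trans (f3 _ _ _)).
  have -> : c ^+ 2 * K * norm1 v * wmod (norm1 v') =
    K * (c * norm1 v) * (c * wmod (norm1 v')) by ring.
  apply: ler_pM; rewrite ?wmod_ge0 ?mulr_ge0 ?norm1_ge0 //; first by rewrite ler_wpM2l.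
  by apply: wmod_le_scale; rewrite // !ger0_norm ?norm1_ge0.
Qed.

Definition partials f D1 D2 := forall a b,
  der (fun t => f (t, b)) a (D1 (a, b)) /\ der (fun t => f (a, t)) b (D2 (a, b)).

Lemma lip_of_partials f D1 D2 M : partials f D1 D2 ->
  (forall p, `|D1 p| <= M) -> (forall p, `|D2 p| <= M) ->
  forall p v, `|f (p + v) - f p| <= M * norm1 v.
Proof.
move=> fD M1 M2 [a b] [c d]; rewrite /norm1 /= mulrDr.
have h1 := @mvt_abs _ (fun t => f (t, b + d)) (fun t => D1 (t, b + d)) a (a + c) M
  (fun t _ => (fD _ _).1) (fun t _ => M1 _).
have h2 := @mvt_abs _ (fun t => f (a, t)) (fun t => D2 (a, t)) b (b + d) M
  (fun t _ => (fD _ _).2) (fun t _ => M2 _).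
rewrite [a + c - a]addrAC subrr add0r in h1.
rewrite [b + d - b]addrAC subrr add0r in h2.
have -> : f ((a, b) + (c, d)) - f (a, b) =
  (f (a + c, b + d) - f (a, b + d)) + (f (a, b + d) - f (a, b)).
  have -> : (a, b) + (c, d) = (a + c, b + d) by exact: injective_projections.
  by ring.
by apply: (le_trans (ler_normD _ _)); rewrite lerD.
Qed.

(** A mixed difference of f is an increment of q |-> f (q + v') - f q, whose partial derivatives are
    at most 2 M [wmod (norm1 v')] by [wmod_interp]. *)
Lemma reg2_of_partials f D1 D2 M : partials f D1 D2 ->
  (forall p, `|f p| <= M) -> (forall p, `|D1 p| <= M) -> (forall p, `|D2 p| <= M) ->
  (forall p v, `|D1 (p + v) - D1 p| <= M * norm1 v) ->
  (forall p v, `|D2 (p + v) - D2 p| <= M * norm1 v) -> reg2 (2 * M) f.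
Proof.
move=> fD M0 M1 M2 L1 L2; have Mp : 0 <= M by apply: le_trans (M0 0).
split=> [p|p v|p v v'].
- by apply: (le_trans (M0 _)); lra.
- apply: (le_trans (lip_of_partials fD M1 M2 p v)).
  by rewrite ler_wpM2r ?norm1_ge0 //; lra.
have inc (D : R * R -> R) p0 : (forall p, `|D p| <= M) ->
    (forall p v, `|D (p + v) - D p| <= M * norm1 v) ->
    `|D (p0 + v') - D p0| <= 2 * M * wmod (norm1 v').
  move=> MD LD; apply: wmod_interp.
    by apply: (le_trans (ler_normB _ _)); have := MD p0; have := MD (p0 + v'); lra.
  apply: (le_trans (LD _ _)); rewrite ger0_norm ?norm1_ge0 //.
  by rewrite ler_wpM2r ?norm1_ge0 //; lra.
pose k q := f (q + v') - f q.
have kD : partials k (fun q => D1 (q + v') - D1 q) (fun q => D2 (q + v') - D2 q).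
  move=> a b; rewrite /k; split; apply: derB; try by case: (fD a b).
    have := @der_comp _ (fun t => f (t, b + v'.2)) (fun t => t + v'.1) a
      (D1 ((a, b) + v')) 1; rewrite mulr1; apply.
      by apply: der_eq (derD (der_id _) (der_cst _ _)) _; rewrite addr0.
    by case: (fD (a + v'.1) (b + v'.2)).
  have := @der_comp _ (fun t => f (a + v'.1, t)) (fun t => t + v'.2) b
      (D2 ((a, b) + v')) 1; rewrite mulr1; apply.
    by apply: der_eq (derD (der_id _) (der_cst _ _)) _; rewrite addr0.
  by case: (fD (a + v'.1) (b + v'.2)).
have := lip_of_partials kD (fun q => inc D1 q M1 L1) (fun q => inc D2 q M2 L2) p v.
have -> : f (p + v + v') - f (p + v) - f (p + v') + f p = k (p + v) - k p.
  by rewrite /k; ring.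
by rewrite mulrAC.
Qed.

Definition uneigen q : R * R := (xcoord q, q.1 - gold * xcoord q).

Lemma uneigenK : cancel uneigen (@eigen R).
Proof.
move=> [a b]; rewrite /eigen /uneigen /=; congr (_, _); first by ring.
have s5 := @sqrt5_gt2 R; have s0 : 2 * gold - 1 != 0 by rewrite gt_eqF //; lra.
have E : xcoord (a, b) * (2 * gold - 1) = a - b by rewrite /xcoord divfK.
by rewrite gold_inv; move: (xcoord _) E => x E; lra.
Qed.

Lemma eigenK : cancel (@eigen R) uneigen.
Proof. by move=> p; rewrite /uneigen xcoord_eigen /eigen /= addrK -surjective_pairing. Qed.

Lemma uneigenD p v : uneigen (p + v) = uneigen p + uneigen v.
Proof. by rewrite /uneigen xcoordD; apply: injective_projections => //=; ring. Qed.

Lemma norm1_uneigen v : norm1 (uneigen v) <= 3 * norm1 v.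
Proof.
rewrite /norm1 /uneigen /=; have s5 := @sqrt5_gt2 R; have /andP[g1 g2] := @gold_bounds R.
have x1 : `|xcoord v| <= (`|v.1| + `|v.2|) / 2.
  rewrite /xcoord normrM; apply: ler_pM => //; first exact: ler_normB.
  by rewrite gtr0_norm ?invr_gt0 ?lef_pV2 ?posrE //; lra.
have : `|v.1 - gold * xcoord v| <= `|v.1| + gold * `|xcoord v|.
  by apply: (le_trans (ler_normB _ _)); rewrite normrM (gtr0_norm gold_gt0).
have : gold * `|xcoord v| <= 1619 / 1000 * `|xcoord v| by rewrite ler_wpM2r.
have := normr_ge0 v.1; have := normr_ge0 v.2; lra.
Qed.

Lemma reg2_uneigen K f : reg2 K f -> reg2 (9 * K) (fun q => f (uneigen q)).
Proof.
move=> Hf; have -> : 9 = 3 ^+ 2 :> R by ring.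
apply: reg2_comp_linear Hf => //; [lra|exact: uneigenD|exact: norm1_uneigen].
Qed.

(** 18 = 2 * 9: the factor 2 comes from [reg2_of_partials], and the change of coordinates of norm at
    most 3 costs 3^2 in the four-point bound. *)
Lemma reg2_xcoord (h h1 h2 : R -> R) M : (forall x, der h x (h1 x)) ->
  (forall x, der h1 x (h2 x)) -> (forall x, `|h x| <= M) -> (forall x, `|h1 x| <= M) ->
  (forall x, `|h2 x| <= M) -> reg2 (18 * M) (fun q => h (xcoord q)).
Proof.
move=> hd h1d M0 M1 M2; have Mp : 0 <= M by apply: le_trans (M0 0).
have -> : 18 * M = 9 * (2 * M) by ring.
apply: (@reg2_uneigen _ (fun p => h p.1)).
apply: (@reg2_of_partials _ (fun p => h1 p.1) (fun=> 0)) => //.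
- by move=> a b; split; [exact: hd|exact: (der_cst (h a) b)].
- by move=> *; rewrite normr0.
- apply: (@lip_of_partials (fun p => h1 p.1) (fun p => h2 p.1) (fun=> 0)) => //.
    by move=> a b; split; [exact: h1d|exact: (der_cst (h1 a) b)].
  by move=> *; rewrite normr0.
- by move=> p v; rewrite subrr normr0 mulr_ge0 ?norm1_ge0.
Qed.

End Regularity.

(** * The fixed-point equation of the stable slope *)

Section Slope.
Context {R : realType}.
Notation gold := (@gold R).
Notation lam := (@lam R).
Implicit Types (p q v : R * R) (u : R * R -> R).
Variables (phi : R -> R) (gamma : R) (kappa : R * R -> R) (eps K : R).
Notation kick := (kick phi gamma).

Definition hyp_map q : R * R := (lam * (q.1 - kick q), (q.2 - kick q) / lam).

Lemma eigen_Fmap p : eigen (Fmap phi gamma p) = hyp_map (eigen p).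
Proof.
rewrite /hyp_map /kick xcoord_eigen /eigen /Fmap /= -[_ / lam]/(_ * lam^-1).
rewrite lam_inv gold_inv /lam; have g2 := @gold_sqr R.
have E (x : R) : x * (gold ^+ 2 - gold - 1) = 0 by rewrite g2; ring.
congr (_, _); apply/eqP; rewrite -subr_eq0.
  by rewrite -(E (- p.1)); apply/eqP; ring.
by rewrite -(E (- p.1)); apply/eqP; ring.
Qed.

Hypotheses (K0 : 0 < K) (K1 : K <= 1 / 100) (epsK : eps <= K / 20).
Hypotheses (Hkick : reg2 eps kick) (Hkappa : reg2 eps kappa).

Let e0 : 0 <= eps. Proof. exact: reg2_ge0 Hkick. Qed.

Let lam_sum : lam + lam^-1 = 3.
Proof. by rewrite lam_inv /lam; ring. Qed.

Let sub (q v : R * R) : q + v - q = v. Proof. by rewrite [q + v]addrC addrK. Qed.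

Let hyp_map_lip p v : norm1 (hyp_map (p + v) - hyp_map p) <= 8 / 3 * norm1 v.
Proof.
rewrite /norm1 /hyp_map /=; set d := kick (p + v) - kick p.
have /andP[l1 l2] := @lam_bounds R; have l0 := @lam_gt0 R.
have li : 0 < lam^-1 by rewrite invr_gt0.
have -> : lam * (p.1 + v.1 - kick (p + v)) - lam * (p.1 - kick p) = lam * (v.1 - d).
  by rewrite /d; ring.
have -> : (p.2 + v.2 - kick (p + v)) / lam - (p.2 - kick p) / lam = (v.2 - d) / lam.
  by rewrite /d; ring.
rewrite !normrM (gtr0_norm l0) (gtr0_norm li).
have h1 : lam * `|v.1 - d| <= lam * (`|v.1| + `|d|) by rewrite ler_wpM2l ?ler_normB // ltW.
have h2 : `|v.2 - d| / lam <= (`|v.2| + `|d|) / lam by rewrite ler_wpM2r ?ler_normB // ltW.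
have [_ k2 _] := Hkick; have h3 : `|d| <= eps * norm1 v by exact: k2.
have ee : eps <= 1 / 2000 by have := epsK; have := K1; lra.
have h4 : eps * norm1 v <= 1 / 2000 * norm1 v by rewrite ler_wpM2r // norm1_ge0.
have h5 : lam * `|v.1| <= 2619 / 1000 * `|v.1| by rewrite ler_wpM2r.
have h6 : `|v.2| / lam <= `|v.2| * 1 by rewrite ler_wpM2l // invf_le1 //; lra.
have h7 : lam * `|d| + `|d| / lam = 3 * `|d| by rewrite -lam_sum; ring.
rewrite /norm1 in h4 h3; have := normr_ge0 v.2; have := normr_ge0 v.1; lra.
Qed.

Let hyp_map_four p v v' :
  norm1 (hyp_map (p + v + v') - hyp_map (p + v) - hyp_map (p + v') + hyp_map p) <=
  3 * (eps * norm1 v * wmod (norm1 v')).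
Proof.
set d := kick (p + v + v') - kick (p + v) - kick (p + v') + kick p.
have [_ _ k3] := Hkick; have h : `|d| <= eps * norm1 v * wmod (norm1 v') by exact: k3.
have l0 := @lam_gt0 R; have li : 0 < lam^-1 by rewrite invr_gt0.
have -> : norm1 (hyp_map (p + v + v') - hyp_map (p + v) - hyp_map (p + v') + hyp_map p) =
    `|lam * - d| + `|- d / lam|.
  rewrite /norm1; set y := hyp_map (p + v + v') - hyp_map (p + v) - hyp_map (p + v') + hyp_map p.
  have -> : y.1 = lam * - d by rewrite /y /d /hyp_map /=; ring.
  by have -> : y.2 = - d / lam by rewrite /y /d /hyp_map /=; ring.
rewrite !normrM normrN (gtr0_norm l0) (gtr0_norm li).
have -> : lam * `|d| + `|d| / lam = 3 * `|d| by rewrite -lam_sum; ring.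
by rewrite ler_wpM2l.
Qed.

(** With it the four-point factor (8/3) (7/3) / 2.6^2 of the slope equation is about 0.92; the
    exponent 1 would give (8/3)^2 / 2.6^2 > 1. *)
Let wmod83 : wmod (8 / 3 : R) <= 7 / 3.
Proof.
have E : wmod (8 / 3 : R) ^+ 5 = (8 / 3) ^+ 4.
  rewrite /wmod ger0_norm; last by lra.
  by rewrite -powR_mulrn ?powR_ge0 // -powRrM -powR_mulrn; [congr (_ `^ _); lra|lra].
rewrite leNgt; apply/negP => h.
have : (7 / 3 : R) ^+ 5 < wmod (8 / 3 : R) ^+ 5.
  by rewrite ltrXn2r ?nnegrE ?wmod_ge0 //; lra.
by rewrite E; lra.
Qed.

Let wmod_hyp p v : wmod (norm1 (hyp_map (p + v) - hyp_map p)) <= 7 / 3 * wmod (norm1 v).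
Proof.
apply: (@le_trans _ _ (wmod (8 / 3 * norm1 v))).
  apply: wmod_mono; rewrite (ger0_norm (norm1_ge0 _)).
  exact: (le_trans (hyp_map_lip p v) (ler_norm _)).
by rewrite wmodM ler_wpM2r // wmod_ge0.
Qed.

(* If s is the slope of the stable line field of F, invariance under the tangent map of F reads
   s = gamma phi' - 2 + 1 / (1 - s o F); this is that equation for u = s + gold. *)
Definition slope_step u q := kappa q + (lam - u (hyp_map q))^-1 - lam^-1.

Let lam26 u q : (forall q, `|u q| <= K) -> 26 / 10 <= lam - u q.
Proof.
move=> uK; have /andP[l1 l2] := @lam_bounds R; have := uK q; have := ler_norm (u q).
have := K1; lra.
Qed.

(** [hyp_map] stretches by at most 8/3 and u |-> 1 / (lam - u) has derivative at most 1 / 2.6^2. The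
    sup, Lipschitz and four-point bounds are thus multiplied by about 0.15, 0.40 and 0.92. What is
    left of K absorbs [kappa], at most K / 20, and the terms quadratic in K. *)
Lemma slope_step_reg2 u : reg2 K u -> reg2 K (slope_step u).
Proof.
move=> Hu; have [u1 u2 u3] := Hu; have [k1 k2 k3] := Hkappa.
have m0 : 0 < 26 / 10 :> R by lra.
have um q := lam26 q u1; have eK := epsK; have KK := K1; have Kp := K0.
rewrite /slope_step; split=> [q|q v|q v v'].
- have /andP[l1 l2] := @lam_bounds R.
  have lm : 26 / 10 <= lam by lra.
  have := lip_inv m0 (um (hyp_map q)) lm.
  have -> : lam - u (hyp_map q) - lam = - u (hyp_map q) by ring.
  rewrite normrN => h.
  have h' : `|u (hyp_map q)| / (26 / 10) ^+ 2 <= K / (26 / 10) ^+ 2.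
    by rewrite ler_wpM2r // invr_ge0 exprn_ge0 // ltW.
  rewrite -addrA; apply: (le_trans (ler_normD _ _)); have := k1 q.
  lra.
- have h := lip_inv m0 (um (hyp_map (q + v))) (um (hyp_map q)).
  have -> : kappa (q + v) + (lam - u (hyp_map (q + v)))^-1 - lam^-1 -
    (kappa q + (lam - u (hyp_map q))^-1 - lam^-1) =
    (kappa (q + v) - kappa q) + ((lam - u (hyp_map (q + v)))^-1 - (lam - u (hyp_map q))^-1).
    by ring.
  have h2 := reg2_lip (hyp_map q) (hyp_map (q + v)) Hu.
  rewrite -[X in _ <= K * norm1 X]opprB in h2.
  have E : lam - u (hyp_map (q + v)) - (lam - u (hyp_map q)) =
    u (hyp_map q) - u (hyp_map (q + v)) by ring.
  rewrite E in h.
  have n1 : K * norm1 (- (hyp_map (q + v) - hyp_map q)) <= K * (8 / 3 * norm1 v).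
    by rewrite norm1N; apply: ler_wpM2l; [exact: ltW|exact: hyp_map_lip].
  have h3 : `|u (hyp_map q) - u (hyp_map (q + v))| / (26 / 10) ^+ 2 <=
     K * (8 / 3 * norm1 v) / (26 / 10) ^+ 2.
    by rewrite ler_wpM2r ?invr_ge0 ?exprn_ge0 ?(ltW m0) // (le_trans h2).
  apply: (le_trans (ler_normD _ _)); have h4 := k2 q v.
  have h5 : eps * norm1 v <= K / 20 * norm1 v by rewrite ler_wpM2r ?norm1_ge0.
  have h6 : 0 <= K * norm1 v by rewrite mulr_ge0 ?norm1_ge0 // ltW.
  lra.
- set n := norm1 v; set w := wmod (norm1 v').
  have n0 : 0 <= n by exact: norm1_ge0.
  have w0 : 0 <= w by exact: wmod_ge0.
  set p11 := hyp_map (q + v + v'); set p10 := hyp_map (q + v).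
  set p01 := hyp_map (q + v'); set p00 := hyp_map q.
  have n10 : norm1 (p10 - p00) <= 8 / 3 * n by exact: hyp_map_lip.
  have w01 : wmod (norm1 (p01 - p00)) <= 7 / 3 * w by exact: wmod_hyp.
  have n11 : norm1 (p11 - p01) <= 8 / 3 * n.
    by rewrite /p11 -addrA [v + v']addrC addrA; exact: hyp_map_lip.
  have n4 : norm1 (p11 - p10 - p01 + p00) <= 3 * (eps * n * w) by exact: hyp_map_four.
  have u4 : `|u p11 - u p10 - u p01 + u p00| <=
      K * (8 / 3 * n) * (7 / 3 * w) + K * (3 * (eps * n * w)).
    apply: (le_trans (reg2_four _ _ _ _ Hu)); apply: lerD; last first.
      by rewrite ler_wpM2l // ltW.
    apply: ler_pM; rewrite ?wmod_ge0 ?mulr_ge0 ?norm1_ge0 ?(ltW Kp) //.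
    by rewrite ler_wpM2l // ltW.
  have Kp' := ltW Kp.
  have u01 : `|u p01 - u p00| <= 2 * K * (7 / 3 * w).
    apply: (le_trans (reg2_wmod _ _ Hu)); rewrite ler_wpM2l // mulr_ge0 //.
  have u10 : `|u p10 - u p00| <= K * (8 / 3 * n).
    by apply: (le_trans (reg2_lip _ _ Hu)); rewrite ler_wpM2l.
  have u11 : `|u p11 - u p01| <= K * (8 / 3 * n).
    by apply: (le_trans (reg2_lip _ _ Hu)); rewrite ler_wpM2l.
  have := four_inv m0 (um p11) (um p10) (um p01) (um p00).
  have s (x y : R) : lam - x - (lam - y) = - (x - y) by ring.
  have -> : lam - u p11 - (lam - u p10) - (lam - u p01) + (lam - u p00) =
    - (u p11 - u p10 - u p01 + u p00) by ring.
  rewrite !s !normrN => h.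
  set y11 := (lam - u p11)^-1 in h *; set y10 := (lam - u p10)^-1 in h *.
  set y01 := (lam - u p01)^-1 in h *; set y00 := (lam - u p00)^-1 in h *.
  have -> : kappa (q + v + v') + y11 - lam^-1 - (kappa (q + v) + y10 - lam^-1) -
    (kappa (q + v') + y01 - lam^-1) + (kappa q + y00 - lam^-1) =
    (kappa (q + v + v') - kappa (q + v) - kappa (q + v') + kappa q) +
    (y11 - y10 - y01 + y00) by ring.
  apply: (le_trans (ler_normD _ _)).
  have h0 := k3 q v v'; rewrite -/n -/w in h0.
  pose x := n * w; have x0 : 0 <= x by rewrite mulr_ge0.
  have Kx : 0 <= K * x by rewrite mulr_ge0.
  have a1 : `|u p11 - u p10 - u p01 + u p00| / (26 / 10) ^+ 2 <=
     (K * (8 / 3 * n) * (7 / 3 * w) + K * (3 * (eps * n * w))) / (26 / 10) ^+ 2.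
    by rewrite ler_wpM2r // invr_ge0 exprn_ge0 // ltW.
  have a2 : `|u p01 - u p00| * (`|u p10 - u p00| + `|u p11 - u p01|) / (26 / 10) ^+ 3 <=
     2 * K * (7 / 3 * w) * (K * (8 / 3 * n) + K * (8 / 3 * n)) / (26 / 10) ^+ 3.
    rewrite ler_wpM2r // ?invr_ge0 ?exprn_ge0 // ?(ltW m0) //.
    by apply: ler_pM => //; exact: lerD.
  have E1 : K * (8 / 3 * n) * (7 / 3 * w) + K * (3 * (eps * n * w)) =
    56 / 9 * (K * x) + 3 * (eps * (K * x)) by rewrite /x; field.
  have E2 : 2 * K * (7 / 3 * w) * (K * (8 / 3 * n) + K * (8 / 3 * n)) =
    224 / 9 * (K * (K * x)) by rewrite /x; field.
  rewrite E1 in a1; rewrite E2 in a2.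
  have b1 : eps * (K * x) <= 1 / 2000 * (K * x) by rewrite ler_wpM2r //; lra.
  have b2 : K * (K * x) <= 1 / 100 * (K * x) by rewrite ler_wpM2r.
  have b3 : eps * n * w <= K * x / 20.
    by rewrite -mulrA [K * x / 20]mulrAC ler_wpM2r.
  have -> : K * n * w = K * x by rewrite /x mulrA.
  move: (K * x) (eps * (K * x)) (K * (K * x)) b1 b2 b3 Kx a1 a2 h0 => z1 z2 z3 b1 b2 b3 Kx a1 a2 h0.
  lra.
Qed.

Lemma slope_step_contract u u' (d : R) : (forall q, `|u q| <= 1 / 4) ->
  (forall q, `|u' q| <= 1 / 4) -> (forall q, `|u q - u' q| <= d) ->
  forall q, `|slope_step u q - slope_step u' q| <= d / 2.
Proof.
move=> h1 h2 h3 q; have /andP[l1 l2] := @lam_bounds R.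
have d0 : 0 <= d by apply: le_trans (h3 0).
have m0 : 0 < 2 :> R by [].
have m1 f x : (forall q, `|f q| <= 1 / 4) -> 2 <= lam - f x.
  by move=> h; have := h x; have := ler_norm (f x); lra.
have := lip_inv m0 (m1 u (hyp_map q) h1) (m1 u' (hyp_map q) h2).
have -> : lam - u (hyp_map q) - (lam - u' (hyp_map q)) = - (u (hyp_map q) - u' (hyp_map q)).
  by ring.
have -> : slope_step u q - slope_step u' q =
  (lam - u (hyp_map q))^-1 - (lam - u' (hyp_map q))^-1 by rewrite /slope_step; ring.
rewrite normrN => /le_trans; apply.
have h : `|u (hyp_map q) - u' (hyp_map q)| / 2 ^+ 2 <= d / 2 ^+ 2 by rewrite ler_wpM2r.
lra.
Qed.

(** Iterates of the equation started at 0 keep the bound K and converge uniformly to [u], since both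
    stay in the ball of radius 1/4 where the step contracts. Only smallness of [u] is assumed, which
    is what the cone argument provides. *)
Lemma slope_reg2 u : (forall q, `|u q| <= 1 / 4) -> u =1 slope_step u -> reg2 K u.
Proof.
move=> u4 uE; apply: reg2_closed => e e_gt0.
pose un n := iter n slope_step (fun=> 0).
have Hn n : reg2 K (un n).
  elim: n => [|n IH]; last exact: slope_step_reg2.
  apply: (@reg2_le _ `|0 : R|); last exact: reg2_cst.
  by rewrite normr0 ltW.
have dn n q : `|u q - un n q| <= 1 / 4 / 2 ^+ n.
  elim: n q => [|n IH] q; first by rewrite /un /= subr0 expr0 divr1.
  rewrite uE /un /= -/(un n) exprSr invfM mulrA; apply: slope_step_contract => // q'.
  by case: (Hn n) => /(_ q') H _ _; apply: (le_trans H); have := K1; lra.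
pose n := (Num.truncn e^-1).+1.
exists (un n); first exact: Hn.
move=> q; apply: (le_trans (dn n q)).
have en : e^-1 <= 2 ^+ n.
  apply: (@le_trans _ _ (n%:R)); first by rewrite ltW // truncnS_gt.
  by rewrite -natrX ler_nat ltnW // ltn_expl.
have p0 : 0 < 2 ^+ n :> R by rewrite exprn_gt0.
have : (2 ^+ n)^-1 <= e by rewrite -[e]invrK lef_pV2 ?posrE ?invr_gt0.
have : 0 <= (2 ^+ n : R)^-1 by rewrite invr_ge0 ltW.
lra.
Qed.

(** The vector (1, u - gold) has eigen-coordinates (u, u - sqrt 5); this is their quotient, the
    velocity of the first coordinate when the second one is time. *)
Definition leaf_slope u q := u q / (u q - (2 * gold - 1)).

Lemma leaf_slope_reg2 u : reg2 K u -> reg2 (24 * K) (leaf_slope u).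
Proof.
move=> Hu; have [u1 _ _] := Hu; have s5 := @sqrt5_gt2 R.
have /andP[g1 g2] := @gold_bounds R; have KK := K1; have Kp := K0.
have fm p : 2 <= (2 * gold - 1) + - u p by have := u1 p; have := ler_norm (u p); lra.
have H1 : reg2 (`|2 * gold - 1| + K) (fun p => 2 * gold - 1 + - u p).
  by apply: reg2_add; [exact: reg2_cst|exact: reg2_opp].
have H2 : reg2 (9 / 4) (fun p => 2 * gold - 1 + - u p).
  by apply: reg2_le H1; rewrite ger0_norm; lra.
have H3 := reg2_inv (ltr0n _ 2) fm H2.
have H4 : reg2 4 (fun p => (2 * gold - 1 + - u p)^-1).
  by apply: reg2_le H3; rewrite -[2%:R]/2; lra.
have -> : leaf_slope u = fun q => - (u q * (2 * gold - 1 + - u q)^-1).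
  by apply/funext => q; rewrite /leaf_slope -mulrN -invrN; congr (_ / _); ring.
by apply: reg2_opp; apply: reg2_le (reg2_mul Hu H4); lra.
Qed.

End Slope.

(** * Reparametrising a flow by a monotone coordinate *)

Section TimeChange.
Context {R : realType}.
Implicit Types (p q v : R * R).

Lemma mvt_decr (B beta : R -> R) c : (forall t, der B t (beta t)) -> (forall t, beta t <= - c) ->
  forall s t, s <= t -> B t <= B s - c * (t - s).
Proof.
move=> Bd bc s t st.
have [] := @MVT_segment R B beta s t st.
- by move=> x _; exact: Bd.
- by apply: continuous_subspaceT => x; exact: der_continuous (Bd x).
move=> x _ E; have : beta x * (t - s) <= - c * (t - s) by rewrite ler_wpM2r // subr_ge0.
lra.
Qed.

Lemma decreasing_inverse (B beta : R -> R) c : (forall t, der B t (beta t)) -> 0 < c ->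
  (forall t, beta t <= - c) ->
  exists T : R -> R, [/\ cancel T B, cancel B T & forall y, der T y (beta (T y))^-1].
Proof.
move=> Bd c0 bc; have mono := mvt_decr Bd bc.
have inj s t : B s = B t -> s = t.
  move=> E; have [st|ts|//] := ltgtP s t.
    have := mono s t (ltW st); have : 0 < c * (t - s) by rewrite mulr_gt0 // subr_gt0.
    lra.
  have := mono t s (ltW ts); have : 0 < c * (s - t) by rewrite mulr_gt0 // subr_gt0.
  lra.
have cB : continuous B by move=> x; exact: der_continuous (Bd x).
have surj y : exists t, B t = y.
  pose M := `|y - B 0| / c.
  have M0 : 0 <= M by rewrite divr_ge0 // ltW.
  have MM : - M <= M by lra.
  have Mc : c * M = `|y - B 0| by rewrite /M mulrC divfK // gt_eqF.
  have h1 := mono 0 M M0; have NM : - M <= 0 by lra.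
  have h2 := mono (- M) 0 NM.
  have := ler_norm (y - B 0); have := ler_norm (- (y - B 0)); rewrite normrN => h3 h4.
  have [] := @IVT R B (- M) M y MM (continuous_subspaceT cB).
    rewrite ge_min le_max; apply/andP; split; apply/orP.
      by right; lra.
    by left; lra.
  by move=> t _ E; exists t.
pose T y := projT1 (cid (surj y)).
have BT y : B (T y) = y by rewrite /T; case: cid.
have TB t : T (B t) = t by apply: inj.
exists T; split=> // y; rewrite -{1}[y]BT.
apply: is_derive_inverse.
- by apply: filterE => x; exact: TB.
- by apply: filterE => x; exact: cB.
- exact: Bd.
- by have := bc (T y); apply: contraTneq => ->; rewrite -ltNge; lra.
Qed.

Variables (E : R -> R * R -> R * R) (alpha beta : R * R -> R) (c : R).
Hypothesis E0 : forall q, E 0 q = q.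
Hypothesis ED : forall s t q, E (s + t) q = E s (E t q).
Hypothesis EL : forall t v q, lat v -> E t (q + v) = E t q + v.
Hypothesis dE1 : forall q t, der (fun t => (E t q).1) t (alpha (E t q)).
Hypothesis dE2 : forall q t, der (fun t => (E t q).2) t (beta (E t q)).
Hypotheses (c0 : 0 < c) (bc : forall q, beta q <= - c).

(* [Psi] runs along the orbits of [E] at unit speed in the second coordinate. *)
Lemma time_change : exists Psi : R -> R * R -> R * R,
  [/\ forall p, Psi 0 p = p, forall s t p, Psi (s + t) p = Psi s (Psi t p),
    forall t v p, lat v -> Psi t (p + v) = Psi t p + v,
    (forall t p, (Psi t p).2 = p.2 + t) /\ (forall t q, E t q = Psi ((E t q).2 - q.2) q) &
    forall p t, der (fun t => (Psi t p).1) t (alpha (Psi t p) / beta (Psi t p))].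
Proof.
have inv q := decreasing_inverse (dE2 q) c0 (fun t => bc (E t q)).
pose T q := projT1 (cid (inv q)).
have HT q : [/\ cancel (T q) (fun t => (E t q).2), cancel (fun t => (E t q).2) (T q) &
    forall y, der (T q) y (beta (E (T q y) q))^-1] by rewrite /T; case: cid.
pose Psi t q := E (T q (q.2 + t)) q.
have Psi2 t q : (Psi t q).2 = q.2 + t by case: (HT q) => /(_ (q.2 + t)).
have E_Psi t q : E t q = Psi ((E t q).2 - q.2) q.
  by rewrite /Psi addrC subrK; case: (HT q) => _ /(_ t) /= ->.
(* A point of an orbit is determined by its height; the flow law and the lattice equivariance of
   [Psi] both reduce to this. *)
have uniq s q x : E s q = x -> x = Psi (x.2 - q.2) q by move=> <-; exact: E_Psi.
exists Psi; split=> //.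
- by move=> p; rewrite -{2}(E0 p) E_Psi E0 subrr.
- move=> s t p; symmetry; have := @uniq (T (Psi t p) ((Psi t p).2 + s) + T p (p.2 + t)) p (Psi s (Psi t p)).
  rewrite ED -/(Psi t p) -/(Psi s (Psi t p)) => /(_ erefl) ->.
  by rewrite !Psi2; congr (Psi _ _); ring.
- move=> t v p lv; symmetry; have := @uniq (T p (p.2 + t)) (p + v) (Psi t p + v).
  rewrite EL // => /(_ erefl) ->.
  by congr (Psi _ _); rewrite /= Psi2; ring.
- move=> p t; case: (HT p) => _ _ dT.
  apply: (@der_comp _ (fun s => (E s p).1) (fun t => T p (p.2 + t))); last exact: dE1.
  apply: (@der_ext _ (fun t => T p (t + p.2))); first by move=> y; rewrite addrC.
  by rewrite /Psi [p.2 + t]addrC; apply: der_shift.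
Qed.

End TimeChange.

(** * Differentials of the coordinate projections *)

Section Projections.
Context {R : realType}.

Lemma is_diff_fst (x : R * R) : is_diff x (fst : R * R -> R) fst.
Proof.
have cf : continuous (fst : R * R -> R) by move=> p; exact: cvg_fst.
by split; [exact: linear_differentiable|rewrite diff_lin].
Qed.

Lemma is_diff_snd (x : R * R) : is_diff x (snd : R * R -> R) snd.
Proof.
have cf : continuous (snd : R * R -> R) by move=> p; exact: cvg_snd.
by split; [exact: linear_differentiable|rewrite diff_lin].
Qed.

End Projections.

(** * Location of the stable direction and the equation of its slope *)

Section StableCone.
Context {R : realType}.
Notation gold := (@gold R).
Notation lam := (@lam R).
Implicit Types (p q v x : R * R).
Variables (phi dphi : R -> R) (gamma : R).
Hypothesis dphiE : forall t, der phi t (dphi t).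
Hypothesis gphi : forall t, `|gamma * dphi t| <= 1 / 100.
Notation F := (Fmap phi gamma).

Definition Fmap_tangent x v : R * R :=
  (2 * v.1 + v.2 - gamma * dphi x.1 * v.1, v.1 + v.2 - gamma * dphi x.1 * v.1).

Let diff_phi t : is_diff t phi (fun h => h *: dphi t).
Proof.
have [Hd Hv] := dphiE t; have dd : differentiable phi t by exact/derivable1_diffP.
split=> //; apply/funext => h; rewrite -{1}[h]mulr1 -[h * 1]/(h *: 1) linearZ /=.
by rewrite -Hv deriveE.
Qed.

Lemma diff_Fmap x : is_diff x F (Fmap_tangent x).
Proof.
have d1 := is_diff_fst x; have d2 := is_diff_snd x; have dp := is_diff_comp d1 (diff_phi x.1).
have -> : F = fun p => ((2 *: fst + snd - gamma *: (phi \o fst)) p,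
                        (fst + snd - gamma *: (phi \o fst)) p) by apply/funext.
apply: is_diff_eq.
apply/funext => v; rewrite /Fmap_tangent.
apply: injective_projections => /=.
  rewrite -[(_ - _) v]/(2 * v.1 + v.2 - gamma * (v.1 * dphi x.1)); ring.
rewrite -[(_ - _) v]/(v.1 + v.2 - gamma * (v.1 * dphi x.1)); ring.
Qed.

Fixpoint iter_tangent n x v := if n is n'.+1 then
  Fmap_tangent (iter n' F x) (iter_tangent n' x v) else v.

Lemma diff_iter_Fmap n x : is_diff x (iter n F) (iter_tangent n x).
Proof.
elim: n => [|n IH]; first exact: is_diff_id.
have -> : iter n.+1 F = F \o iter n F by apply/funext.
exact: is_diff_comp IH (diff_Fmap _).
Qed.

(* Vectors of this cone expand under forward iteration, so the stable line avoids it. *)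
Definition in_cone v := `|(eigen v).2| <= 10 * `|(eigen v).1|.

Lemma eigen_tangent x v : eigen (Fmap_tangent x v) =
  (lam * ((eigen v).1 - gamma * dphi x.1 * v.1), ((eigen v).2 - gamma * dphi x.1 * v.1) / lam).
Proof.
rewrite /eigen /Fmap_tangent /= -[_ / lam]/(_ * lam^-1) lam_inv gold_inv /lam.
have E (y : R) : y * (gold ^+ 2 - gold - 1) = 0 by rewrite gold_sqr; ring.
congr (_, _); apply/eqP; rewrite -subr_eq0 -(E (- v.1)); apply/eqP; ring.
Qed.

(** In the cone |v.1| is at most 11/2 of the first eigen-coordinate a, so the nonlinear term is at
    most 0.055 |a|; then |a| grows by lam * 0.945 > 2 while the second coordinate stays below 11
    |a|. *)
Lemma cone_step x v : in_cone v -> in_cone (Fmap_tangent x v) /\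
  2 * `|(eigen v).1| <= `|(eigen (Fmap_tangent x v)).1|.
Proof.
have T1 : (eigen (Fmap_tangent x v)).1 = lam * ((eigen v).1 - gamma * dphi x.1 * v.1).
  by rewrite eigen_tangent.
have T2 : (eigen (Fmap_tangent x v)).2 = ((eigen v).2 - gamma * dphi x.1 * v.1) / lam.
  by rewrite eigen_tangent.
rewrite /in_cone T1 T2 => H.
have xE := xcoord_eigen v; rewrite /xcoord in xE.
have l0 := @lam_gt0 R; have /andP[l1 l2] := @lam_bounds R.
set a := (eigen v).1 in H *; set b := (eigen v).2 in H *.
have s5 := @sqrt5_gt2 R.
have v1 : `|v.1| <= 11 / 2 * `|a|.
  rewrite -xE normrM [`|_^-1|]gtr0_norm ?invr_gt0; last lra.
  apply: (@le_trans _ _ ((11 * `|a|) / 2)); last lra.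
  apply: ler_pM => //; first by rewrite invr_ge0; lra.
    by apply: (le_trans (ler_normB _ _)); lra.
  by rewrite lef_pV2 ?posrE; lra.
have k1 : `|gamma * dphi x.1 * v.1| <= 1 / 100 * (11 / 2 * `|a|).
  by rewrite normrM ler_pM.
set k := gamma * dphi x.1 * v.1 in k1 *.
have a1 : `|a| - `|k| <= `|a - k| by exact: lerB_dist.
have b1 : `|b - k| <= `|b| + `|k| by exact: ler_normB.
have li : lam^-1 <= 1 by rewrite invf_le1 //; lra.
have li0 : 0 <= lam^-1 by rewrite invr_ge0 ltW.
rewrite !normrM (gtr0_norm l0) (ger0_norm li0).
have h1 : 2618 / 1000 * `|a - k| <= lam * `|a - k| by rewrite ler_wpM2r.
split; last by have := normr_ge0 a; lra.
have h2 : `|b - k| / lam <= `|b - k| * 1 by rewrite ler_wpM2l.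
have := normr_ge0 a; lra.
Qed.

Lemma cone_growth n x v : in_cone v ->
  2 ^+ n * `|(eigen v).1| <= `|(eigen (iter_tangent n x v)).1|.
Proof.
move=> Hv; suff : in_cone (iter_tangent n x v) /\
  2 ^+ n * `|(eigen v).1| <= `|(eigen (iter_tangent n x v)).1| by case.
elim: n => [|n [IH1 IH2]]; first by rewrite expr0 mul1r.
have [h1 h2] := cone_step (iter n F x) IH1; split=> //=.
by rewrite exprS -mulrA; apply: le_trans h2; rewrite ler_wpM2l.
Qed.

Variable V : R * R -> R * R.
Hypothesis HV : unit_stable_field F V.

Definition slope x := (V x).2 / (V x).1.

(** Stable vectors stay bounded under iteration, whereas in the cone the first eigen-coordinate
    doubles. It must vanish, then so does the second by the cone condition, which contradicts
    [0 < (V x).1]. *)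
Lemma stable_not_in_cone x : ~~ in_cone (V x).
Proof.
have [Es [Eu [[_ _ _ [C [l [C0 /andP[l0 l1] Hs _]]]] /(_ x)[V1 Vp EV]]]] := HV.
apply/negP => Hc.
have Vs : V x \in Es x by rewrite EV memv_line.
pose M := 3 * C * `|V x|.
have a0 : `|(eigen (V x)).1| <= 0.
  apply/ler_addgt0Pr => e e0; rewrite add0r.
  pose n := (Num.truncn (M / e)).+1.
  have h1 := cone_growth n x Hc.
  have h2 := Hs n x _ Vs.
  have [_ E] := diff_iter_Fmap n x; rewrite E in h2.
  have /andP[g1 g2] := @gold_bounds R.
  set w := iter_tangent n x (V x) in h1 h2.
  have h3 : `|(eigen w).1| <= 3 * `|w|.
    apply: (le_trans (ler_normD _ _)); rewrite normrM (gtr0_norm gold_gt0).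
    have w1 : `|w.1| <= `|w| by rewrite [`|w|]prod_normE le_max lexx.
    have w2 : `|w.2| <= `|w| by rewrite [`|w|]prod_normE le_max lexx orbT.
    have : gold * `|w.1| <= 2 * `|w| by rewrite ler_pM //; lra.
    lra.
  have ln : l ^+ n <= 1 by rewrite exprn_ile1 // ltW.
  have h4 : C * l ^+ n * `|V x| <= C * 1 * `|V x|.
    by rewrite ler_wpM2r // ler_wpM2l // ltW.
  have h5 : 2 ^+ n * `|(eigen (V x)).1| <= M by rewrite /M; lra.
  have n2 : M / e <= 2 ^+ n.
    apply: (@le_trans _ _ (n%:R)); first by rewrite ltW // truncnS_gt.
    by rewrite -natrX ler_nat ltnW // ltn_expl.
  rewrite -(@ler_pM2l _ (2 ^+ n)) ?exprn_gt0 //; apply: (le_trans h5).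
  by rewrite -ler_pdivrMr.
move: Hc a0; rewrite /in_cone normr_le0 => Hc /eqP a0.
rewrite a0 normr0 mulr0 normr_le0 in Hc; move/eqP: Hc => b0.
have E0 : eigen (V x) = 0 by apply: injective_projections.
have : V x = uneigen 0 by rewrite -E0 eigenK.
move=> Vx; move: Vp; rewrite Vx /uneigen /xcoord /= subrr mul0r.
by rewrite ltxx.
Qed.

(** Outside the cone, 10 |s + gold| < |s - 1/gold| <= |s + gold| + sqrt 5, so |s + gold| < sqrt 5 /
    9 < 1/4. The aperture 10 of the cone is chosen for this. *)
Lemma slope_near_gold x : `|slope x + gold| <= 1 / 4.
Proof.
have [Es [Eu [_ /(_ x)[_ Vp _]]]] := HV.
have := stable_not_in_cone x; rewrite /in_cone -ltNge /eigen /=.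
have VE : (V x).2 = slope x * (V x).1 by rewrite /slope divfK // gt_eqF.
rewrite VE -mulrDl.
have -> : slope x * (V x).1 - (V x).1 / gold = (slope x - gold^-1) * (V x).1 by ring.
rewrite !normrM (gtr0_norm Vp) mulrA ltr_pM2r // gold_inv => H.
have /andP[g1 g2] := @gold_bounds R.
have : `|slope x - (gold - 1)| <= `|slope x + gold| + (2 * gold - 1).
  have -> : slope x - (gold - 1) = (slope x + gold) - (2 * gold - 1) by ring.
  by apply: (le_trans (ler_normB _ _)); rewrite lerD2l ger0_norm //; lra.
lra.
Qed.

Lemma slope_equation x : slope x = gamma * dphi x.1 - 2 + (1 - slope (F x))^-1.
Proof.
have [Es [Eu [[_ _ /(_ x)[EF _] _] VE]]] := HV.
have [_ Vp EV] := VE x; have [_ Vp' EV'] := VE (F x).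
have VF : V (F x) \in (linfun ('d F x) @: Es x)%VS by rewrite EF EV' memv_line.
move/memv_imgP: VF => [w]; rewrite EV => /vlineP[m ->].
have [_ E] := diff_Fmap x.
rewrite lfunE /= linearZ /= E /Fmap_tangent => V'.
set k := gamma * dphi x.1 in V' *.
rewrite /slope V' /=.
have d0 : m *: (2 * (V x).1 + (V x).2 - k * (V x).1) != 0.
  by have := Vp'; rewrite V' /= => /gt_eqF ->.
move: d0; rewrite -[_ *: _]/(m * _) mulf_eq0 negb_or => /andP[m0 d0].
rewrite -![_ *: _]/(m * _).
have x0 : (V x).1 != 0 by rewrite gt_eqF.
have e0 : 1 - m * ((V x).1 + (V x).2 - k * (V x).1) / (m * (2 * (V x).1 + (V x).2 - k * (V x).1))
  = (V x).1 / (2 * (V x).1 + (V x).2 - k * (V x).1).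
  by field; rewrite m0 d0.
rewrite e0; field; by rewrite x0 d0.
Qed.

Definition slope_defect q := slope (uneigen q) + gold.

Lemma slope_defect_le q : `|slope_defect q| <= 1 / 4.
Proof. exact: slope_near_gold. Qed.

Lemma slope_defect_fixed :
  slope_defect =1 slope_step phi gamma (fun q => gamma * dphi (xcoord q)) slope_defect.
Proof.
move=> q; rewrite /slope_step /slope_defect.
have E : uneigen (hyp_map phi gamma q) = F (uneigen q).
  by rewrite -{1}(uneigenK q) -eigen_Fmap eigenK.
rewrite E slope_equation lam_inv -[(uneigen q).1]/(xcoord q).
have -> : lam - (slope (F (uneigen q)) + gold) = 1 - slope (F (uneigen q)).
  by rewrite /lam; ring.
ring.
Qed.

End StableCone.

(** * Invariant measures exclude linear growth of orbit integrals *)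

Section InvariantMean.
Context {R : realType}.

Lemma open_measurable2 (U : set (R * R)) : open U -> measurable U.
Proof.
move=> oU.
pose box (i : rat * rat * nat) : set (R * R) :=
  ball (ratr i.1.1 : R) i.2.+1%:R^-1 `*` ball (ratr i.1.2 : R) i.2.+1%:R^-1.
have mbox i : measurable (box i) by apply: measurableX; exact: measurable_realfun.measurable_ball.
have -> : U = \bigcup_i (if `[< box i `<=` U >] then box i else set0).
  apply/seteqP; split=> [[x y] Uxy|p [i _]]; last first.
    by case: ifPn => // /asboolP; exact.
  have /nbhs_ballP[e /= e0 eU] : nbhs (x, y) U by exact: open_nbhs_nbhs.
  have e2 : 0 < e / 2 by rewrite divr_gt0.
  pose n := Num.truncn (e / 2)^-1.
  have ne : n.+1%:R^-1 < e / 2.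
    rewrite -[e / 2]invrK ltf_pV2 ?posrE ?invr_gt0 //; exact: truncnS_gt.
  have n0 : 0 < n.+1%:R^-1 :> R by rewrite invr_gt0.
  have close (z : R) : exists q : rat, ball (ratr q : R) n.+1%:R^-1 z.
    have : z < z + n.+1%:R^-1 by rewrite ltrDl.
    move=> /rat_in_itvoo[q]; rewrite in_itv /= => /andP[h1 h2]; exists q.
    by move: h1 h2 n0; rewrite /ball /=; move: (n.+1%:R^-1) => r h1 h2 n0; rewrite gtr0_norm; lra.
  have [q hq] := close x; have [q' hq'] := close y.
  exists (q, q', n) => //; rewrite ifT; first by split.
  apply/asboolP => -[x' y'] [/= h1 h2]; apply: eU; split => /=.
    move: hq h1; rewrite /ball /= => a b.
    have -> : x - x' = (ratr q - x') - (ratr q - x) by ring.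
    apply: (le_lt_trans (ler_normB _ _)); move: (n.+1%:R^-1) ne a b => r; lra.
  move: hq' h2; rewrite /ball /= => a b.
  have -> : y - y' = (ratr q' - y') - (ratr q' - y) by ring.
  apply: (le_lt_trans (ler_normB _ _)); move: (n.+1%:R^-1) ne a b => r; lra.
apply: countable_bigcupT_measurable => // i; case: ifP => // _.
Qed.

Lemma continuous_measurable2 (f : R * R -> R) : continuous f -> measurable_fun setT f.
Proof.
move=> /continuousP cf; apply: (measurability _ (measurable_realfun.RGenOpens.measurableE R)).
move=> _ [_ [a [b ->] <-]]; rewrite setTI; apply: open_measurable2.
exact/cf/interval_open.
Qed.

Variables (Phi : R -> R * R -> R * R) (mu : probability (R * R)%type R).
Hypothesis Phi_cont : forall t, continuous (Phi t).
Hypothesis mu_inv : invariant_torus_probability Phi mu.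

Lemma bounded_integrable2 (f : R * R -> R) M : continuous f -> (forall x, `|f x| <= M) ->
  mu.-integrable setT (EFin \o f).
Proof.
move=> cf fM; apply: measurable_bounded_integrable => //.
- by apply: (le_lt_trans (probability_le1 mu measurableT)); rewrite ltry.
- exact: continuous_measurable2.
- exists M; split; first exact: num_real.
  by move=> x Mx y _; apply: le_trans (ltW Mx); exact: fM.
Qed.

(** Preimages under the periodic [g] are periodic sets, the only ones on which invariance is known;
    hence [g] and its translate have the same image measure on the line. *)
Lemma invariant_mean (g : R * R -> R) M t : continuous g -> periodic2 g ->
  (forall x, `|g x| <= M) ->
  \int[mu]_(x in setT) g (Phi t x) = \int[mu]_(x in setT) g x.
Proof.
move=> cg pg gM; rewrite /Rintegral; congr fine.
have cgt : continuous (fun x => g (Phi t x)).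
  by move=> x; apply: continuous_comp; [exact: Phi_cont|exact: cg].
have m1 := continuous_measurable2 cg; have m2 := continuous_measurable2 cgt.
have i1 := bounded_integrable2 cg gM.
have i2 := bounded_integrable2 cgt (fun x => gM (Phi t x)).
have mid := @measurable_realfun.EFin_measurable R setT.
have := @integral_pushforward _ _ _ _ R _ m1 mu setT _ mid i1 measurableT.
have := @integral_pushforward _ _ _ _ R _ m2 mu setT _ mid i2 measurableT.
rewrite !preimage_setT => <- <-.
apply: eq_measure_integral => A mA _; rewrite /pushforward.
rewrite -[X in mu X = _]/(Phi t @^-1` (g @^-1` A)); apply: mu_inv.
  by rewrite -[X in measurable X]setTI; exact: m1.
by move=> k l x; rewrite /preimage /=; congr (A _); exact: pg.
Qed.

(** Orbit integrals are compared with Riemann sums. Every sum has mean 0, since each translate of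
    [g] has, while linear growth would make a long sum at least 1/h everywhere. Finite sums take the
    place of Fubini. *)
Lemma no_linear_growth (g : R * R -> R) (M L c C : R) : continuous g -> periodic2 g ->
  (forall x, `|g x| <= M) -> (forall x, continuous (fun s => g (Phi s x))) ->
  (forall x s t, `|g (Phi s x) - g (Phi t x)| <= L * `|s - t|) ->
  \int[mu]_(x in setT) g x = 0 -> 0 < c ->
  ~ (forall x t, 0 <= t -> c * t - C <= itg (fun s => g (Phi s x)) t).
Proof.
move=> cg pg gM cgs gL g0 c0 growth.
have L0 : 0 <= L by have := gL 0 1 0; rewrite subr0 normr1 mulr1; apply: le_trans.
(* The Riemann error per unit of time, L h, stays below c/2, so half of the growth survives. *)
pose h := c / (2 * (L + 1)).
have L1 : 0 < 2 * (L + 1) by rewrite mulr_gt0 //; lra.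
have h0 : 0 < h by rewrite divr_gt0.
have hL : 2 * (L + 1) * h = c by rewrite /h mulrC divfK // gt_eqF.
pose S n x := \sum_(i < n) g (Phi (i%:R * h) x).
have SS n x : S n.+1 x = S n x + g (Phi (n%:R * h) x) by rewrite /S big_ord_recr.
have cgt t : continuous (fun x => g (Phi t x)).
  by move=> x; apply: continuous_comp; [exact: Phi_cont|exact: cg].
have S0 n : [/\ continuous (S n), forall x, `|S n x| <= n%:R * M & \int[mu]_(x in setT) S n x = 0].
  elim: n => [|n [IH1 IH2 IH3]].
    have -> : S 0 = fun=> 0 by apply/funext => x; rewrite /S big_ord0.
    split; first exact: cst_continuous.
      by move=> x; rewrite normr0 mul0r.
    by rewrite Rintegral_cst // mul0r.
  have -> : S n.+1 = fun x => S n x + g (Phi (n%:R * h) x) by apply/funext => x.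
  split.
  - by move=> x; apply: continuousD; [exact: IH1|exact: cgt].
  - move=> x; rewrite -natr1 mulrDl mul1r; apply: (le_trans (ler_normD _ _)).
    exact: lerD.
  - rewrite RintegralD //; last exact: bounded_integrable2 (fun x => gM _).
      by rewrite IH3 (invariant_mean _ cg pg gM) g0 addr0.
    exact: bounded_integrable2 IH2.
have AS n x : itg (fun s => g (Phi s x)) (n%:R * h) <= h * S n x + n%:R * (L * h * h).
  elim: n => [|n IH]; first by rewrite !mul0r itg0 /S big_ord0 mulr0 addr0.
  pose f t := itg (fun s => g (Phi s x)) t - t * g (Phi (n%:R * h) x).
  have fd t : der f t (g (Phi t x) - g (Phi (n%:R * h) x)).
    apply: derB; first exact: der_itg.
    by apply: der_eq; first exact: (derM (der_id t) (der_cst _ t)); rewrite mul1r mulr0 addr0.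
  have := @mvt_abs _ f _ (n%:R * h) (n.+1%:R * h) (L * h) (fun t _ => fd t).
  have -> : n.+1%:R * h - n%:R * h = h by rewrite -natr1; ring.
  rewrite (gtr0_norm h0) => H.
  have {}H : `|f (n.+1%:R * h) - f (n%:R * h)| <= L * h * h.
    apply: H => t tn; apply: (le_trans (gL _ _ _)); rewrite ler_wpM2l //.
    have E : n.+1%:R * h = n%:R * h + h by rewrite -natr1; ring.
    by move: tn; rewrite /btw E; move: (n%:R * h) => z /orP[]/andP[? ?]; rewrite ler_norml; lra.
  have {H} := le_trans (ler_norm _) H; rewrite /f SS.
  have -> : n.+1%:R * (L * h * h) = n%:R * (L * h * h) + L * h * h by rewrite -natr1; ring.
  have -> : n.+1%:R * h * g (Phi (n%:R * h) x) =
    n%:R * h * g (Phi (n%:R * h) x) + h * g (Phi (n%:R * h) x) by rewrite -natr1; ring.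
  lra.
pose n := (Num.truncn ((`|C| + 1) / (c / 2 * h))).+1.
have ch : 0 < c / 2 * h by rewrite mulr_gt0 // divr_gt0.
have nbig : `|C| + 1 <= n%:R * (c / 2 * h).
  by rewrite -ler_pdivrMr // ltW // truncnS_gt.
have low x : h^-1 <= S n x.
  rewrite -(ler_pM2l h0) divff ?gt_eqF //.
  have nh : 0 <= n%:R * h by rewrite mulr_ge0 // ltW.
  have := growth x _ nh; have := AS n x.
  have e1 : n%:R * (L * h * h) <= n%:R * (c / 2 * h).
    rewrite ler_wpM2l // ler_wpM2r ?(ltW h0) //; lra.
  have := ler_norm C.
  have -> : c * (n%:R * h) = 2 * (n%:R * (c / 2 * h)) by field.
  lra.
have [Sc SM Sint] := S0 n.
have := @le_Rintegral _ _ _ mu setT (cst h^-1) (S n) measurableT.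
rewrite Rintegral_cst // Sint => H.
have {H} : h^-1 * fine (mu setT) <= 0.
  apply: H => //; last exact: bounded_integrable2 SM.
  by apply: (@bounded_integrable2 _ `|h^-1|) => //; exact: cst_continuous.
have -> : fine (mu setT) = 1.
  by have -> : mu setT = 1%E by exact: probability_setT.
by rewrite mulr1 leNgt invr_gt0 h0.
Qed.

End InvariantMean.

(** * Bounds for periodic differentiable functions *)

Section PeriodicRegularity.
Context {R : realType}.
Implicit Types (f g : R * R -> R) (x p v : R * R).

Lemma periodic_bounded f : continuous f -> periodic2 f -> exists M, forall x, `|f x| <= M.
Proof.
move=> cf pf.
have cK : compact (`[(0 : R), 1]%classic `*` `[(0 : R), 1]%classic).
  by apply: compact_setX; exact: segment_compact.
have : compact (f @` (`[(0 : R), 1]%classic `*` `[(0 : R), 1]%classic)).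
  apply: continuous_compact => //; exact: continuous_subspaceT.
move/compact_bounded => [M [_ HM]]; exists (M + 1) => x.
have frac (t : R) : 0 <= t + (- Num.floor t)%:~R <= 1.
  rewrite rmorphN; apply/andP; split; first by rewrite subr_ge0 floor_le.
  by rewrite lerBlDl ltW // -[1]/(1%:~R) -intrD floorD1_gt.
rewrite -(pf (- Num.floor x.1) (- Num.floor x.2) x).
apply: (HM (M + 1)); first lra.
exists (x + lattice R (- Num.floor x.1) (- Num.floor x.2)) => //.
by split; rewrite /= in_itv /=; exact: frac.
Qed.

Lemma Ck_holder_continuous a k f : Ck_holder a k f -> continuous f.
Proof. by case: k => [|k] []. Qed.

(** A directional derivative depends only on the increments in its direction. This serves for
    translation by periods, for restriction to coordinate lines and for equivariant flows. *)
Lemma derive_eq_increments (U U' W : normedModType R) (h : U -> W) (h' : U' -> W) (y v : U) (y' v' : U') :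
  (forall r : R, h (r *: v + y) - h y = h' (r *: v' + y') - h' y') ->
  (derivable h y v -> derivable h' y' v') /\ 'D_v' h' y' = 'D_v h y.
Proof.
move=> E.
have F : (fun r : R => r^-1 *: ((h \o shift y) (r *: v) - h y)) =
         (fun r : R => r^-1 *: ((h' \o shift y') (r *: v') - h' y')).
  by apply/funext => r /=; rewrite E.
by rewrite /derivable /derive F.
Qed.

Lemma derive_periodic f v : periodic2 f -> periodic2 ('D_v f).
Proof.
move=> pf k l x; apply: (derive_eq_increments _).2 => r.
by rewrite addrA !pf.
Qed.

Lemma partials_of_derivable f : (forall x, derivable f x (1, 0) /\ derivable f x (0, 1)) ->
  partials f ('D_((1, 0) : R * R) f) ('D_((0, 1) : R * R) f).
Proof.
move=> fd a b; have [d1 d2] := fd (a, b).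
have [r1 e1] : (derivable f (a, b) (1, 0) -> derivable (fun t : R => f (t, b)) a 1) /\
    'D_1 (fun t : R => f (t, b)) a = 'D_((1, 0) : R * R) f (a, b).
  apply: derive_eq_increments => r; congr (f _ - _).
  by apply: injective_projections => //=; rewrite /GRing.scale /= mulr0 add0r.
have [r2 e2] : (derivable f (a, b) (0, 1) -> derivable (fun t : R => f (a, t)) b 1) /\
    'D_1 (fun t : R => f (a, t)) b = 'D_((0, 1) : R * R) f (a, b).
  apply: derive_eq_increments => r; congr (f _ - _).
  by apply: injective_projections => //=; rewrite /GRing.scale /= mulr0 add0r.
by split; split; [exact: r1|exact: e1|exact: r2|exact: e2].
Qed.

Lemma C2_reg2 r f : 2 <= r -> C_torus r f -> exists K, reg2 K f.
Proof.
move=> r2 [r0 pf].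
have : (2 <= Num.truncn r)%N by rewrite truncn_ge_nat.
case: (Num.truncn r) => [|[|k]] // _; set a := r - _ => -[cf df].
move=> [c1 d1 /Ck_holder_continuous c11 /Ck_holder_continuous c12].
move=> [c2 d2 /Ck_holder_continuous c21 /Ck_holder_continuous c22].
have p1 := derive_periodic (1, 0) pf; have p2 := derive_periodic (0, 1) pf.
have [M0 H0] := periodic_bounded cf pf.
have [M1 H1] := periodic_bounded c1 p1; have [M2 H2] := periodic_bounded c2 p2.
have [M11 H11] := periodic_bounded c11 (derive_periodic (1, 0) p1).
have [M12 H12] := periodic_bounded c12 (derive_periodic (0, 1) p1).
have [M21 H21] := periodic_bounded c21 (derive_periodic (1, 0) p2).
have [M22 H22] := periodic_bounded c22 (derive_periodic (0, 1) p2).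
pose M := `|M0| + `|M1| + `|M2| + `|M11| + `|M12| + `|M21| + `|M22|.
have leM h N : (forall x, `|h x : R| <= N) -> `|N| <= M -> forall x, `|h x| <= M.
  by move=> hN NM x; apply: (le_trans (hN x)); apply: (le_trans (ler_norm N)).
have n0 := normr_ge0 M0.
have n1 := normr_ge0 M1.
have n2 := normr_ge0 M2.
have n3 := normr_ge0 M11.
have n4 := normr_ge0 M12.
have n5 := normr_ge0 M21.
have n6 := normr_ge0 M22.
exists (2 * M); apply: (reg2_of_partials (partials_of_derivable df)).
- by apply: leM H0 _; rewrite /M; lra.
- by apply: leM H1 _; rewrite /M; lra.
- by apply: leM H2 _; rewrite /M; lra.
- apply: (lip_of_partials (partials_of_derivable d1)).
    by apply: leM H11 _; rewrite /M; lra.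
  by apply: leM H12 _; rewrite /M; lra.
- apply: (lip_of_partials (partials_of_derivable d2)).
    by apply: leM H21 _; rewrite /M; lra.
  by apply: leM H22 _; rewrite /M; lra.
Qed.

Variable phi : R -> R.
Hypothesis phi_smooth : smooth_circle phi.

Lemma der_smooth n t : der (derive1n n phi) t (derive1n n.+1 phi t).
Proof.
have [_ dn] := phi_smooth; split; first exact: dn.
by rewrite derive1nS derive1E.
Qed.

Lemma smooth_periodic n t : derive1n n phi (t + 1) = derive1n n phi t.
Proof.
elim: n t => [|n IH] t; first by case: phi_smooth => + _; apply.
have h := @der_shift _ _ 1 t _ (der_smooth n (t + 1)).
have := der_ext IH h => -[_ <-].
by have [_ ->] := der_smooth n t.
Qed.

Lemma smooth_periodic_int n t (k : int) : derive1n n phi (t + k%:~R) = derive1n n phi t.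
Proof.
have pos (m : nat) s : derive1n n phi (s + m%:R) = derive1n n phi s.
  by elim: m s => [|m IH] s; rewrite ?addr0 // -natr1 addrA smooth_periodic.
case: k => m; first exact: pos.
by rewrite NegzE rmorphN /= -[in RHS](subrK m.+1%:R t) pos.
Qed.

Lemma smooth_bounded n : exists M, forall t, `|derive1n n phi t| <= M.
Proof.
suff [M HM] : exists M, forall p : R * R, `|derive1n n phi p.1| <= M.
  by exists M => t; exact: (HM (t, 0)).
apply: periodic_bounded; last by move=> k l x; rewrite /= smooth_periodic_int.
move=> x; apply: (@continuous_comp _ _ _ (fun p : R * R => p.1)); first exact: cvg_fst.
exact: der_continuous (der_smooth n _).
Qed.

End PeriodicRegularity.

(** * Coordinates of the flow of V *)

Section FlowCoordinates.
Context {R : realType}.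
Variables (V : R * R -> R * R) (Phi : R -> R * R -> R * R).
Hypothesis HPhi : flow_generated_by V Phi.

Lemma der_Phi1 t x : der (fun s => (Phi s x).1) t (V (Phi t x)).1.
Proof.
have [_ _ _ _ /(_ t x) [Hd Hv]] := HPhi.
have dP : differentiable (fun s => Phi s x) t by exact/derivable1_diffP.
have [df Ef] := is_diff_fst (Phi t x).
have dc : differentiable (fst \o (fun s => Phi s x)) t by exact: differentiable_comp.
split; first by apply/derivable1_diffP.
by rewrite -[fun s => (Phi s x).1]/(fst \o (fun s => Phi s x)) deriveE // diff_comp //= Ef -deriveE // Hv.
Qed.

Lemma der_Phi2 t x : der (fun s => (Phi s x).2) t (V (Phi t x)).2.
Proof.
have [_ _ _ _ /(_ t x) [Hd Hv]] := HPhi.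
have dP : differentiable (fun s => Phi s x) t by exact/derivable1_diffP.
have [df Ef] := is_diff_snd (Phi t x).
have dc : differentiable (snd \o (fun s => Phi s x)) t by exact: differentiable_comp.
split; first by apply/derivable1_diffP.
by rewrite -[fun s => (Phi s x).2]/(snd \o (fun s => Phi s x)) deriveE // diff_comp //= Ef -deriveE // Hv.
Qed.

(** V is the time derivative at 0 of an equivariant flow, whose displacements are periodic. *)
Lemma V_periodic : periodic2 V.
Proof.
move=> k l x; have [P0 _ _ PE dP] := HPhi.
have E y : V y = 'D_1 (fun s => Phi s y) 0.
  by have [_ ->] := dP 0 y; rewrite P0.
rewrite !E; apply: (derive_eq_increments _).2 => r.
by rewrite !PE opprD [X in _ = X]addrACA subrr !addr0.
Qed.

Lemma Phi_continuous_space t : continuous (Phi t).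
Proof.
have [_ _ cP _ _] := HPhi => x.
apply: (@continuous_comp _ _ _ (fun y => (t, y)) (fun p : R * (R * R) => Phi p.1 p.2)).
  apply: differentiable_continuous; apply: differentiable_pair; first exact: differentiable_cst.
  by have [] := @is_diff_id _ _ x.
exact: cP.
Qed.

End FlowCoordinates.

(** * Continuity from Lipschitz and square-root bounds *)

Section ModuliOfContinuity.
Context {R : realType}.

Lemma continuous_eps (U : normedModType R) (f : U -> R) (x : U) :
  (forall e, 0 < e -> exists2 d, 0 < d & forall y, `|x - y| < d -> `|f x - f y| < e) ->
  {for x, continuous f}.
Proof.
move=> H; apply/cvgrPdist_lt => e /H [d d0 Hd].
by apply/nbhs_normP; exists d.
Qed.

Lemma lipschitz_continuous (U : normedModType R) (f : U -> R) L :
  (forall x y, `|f x - f y| <= L * `|x - y|) -> continuous f.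
Proof.
move=> fL x; apply: continuous_eps => e e0.
have L1 : 0 < `|L| + 1 by rewrite ltr_wpDl.
exists (e / (`|L| + 1)); first by rewrite divr_gt0.
move=> y; rewrite ltr_pdivlMr // => H; apply: le_lt_trans H.
apply: (le_trans (fL x y)); rewrite [X in _ <= X]mulrC ler_wpM2r //.
by have := ler_norm L; lra.
Qed.

Lemma sqrt_holder_continuous (U : normedModType R) (f : U -> R) C :
  (forall x y, `|f x - f y| <= C * Num.sqrt `|x - y|) -> continuous f.
Proof.
move=> fC x; apply: continuous_eps => e e0.
have C1 : 0 < `|C| + 1 by rewrite ltr_wpDl.
have q0 : 0 < e / (`|C| + 1) by rewrite divr_gt0.
exists ((e / (`|C| + 1)) ^+ 2); first exact: exprn_gt0.
move=> y H.
have s : Num.sqrt `|x - y| < e / (`|C| + 1).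
  rewrite -(@ltr_pXn2r _ 2) ?nnegrE ?sqrtr_ge0 ?(ltW q0) //.
  by rewrite sqr_sqrtr.
rewrite ltr_pdivlMr // in s; apply: le_lt_trans s.
apply: (le_trans (fC x y)); rewrite [X in _ <= X]mulrC ler_wpM2r ?sqrtr_ge0 //.
by have := ler_norm C; lra.
Qed.

End ModuliOfContinuity.

(** * Invariance of the leaf slope under the inverse map *)

Section LeafSlopeInvariance.
Context {R : realType}.
Notation gold := (@gold R).
Notation lam := (@lam R).
Variables (phi dphi : R -> R) (gamma : R) (u : R * R -> R).
Hypothesis u4 : forall q, `|u q| <= 1 / 4.
Hypothesis uE : u =1 slope_step phi gamma (fun q => gamma * dphi (xcoord q)) u.

Lemma xcoord_inv_map p : xcoord (inv_map phi gamma p) = xcoord (hyp_inv p).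
Proof. by rewrite /inv_map xcoordD [X in _ + X]/xcoord /= subrr mul0r addr0. Qed.

Lemma hyp_map_inv_map p : hyp_map phi gamma (inv_map phi gamma p) = p.
Proof.
rewrite /hyp_map /kick xcoord_inv_map -/(kick phi gamma (hyp_inv p)) /inv_map /=.
rewrite !addrK mulrC divfK; last by rewrite gt_eqF // lam_gt0.
by rewrite mulrC mulKf -?surjective_pairing // gt_eqF // lam_gt0.
Qed.

(** The slope equation read at [inv_map p] expresses the slope there through the one at [p];
    rewritten for [leaf_slope], it is the tangency condition on which the leaf map relies. *)
Lemma leaf_slope_inv p : leaf_slope u (inv_map phi gamma p) *
    (lam + kick_rate gamma (leaf_slope u) dphi p) =
  leaf_slope u p / lam + kick_rate gamma (leaf_slope u) dphi p.
Proof.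
have s5 := @sqrt5_gt2 R; have l0 := @lam_gt0 R; have /andP[l1 l2] := @lam_bounds R.
have := uE (inv_map phi gamma p).
rewrite /slope_step hyp_map_inv_map xcoord_inv_map /kick_rate.
set c := gamma * dphi _; set X := u (inv_map _ _ _) => XE.
have -> : leaf_slope u (inv_map phi gamma p) = X / (X - (2 * gold - 1)) by [].
have u1 := u4 p; have u2 := u4 (inv_map phi gamma p); rewrite -/X in u2.
have n1 := ler_norm (u p); have n2 := ler_norm X.
have -> : leaf_slope u p = u p / (u p - (2 * gold - 1)) by [].
move: (u p) XE u1 n1 => x XE u1 n1.
(* That is, lam - 1/lam = sqrt 5, the only arithmetic fact in the computation. *)
have rel : lam * lam - 1 - lam * (2 * gold - 1) = 0.
  have g2 := @gold_sqr R; rewrite expr2 in g2.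
  rewrite /lam; have -> : (gold + 1) * (gold + 1) - 1 - (gold + 1) * (2 * gold - 1) =
    - (gold * gold - (gold + 1)) by ring.
  by rewrite g2 subrr oppr0.
move: (2 * gold - 1) s5 rel => s s5 rel.
have xs : x - s != 0 by rewrite lt_eqF //; lra.
have Xs : X - s != 0 by rewrite lt_eqF //; lra.
have lx : lam - x != 0 by rewrite gt_eqF //; lra.
have ln : lam != 0 by rewrite gt_eqF.
have sn : s != 0 by rewrite gt_eqF //; lra.
apply: (mulIf Xs).
have -> : X / (X - s) * (lam + c * ((x / (x - s) / lam - lam) / s)) * (X - s) =
  (lam + c * ((x / (x - s) / lam - lam) / s)) * X by rewrite mulrAC divfK // mulrC.
apply/eqP; rewrite -subr_eq0; apply/eqP.
have XcE : X - c = x / (lam * (lam - x)).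
  have -> : X - c = (lam - x)^-1 - lam^-1 by rewrite XE; ring.
  by field; rewrite lx ln.
have h : lam - x / (x - s) / lam = - s * (lam - x) / (x - s).
  have -> : lam - x / (x - s) / lam = - s * (lam - x) / (x - s) +
    x * (lam * lam - 1 - lam * s) / (lam * (x - s)) by field; rewrite ln xs.
  by rewrite rel mulr0 mul0r addr0.
have -> : (lam + c * ((x / (x - s) / lam - lam) / s)) * X -
  (x / (x - s) / lam + c * ((x / (x - s) / lam - lam) / s)) * (X - s) =
  (X - c) * (lam - x / (x - s) / lam) + s * (x / (x - s)) / lam.
  by field; rewrite sn xs ln.
by rewrite h XcE; field; rewrite lx xs ln.
Qed.

End LeafSlopeInvariance.

(** * From orbits of V to the leaf flow and back *)

Section LeafFlow.
Context {R : realType}.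
Notation gold := (@gold R).
Notation lam := (@lam R).
Implicit Types (p q x : R * R) (g : R * R -> R).
Variables (phi dphi : R -> R) (gamma eps K T eta : R) (V : R * R -> R * R).
Variable Phi : R -> R * R -> R * R.
Hypothesis phi_int : forall t (k : int), phi (t + k%:~R) = phi t.
Hypothesis dphiE : forall t, der phi t (dphi t).
Hypothesis gphi : forall t, `|gamma * dphi t| <= 1 / 100.
Hypothesis HV : unit_stable_field (Fmap phi gamma) V.
Hypothesis HPhi : flow_generated_by V Phi.
Notation u := (slope_defect V).
Hypothesis Hkick : reg2 eps (kick phi gamma).
Hypothesis Hkappa : reg2 eps (fun q => gamma * dphi (xcoord q)).
Hypotheses (K0 : 0 < K) (K1 : K <= 1 / 2400) (epsK : eps <= K / 20) (eps_eta : 3 * eps <= eta).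
Hypotheses (T0 : 0 < T) (KT : 24 * K * T <= 1 / 2) (KTeta : 8 * (24 * K) * T <= eta).

Let u4 q : `|u q| <= 1 / 4.
Proof. exact: (slope_defect_le dphiE gphi HV). Qed.

Let uE : u =1 slope_step phi gamma (fun q => gamma * dphi (xcoord q)) u.
Proof. exact: (slope_defect_fixed dphiE HV). Qed.

Let Hu : reg2 K u.
Proof. by apply: (slope_reg2 K0 _ epsK Hkick Hkappa u4 uE); have := K1; lra. Qed.

Let V_unit x : (V x).1 ^+ 2 + (V x).2 ^+ 2 = 1 /\ 0 < (V x).1.
Proof. by have [Es [Eu [_ /(_ x)[h1 h2 _]]]] := HV. Qed.

Let slope_lo x : `|slope V x| <= 2.
Proof.
have := u4 (eigen x); rewrite /slope_defect eigenK => h.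
have /andP[g1 g2] := @gold_bounds R.
by move: h; rewrite !ler_norml => /andP[? ?]; apply/andP; split; lra.
Qed.

Let V2E x : (V x).2 = slope V x * (V x).1.
Proof. by have [_ h] := V_unit x; rewrite /slope divfK // gt_eqF. Qed.

Let V1_ge x : 2 / 5 <= (V x).1.
Proof.
have [h1 h2] := V_unit x; have h3 := slope_lo x.
rewrite leNgt; apply/negP => h4.
have a1 : (V x).1 ^+ 2 < (2 / 5) ^+ 2 by rewrite ltrXn2r ?nnegrE ?ltW.
have a2 : (V x).2 ^+ 2 <= 4 * (V x).1 ^+ 2.
  rewrite V2E exprMn ler_wpM2r ?sqr_ge0 // -real_normK ?num_real //.
  by have -> : 4 = 2 ^+ 2 :> R by [ring]; rewrite lerXn2r ?nnegrE.
lra.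
Qed.

Definition height_rate q := (eigen (V (uneigen q))).2.

Let rateE q : height_rate q = (V (uneigen q)).1 * (u q - (2 * gold - 1)).
Proof. by rewrite /height_rate /eigen /= V2E gold_inv /slope_defect; ring. Qed.

Let rate1E q : (eigen (V (uneigen q))).1 = (V (uneigen q)).1 * u q.
Proof. by rewrite /eigen /= V2E /slope_defect; ring. Qed.

Let u_lt q : u q - (2 * gold - 1) <= - (7 / 4).
Proof. by have := u4 q; have := ler_norm (u q); have := @sqrt5_gt2 R; lra. Qed.

Let rate_le q : height_rate q <= - (1 / 2).
Proof.
rewrite rateE; have h1 := V1_ge (uneigen q); have h2 := u_lt q.
have : 2 / 5 * (7 / 4) <= (V (uneigen q)).1 * - (u q - (2 * gold - 1)).
  by apply: ler_pM; lra.
lra.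
Qed.

Let rate_ratio q : (eigen (V (uneigen q))).1 / height_rate q = leaf_slope u q.
Proof.
rewrite rateE rate1E /leaf_slope; have [_ h] := V_unit (uneigen q).
have h2 := u_lt q; have v0 : (V (uneigen q)).1 != 0 by rewrite gt_eqF.
have w0 : u q - (2 * gold - 1) != 0 by rewrite lt_eqF //; lra.
by rewrite -mulf_div divff // mul1r.
Qed.

Let E t q := eigen (Phi t (uneigen q)).

Let ueE t q : uneigen (E t q) = Phi t (uneigen q).
Proof. by rewrite /E eigenK. Qed.

Let E0 q : E 0 q = q.
Proof. by have [P0 _ _ _ _] := HPhi; rewrite /E P0 uneigenK. Qed.

Let ED s t q : E (s + t) q = E s (E t q).
Proof. by have [_ PD _ _ _] := HPhi; rewrite {1 2}/E ueE PD. Qed.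

Let eigenD p q : eigen (p + q) = eigen p + eigen q :> R * R.
Proof. by rewrite /eigen; apply: injective_projections => /=; ring. Qed.

Let EL t v q : lat v -> E t (q + v) = E t q + v.
Proof.
have [_ _ _ PE _] := HPhi => -[k [l ->]].
by rewrite /E uneigenD eigenK -[(k%:~R, l%:~R)]/(lattice R k l) PE eigenD.
Qed.

Let dE1 q t : der (fun t => (E t q).1) t (eigen (V (uneigen (E t q)))).1.
Proof.
rewrite ueE /E /eigen /=; apply: derD; first exact: (der_Phi2 HPhi).
by apply: derZ; exact: (der_Phi1 HPhi).
Qed.

Let dE2 q t : der (fun t => (E t q).2) t (height_rate (E t q)).
Proof.
rewrite /height_rate ueE /E /eigen /=.
apply: (@der_ext _ (fun t => (Phi t (uneigen q)).2 - gold^-1 * (Phi t (uneigen q)).1)).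
  by move=> s; rewrite [gold^-1 * _]mulrC.
apply: der_eq; first apply: derB; first exact: (der_Phi2 HPhi).
  by apply: derZ; exact: (der_Phi1 HPhi).
by rewrite [gold^-1 * _]mulrC.
Qed.

(* As V is a unit vector, 1 / V_1 = sqrt (1 + s^2), where s = u - gold is its slope. *)
Lemma height_rate_inv q : (height_rate q)^-1 =
  - (Num.sqrt (1 + (u q + - gold) * (u q + - gold)) * ((2 * gold - 1) + - u q)^-1).
Proof.
have [h1 h2] := V_unit (uneigen q); have h3 := u_lt q.
have sE : u q + - gold = slope V (uneigen q) by rewrite /slope_defect addrK.
rewrite rateE sE; set s := slope V (uneigen q).
have nz : 0 <= 1 + s * s by have := sqr_ge0 s; rewrite expr2; lra.
have V1s : (V (uneigen q)).1 * Num.sqrt (1 + s * s) = 1.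
  have p0 : 0 <= (V (uneigen q)).1 * Num.sqrt (1 + s * s).
    by rewrite mulr_ge0 ?sqrtr_ge0 // ltW.
  apply/eqP; rewrite -(@eqrXn2 _ 2) // expr1n exprMn sqr_sqrtr //.
  by move: h1; rewrite (V2E (uneigen q)) -/s => h1; rewrite -[X in _ == X]h1; apply/eqP; ring.
have v0 : (V (uneigen q)).1 != 0 by rewrite gt_eqF.
have w0 : u q - (2 * gold - 1) != 0 by rewrite lt_eqF //; lra.
have w1 : 2 * gold - 1 - u q != 0 by rewrite gt_eqF //; lra.
have -> : Num.sqrt (1 + s * s) = (V (uneigen q)).1^-1.
  by apply: (mulfI v0); rewrite V1s divff.
move: (2 * gold - 1) w0 w1 => c5 w0 w1.
by field; rewrite v0 w0 w1.
Qed.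

Lemma height_rate_inv_reg2 : exists Kb, reg2 Kb (fun q => (height_rate q)^-1).
Proof.
have H1 : reg2 (K + `|- gold|) (fun q => u q + - gold) by apply: reg2_add Hu (reg2_cst _).
have H2 := reg2_add (reg2_cst 1) (reg2_mul H1 H1).
have H3 : reg2 (`|2 * gold - 1| + K) (fun p => 2 * gold - 1 + - u p).
  by apply: reg2_add; [exact: reg2_cst|exact: reg2_opp].
have H4 q : 1 <= 2 * gold - 1 + - u q by have := u_lt q; lra.
have H5 q : 1 <= 1 + (u q + - gold) * (u q + - gold).
  by have := sqr_ge0 (u q + - gold); rewrite expr2; lra.
have H6 := reg2_opp (reg2_mul (reg2_sqrt H5 H2) (reg2_inv ltr01 H4 H3)).
rewrite (_ : (fun q => (height_rate q)^-1) = fun q =>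
  - (Num.sqrt (1 + (u q + - gold) * (u q + - gold)) * ((2 * gold - 1) + - u q)^-1)).
  by eexists; exact: H6.
by apply/funext => q; rewrite height_rate_inv.
Qed.

Let speed_le x s t : norm1 (Phi s x - Phi t x) <= 2 * `|s - t|.
Proof.
have V1 y : `|(V y).1| <= 1 /\ `|(V y).2| <= 1.
  have [h1 _] := V_unit y; have := sqr_ge0 (V y).1; have := sqr_ge0 (V y).2.
  by split; rewrite -(@expr_le1 _ 2) // real_normK ?num_real //; lra.
have h1 := @mvt_abs _ (fun s => (Phi s x).1) _ t s 1
  (fun r _ => der_Phi1 HPhi r x) (fun r _ => (V1 _).1).
have h2 := @mvt_abs _ (fun s => (Phi s x).2) _ t s 1
  (fun r _ => der_Phi2 HPhi r x) (fun r _ => (V1 _).2).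
by rewrite /norm1 /=; lra.
Qed.

Lemma orbit_lipschitz (Kg : R) g x s t : reg2 Kg g ->
  `|g (Phi s x) - g (Phi t x)| <= 2 * Kg * `|s - t|.
Proof.
move=> Hg; apply: (le_trans (reg2_lip _ _ Hg)).
have -> : 2 * Kg * `|s - t| = Kg * (2 * `|s - t|) by ring.
by apply: ler_wpM2l; [exact: reg2_ge0 Hg|exact: speed_le].
Qed.

Hypothesis dichotomy : forall Psi Fi, renormalizable_flow Psi Fi T eta ->
  forall (Kg : R) G, leaf_continuous Psi G -> lat_periodic lat G -> nrm Kg G ->
  leaf_growth Psi G \/ leaf_coboundary Psi lat G.

Lemma orbit_growth_or_coboundary (Kg : R) g : reg2 Kg g -> periodic2 g ->
  (exists c C : R, 0 < c /\
    ((forall x t, 0 <= t -> c * t - C <= itg (fun s => g (Phi s x)) t) \/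
     (forall x t, 0 <= t -> c * t - C <= - itg (fun s => g (Phi s x)) t))) \/
  (exists (h : R * R -> R) (C : R),
    [/\ periodic2 h, forall t x, h (Phi t x) - h x = itg (fun s => g (Phi s x)) t,
      forall x, `|h x| <= C & forall x y, `|h x - h y| <= C * Num.sqrt `|x - y|]).
Proof.
move=> Hg pg.
have half0 : 0 < 1 / 2 :> R by lra.
have [Psi [Psi0 PsiD PsiL [Psi2 EPsi] dPsi']] 
  := @time_change R E (fun q => (eigen (V (uneigen q))).1) height_rate (1 / 2)
       E0 ED EL dE1 dE2 half0 rate_le.
have dPsi p t : der (fun t => (Psi t p).1) t (leaf_slope u (Psi t p)).
  by apply: der_eq (dPsi' p t) _; rewrite rate_ratio.
have K100 : K <= 1 / 100 by have := K1; lra.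
have Hsigma : reg2 (24 * K) (leaf_slope u) by exact: (leaf_slope_reg2 K0 K100 Hu).
have kap1 : 24 * K <= 1 / 100 by have := K1; lra.
have eps1 : eps <= 1 / 100 by have := epsK; have := K1; lra.
have rf := leaf_renormalizable phi_int Psi0 PsiD PsiL Psi2 dPsi Hsigma dphiE gphi
  (leaf_slope_inv u4 uE) (ltW T0) KT KTeta eps_eta kap1 eps1 Hkick.
(* Dividing by the speed of the height turns integrals over orbit time into integrals over
   height. *)
pose G q := g (uneigen q) * (height_rate q)^-1.
have [Kb Hb] := height_rate_inv_reg2.
have HG := reg2_mul (reg2_uneigen Hg) Hb; rewrite -/G in HG; move: (6 * _ * _) HG => KG HG.
have KG0 := reg2_ge0 HG.
have cG : leaf_continuous Psi G.
  move=> p; apply: (@lipschitz_continuous _ R _ (KG * (24 * K + 1))) => r s.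
  apply: (le_trans (reg2_lip _ _ HG)); rewrite -mulrA; apply: ler_wpM2l => //.
  have [s1 _ _] := Hsigma.
  have := @mvt_abs _ (fun r => (Psi r p).1) _ s r (24 * K) (fun t _ => dPsi p t) (fun t _ => s1 _).
  rewrite /norm1 /= !Psi2.
  have -> : p.2 + r - (p.2 + s) = r - s by ring.
  by move=> h; rewrite mulrDl mul1r lerD2r.
have pG : lat_periodic lat G.
  move=> v p [k [l ->]]; rewrite /G /height_rate uneigenD eigenK.
  by rewrite -[(k%:~R, l%:~R)]/(lattice R k l) pg (V_periodic HPhi).
have cgP x : continuous (fun s => g (Phi s x)).
  apply: (@lipschitz_continuous _ R _ (2 * Kg)) => s t; exact: orbit_lipschitz.
have link x t : itg (fun s => g (Phi s x)) t =
    leafint Psi G (eigen x) ((E t (eigen x)).2 - (eigen x).2).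
  pose b t := (E t (eigen x)).2 - (eigen x).2.
  have db s : der b s (height_rate (E s (eigen x))).
    by apply: der_eq; [apply: derB; [exact: dE2|exact: der_cst]|rewrite subr0].
  rewrite (@itg_primitive _ _ (fun s => leafint Psi G (eigen x) (b s))) //.
    by rewrite {2}/b E0 subrr leafint0 subr0.
  move=> s; apply: der_eq.
    apply: (@der_comp _ (leafint Psi G (eigen x)) b); first exact: db.
    exact: (der_leafint _ _ cG).
  rewrite /b -EPsi /G ueE eigenK -mulrA mulVf ?mulr1 //.
  by have := rate_le (E s (eigen x)); apply: contraTneq => ->; rewrite -ltNge; lra.
have fall x t : 0 <= t -> t / 2 <= - ((E t (eigen x)).2 - (eigen x).2).
  move=> t0; have := mvt_decr (dE2 (eigen x)) (fun s => rate_le (E s (eigen x))) t0.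
  by rewrite E0; lra.
(* Heights decrease along orbits of V, so a forward leaf integral runs from the end of an orbit back
   to its start. This changes the sign and exchanges the two cases of growth. *)
have back x t : leafint Psi G (E t (eigen x)) (- ((E t (eigen x)).2 - (eigen x).2)) =
    - itg (fun s => g (Phi s x)) t.
  rewrite link {1}EPsi (leafint_shift PsiD) // addNr.
  by rewrite leafint0 sub0r.
case: (dichotomy rf cG pG (reg2_nrm HG)) => [[c [C [c0 gr]]]|[h [C [hL hc hC hH]]]].
  left; exists (c / 2), C; split; first by rewrite divr_gt0.
  have half x t : 0 <= t -> c / 2 * t <= c * - ((E t (eigen x)).2 - (eigen x).2).
    by move=> /(fall x) H; have := ler_wpM2l (ltW c0) H; lra.
  have pos x t : 0 <= t -> 0 <= - ((E t (eigen x)).2 - (eigen x).2).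
    by move=> t0; have := fall x t t0; lra.
  case: gr => gr; [right|left] => x t t0; have := gr (E t (eigen x)) _ (pos x t t0);
    rewrite back; have := half x t t0; lra.
right; exists (fun x => h (eigen x)), (3 * C).
have C0 : 0 <= C by apply: le_trans (hC 0).
split.
- move=> k l x; rewrite eigenD; apply: hL.
  by exists k, l.
- move=> t x; rewrite link -hc -EPsi; congr (h _ - _).
  by rewrite /E eigenK.
- by move=> x; apply: (le_trans (hC _)); lra.
- move=> x y; apply: (le_trans (hH _ _)); rewrite [3 * C]mulrC -mulrA.
  apply: ler_wpM2l => //.
  have -> : 3 = Num.sqrt (3 ^+ 2) :> R by rewrite sqrtr_sqr ger0_norm.
  rewrite -sqrtrM ?exprn_ge0 // ler_wsqrtr //.
  have d1 : `|y.1 - x.1| <= `|x - y| by rewrite distrC [`|x - y|]prod_normE le_max lexx.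
  have d2 : `|y.2 - x.2| <= `|x - y| by rewrite distrC [`|x - y|]prod_normE le_max lexx orbT.
  have /andP[g1 g2] := @gold_bounds R.
  have a1 : `|(eigen y).1 - (eigen x).1| <= `|y.2 - x.2| + gold * `|y.1 - x.1|.
    have -> : (eigen y).1 - (eigen x).1 = (y.2 - x.2) + gold * (y.1 - x.1).
      by rewrite /eigen /=; ring.
    by apply: (le_trans (ler_normD _ _)); rewrite normrM (gtr0_norm gold_gt0).
  have gi : 0 < gold^-1 by rewrite invr_gt0 gold_gt0.
  have a2 : `|(eigen y).2 - (eigen x).2| <= `|y.2 - x.2| + gold^-1 * `|y.1 - x.1|.
    have -> : (eigen y).2 - (eigen x).2 = (y.2 - x.2) - gold^-1 * (y.1 - x.1).
      by rewrite /eigen /=; ring.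
    by apply: (le_trans (ler_normB _ _)); rewrite normrM (gtr0_norm gi).
  have g3 : gold^-1 <= 1 by rewrite gold_inv; lra.
  have b1 : gold * `|y.1 - x.1| <= 2 * `|x - y| by apply: ler_pM => //; lra.
  have b2 : gold^-1 * `|y.1 - x.1| <= 1 * `|x - y| by apply: ler_pM => //; lra.
  have n0 := normr_ge0 (x - y); rewrite expr2; lra.
Qed.

End LeafFlow.

(** * The Hoelder class and the choice of gamma *)

Section Conclusion.
Context {R : realType}.

(** At distances up to 1 the square root lies below the power s, and beyond 1 the sup bound
    suffices. *)
Lemma C_torus_of_sqrt_holder (h : R * R -> R) (C s : R) : periodic2 h ->
  (forall x, `|h x| <= C) -> (forall x y, `|h x - h y| <= C * Num.sqrt `|x - y|) ->
  0 < s <= 1 / 2 -> C_torus s h.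
Proof.
move=> ph hC hH /andP[s0 s2]; have C0 : 0 <= C by apply: le_trans (hC 0).
split=> //; first exact: ltW.
have -> : Num.truncn s = 0%N by apply/truncn0Pn; rewrite -ltNge; lra.
rewrite subr0; split; first exact: sqrt_holder_continuous hH.
exists (2 * C) => x y; have [xy1|xy1] := leP `|x - y| 1.
  have [->|xy0] := eqVneq x y.
    by rewrite !subrr normr0 !mulr_ge0 // powR_ge0.
  have n0 : 0 < `|x - y| by rewrite normr_gt0 subr_eq0.
  apply: (le_trans (hH x y)); apply: ler_pM; rewrite ?sqrtr_ge0 //; first lra.
  by rewrite -powR12_sqrt // ger_powR ?n0 ?xy1 //; lra.
apply: (@le_trans _ _ (2 * C)).
  by apply: (le_trans (ler_normB _ _)); have := hC x; have := hC y; lra.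
rewrite ler_peMr ?mulr_ge0 //.
apply: (@le_trans _ _ (1 `^ s)); first by rewrite powR1.
apply: ge0_ler_powR; rewrite ?nnegrE //; exact: ltW.
Qed.

End Conclusion.

Unset Implicit Arguments.

Theorem corollary5p12 (R : realType) (phi : R -> R)
    (phi_smooth : smooth_circle phi)
    (phi_mean0 : \int[lebesgue_measure]_(x in `[0, 1]) phi x = 0) :
  exists r0 : R, forall r : R, r0 <= r ->
  exists gamma0 c : R, [/\ 0 < gamma0, 0 < c &
    forall gamma : R, 0 <= gamma < gamma0 ->
    forall V : R * R -> R * R, unit_stable_field (Fmap phi gamma) V ->
    forall Phi : R -> R * R -> R * R, flow_generated_by V Phi ->
    forall O : (R * R -> R) -> R, leading_obstruction Phi O ->
    forall g : R * R -> R, C_torus r g -> O g = 0 ->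
    coboundary (1 / 2 - c * gamma) Phi g].
Proof.
have [T [eta [T0 eta0 dich]]] := @renormalizable_flow_cohomology R.
(* Three derivatives are bounded because the slope equation contains phi', and its regularity class
   costs two more. *)
have [M0 H0] := smooth_bounded phi_smooth 0; have [M1 H1] := smooth_bounded phi_smooth 1.
have [M2 H2] := smooth_bounded phi_smooth 2; have [M3 H3] := smooth_bounded phi_smooth 3.
pose M := 1 + `|M0| + `|M1| + `|M2| + `|M3|.
have n0 := normr_ge0 M0; have n1 := normr_ge0 M1.
have n2 := normr_ge0 M2; have n3 := normr_ge0 M3.
have M1' : 1 <= M by rewrite /M; lra.
have bound n N : (forall t, `|derive1n n phi t| <= N) -> `|N| <= M ->
    forall t, `|derive1n n phi t| <= M.
  by move=> HN NM t; apply: (le_trans (HN t)); apply: (le_trans (ler_norm N)).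
have {}H0 := bound _ _ H0 (ltac:(rewrite /M; lra)).
have {}H1 := bound _ _ H1 (ltac:(rewrite /M; lra)).
have {}H2 := bound _ _ H2 (ltac:(rewrite /M; lra)).
have {}H3 := bound _ _ H3 (ltac:(rewrite /M; lra)).
(* The leaf slope has regularity constant 24 K. The three terms ensure 24 K <= 1/100, 24 K T <= 1/2
   and 8 * 24 K T <= eta. *)
pose K := Num.min (1 / 2400) (Num.min (1 / (48 * T)) (eta / (192 * T))).
have T48 : 0 < 48 * T by lra.
have T192 : 0 < 192 * T by lra.
have K0 : 0 < K.
  rewrite /K !lt_min; apply/and3P; split; first lra.
    exact: divr_gt0 ltr01 T48.
  exact: divr_gt0 eta0 T192.
have K1 : K <= 1 / 2400 by rewrite /K ge_min lexx.
have KT1 : K * (48 * T) <= 1.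
  by rewrite -(ler_pdivlMr _ _ T48) /K !ge_min lexx !orbT.
have KT2 : K * (192 * T) <= eta.
  by rewrite -(ler_pdivlMr _ _ T192) /K !ge_min lexx !orbT.
(* K / 20 is the margin in [slope_step_reg2], and eta / 3 the one in [return_drift_nrm]. *)
pose del := Num.min (K / 20) (eta / 3).
have del0 : 0 < del by rewrite /del lt_min; apply/andP; split; lra.
have delK : del <= K / 20 by rewrite /del ge_min lexx.
have dele : del <= eta / 3 by rewrite /del ge_min lexx orbT.
have M18 : 0 < 18 * M by lra.
(* Two derivatives of g suffice for [C2_reg2]. The transfer function is 1/2-Hoelder for every
   admissible gamma, so c = 1 is a free choice; gamma < 1/4 keeps the exponent positive. *)
exists 2 => r r2; exists (del / (18 * M)), 1; split=> //; first by rewrite divr_gt0.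
move=> gamma /andP[g0 g1] V HV Phi HPhi O [kap [mu [kap0 mu_inv OE]]] g Cg Og.
rewrite ltr_pdivlMr // in g1.
have gM : gamma <= gamma * M by rewrite ler_peMr.
have g_small : gamma < 1 / 4 by lra.
have gphi t : `|gamma * derive1n 1 phi t| <= 1 / 100.
  rewrite normrM (ger0_norm g0); have : gamma * `|derive1n 1 phi t| <= gamma * M.
    by rewrite ler_wpM2l.
  lra.
have Hkick : reg2 (gamma * (18 * M)) (kick phi gamma).
  exact: (reg2_scale g0 (reg2_xcoord (der_smooth phi_smooth 0) (der_smooth phi_smooth 1)
    H0 H1 H2)).
have Hkappa : reg2 (gamma * (18 * M)) (fun q => gamma * derive1n 1 phi (xcoord q)).
  exact: (reg2_scale g0 (reg2_xcoord (der_smooth phi_smooth 1) (der_smooth phi_smooth 2)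
    H1 H2 H3)).
have epsK : gamma * (18 * M) <= K / 20 by lra.
have eps_eta : 3 * (gamma * (18 * M)) <= eta by lra.
have KT : 24 * K * T <= 1 / 2 by lra.
have KTeta : 8 * (24 * K) * T <= eta by lra.
have [_ pg Ckg] := Cg; have cg := Ck_holder_continuous Ckg.
have [Kg Hg] := C2_reg2 r2 Cg.
have int0 : \int[mu]_(x in [set: R * R]) g x = 0.
  by apply/eqP; have := OE g cg pg; rewrite Og => /eqP; rewrite eq_sym mulf_eq0 (negbTE kap0).
have cgP f N : reg2 N f -> forall x, continuous (fun s => f (Phi s x)).
  move=> Hf x; apply: (@lipschitz_continuous _ R _ (2 * N)) => s t.
  exact: (orbit_lipschitz HV HPhi).
have cP := Phi_continuous_space HPhi.
have [[c [C [c0 growth]]]|[h [C [ph hE hC hH]]]] := orbit_growth_or_coboundary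
  (smooth_periodic_int phi_smooth 0) (der_smooth phi_smooth 0) gphi HV HPhi Hkick Hkappa
  K0 K1 epsK eps_eta T0 KT KTeta dich Hg pg; last first.
  exists h; split; last by move=> t x; rewrite hE itgE.
  by apply: C_torus_of_sqrt_holder ph hC hH _; apply/andP; split; lra.
have [gB _ _] := Hg; exfalso; case: growth => growth.
  exact: (no_linear_growth cP mu_inv cg pg gB (cgP _ _ Hg)
    (fun x s t => orbit_lipschitz HV HPhi x s t Hg) int0 c0 growth).
have Hg' := reg2_opp Hg; have [gB' _ _] := Hg'.
have cg' : continuous (fun x => - g x) by move=> x; apply: continuousN; exact: cg.
have pg' : periodic2 (fun x => - g x) by move=> k l x; rewrite pg.
have int0' : \int[mu]_(x in [set: R * R]) - g x = 0.
  have -> : (fun x => - g x) = (fun x => -1 * g x) by apply/funext => x; rewrite mulN1r.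
  rewrite RintegralZl //; last exact: bounded_integrable2 gB.
  by rewrite int0 mulr0.
apply: (no_linear_growth cP mu_inv cg' pg' gB' (cgP _ _ Hg')
  (fun x s t => orbit_lipschitz HV HPhi x s t Hg') int0' c0).
move=> x t t0; apply: (le_trans (growth x t t0)).
rewrite (@itg_primitive _ (fun s => - g (Phi s x)) (fun t => - itg (fun s => g (Phi s x)) t)).
- by rewrite itg0 oppr0 subr0.
- exact: (cgP _ _ Hg').
- by move=> s; apply: derN; apply: der_itg; exact: (cgP _ _ Hg).
Qed.
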